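(* Let $C_0\subset\mathbb{R}^2$ be a finite union of half-lines meeting at $0$, and let $\Gamma\subset\mathbb{R}^2\times[0,\infty)$ be the world-sheet of a self-similar expanding solution of the network curve-shortening flow with initial condition $C_0$. Let $X$ be the parabolic blowup of $\mathbb{R}^2\times[0,\infty)$ at $x=y=t=0$. The closure of $\Gamma\setminus\{(0,0,0)\}$ in $X$ is a union of a finite number of smooth surfaces, each with boundary and corners, which intersect along a finite number of smooth curves. Each of these curves of intersection is an orbit of the family of dilations $D_\lambda(x,y,t)=(\lambda x,\lambda y,\lambda^2t)$, $\lambda>0$.
   Context: A planar network is a finite union of embedded arcs, properly embedded half-lines and properly embedded lines, all at least $C^2$, any two distinct ones being disjoint or intersecting only at common boundary points (one, or both, of the boundary points of each). Points where curves meet are interior vertices. A network is regular if each interior vertex is trivalent and the three curves meet there at equal angles $2\pi/3$. A solution of the network curve-shortening flow is a family $\gamma_t$, $t\ge0$, of networks, regular for every $t>0$ and without boundary points (endpoints of exactly one curve) in $\mathbb{R}^2$, each of whose curves moves for $t>0$ with normal velocity equal to its curvature: $(\partial_tF_t)\cdot\nu=\kappa$ for smooth local parametrizations $F_t$, where $\nu$ is a unit normal and $\kappa\nu$ the curvature vector. Its world-sheet is $\Gamma=\bigcup_{t\ge0}\gamma_t\times\{t\}$, and it is self-similar (expanding) if $D_\lambda(\Gamma)=\Gamma$ for all $\lambda>0$. It has initial condition $C_0$ if $\gamma_0=C_0$ and the length measures of $\gamma_t$ converge weakly to that of $C_0$ as $t\searrow0$. Parabolic blowup: $X$ is the manifold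 with corners of codimension two which is the disjoint union of $(\mathbb{R}^2\times[0,\infty))\setminus\{(0,0,0)\}$ and a new boundary hypersurface $F$ whose points are the orbits of the dilations $D_\lambda$. With $S=\{(x,y,t):t\ge0,\ (x^2+y^2)^2+t^2=1\}$, the smooth structure is that of $[0,\infty)\times S$, where $(\lambda,\omega)$ with $\lambda>0$ is identified with $D_\lambda(\omega)$ and $F=\{\lambda=0\}$. Its codimension one boundary hypersurfaces are $F$ (diffeomorphic to a closed half-sphere) and $T$, the closure in $X$ of $\{t=0\}\setminus\{(0,0,0)\}$. An orbit of the dilations in $X$ is understood to include its limit point on $F$ as $\lambda\searrow0$. *)

(* Defs.v *)
From HB Require Import structures.
From mathcomp Require Import all_boot all_order all_algebra.
From mathcomp Require Import all_classical all_reals all_analysis.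

Set Implicit Arguments.
Unset Strict Implicit.
Unset Printing Implicit Defensive.

Import Order.TTheory GRing.Theory Num.Theory.
Import numFieldNormedType.Exports.

Local Open Scope ring_scope.
Local Open Scope classical_set_scope.

Section Smoothness.
Context {R : realType} {V W : normedModType R}.

Fixpoint iter_derive (vs : seq V) (f : V -> W) : V -> W :=
  if vs is v :: vs' then 'D_v (iter_derive vs' f) else f.

(* On an open set U this is C^k in the usual sense: all iterated directional
   derivatives of order at most k exist and are continuous. *)
Definition Ck (k : nat) (U : set V) (f : V -> W) : Prop :=
  forall (vs : seq V) (x : V), (size vs <= k)%N -> U x ->
    {for x, continuous (iter_derive vs f)} /\
    ((size vs < k)%N -> forall v, derivable (iter_derive vs f) x v).

Definition Ck_near (k : nat) (A : set V) (f : V -> W) : Prop :=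
  exists U : set V, [/\ open U, A `<=` U & Ck k U f].

Definition smooth (U : set V) (f : V -> W) : Prop := forall k, Ck k U f.

Definition smooth_near (A : set V) (f : V -> W) : Prop :=
  exists U : set V, [/\ open U, A `<=` U & smooth U f].

End Smoothness.

Section Plane.
Context {R : realType}.

Definition dot (v w : 'rV[R]_2) : R := \sum_(i < 2) v 0 i * w 0 i.

(* The library norm on row vectors is the sup norm. *)
Definition enorm (v : 'rV[R]_2) : R := Num.sqrt (dot v v).

Definition rot90 (v : 'rV[R]_2) : 'rV[R]_2 :=
  \row_(i < 2) (if i == 0 then - v 0 1 else v 0 0).

Definition unit_tangent (c : R -> 'rV[R]_2) (s : R) : 'rV[R]_2 :=
  (enorm (derive1 c s))^-1 *: derive1 c s.

Definition unit_normal (c : R -> 'rV[R]_2) (s : R) : 'rV[R]_2 :=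
  rot90 (unit_tangent c s).

(* Component along unit_normal c s of the curvature vector of c, which is the
   normal part of c'' / |c'|^2. *)
Definition curvature (c : R -> 'rV[R]_2) (s : R) : R :=
  dot (derive1 (derive1 c) s) (unit_normal c s) / enorm (derive1 c s) ^+ 2.

End Plane.

Inductive curve_kind := Arc | HalfLine | Line.

Section Networks.
Variable R : realType.

Definition curve_dom (k : curve_kind) : set R :=
  match k with
  | Arc => `[0, 1]
  | HalfLine => `[0, +oo[
  | Line => setT
  end.

Definition curve_end (k : curve_kind) (s : R) : Prop :=
  match k with
  | Arc => s = 0 \/ s = 1
  | HalfLine => s = 0
  | Line => False
  end.

(* Values of the parametrizations outside [curve_dom] are irrelevant. *)
Record network := Network {
  net_size : nat;
  net_kind : 'I_net_size -> curve_kind;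
  net_curve : 'I_net_size -> R -> 'rV[R]_2 }.

(* Properness is automatic for arcs; together with injectivity it makes c a
   homeomorphism onto its image. *)
Definition proper_embedding (k : curve_kind) (c : R -> 'rV[R]_2) : Prop :=
  [/\ Ck_near 2 (curve_dom k) c,
      {in curve_dom k &, injective c},
      (forall s, curve_dom k s -> derive1 c s != 0) &
      forall B : R, exists B' : R, forall s,
        curve_dom k s -> enorm (c s) <= B -> `|s| <= B'].

Definition curve_trace (N : network) (i : 'I_(net_size N)) : set 'rV[R]_2 :=
  net_curve i @` curve_dom (net_kind i).

Definition endpoint (N : network) (i : 'I_(net_size N)) (p : 'rV[R]_2) : Prop :=
  exists2 s, curve_end (net_kind i) s & net_curve i s = p.

Definition is_network (N : network) : Prop :=
  (forall i : 'I_(net_size N), proper_embedding (net_kind i) (net_curve i)) /\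
  (forall (i j : 'I_(net_size N)) p, i != j ->
     curve_trace i p -> curve_trace j p -> endpoint i p /\ endpoint j p).

Definition net_support (N : network) : set 'rV[R]_2 :=
  \bigcup_(i : 'I_(net_size N)) curve_trace i.

(* Arcs are injective, so this counts curve ends at p. *)
Definition valence (N : network) (p : 'rV[R]_2) : nat :=
  #|[pred i : 'I_(net_size N) | `[< endpoint i p >]]|.

Definition interior_vertex (N : network) (p : 'rV[R]_2) : Prop :=
  exists i j : 'I_(net_size N), [/\ i != j, curve_trace i p & curve_trace j p].

Definition boundary_point (N : network) (p : 'rV[R]_2) : Prop :=
  valence N p = 1%N.

(* For an end parameter s, the unit tangent pointing into the curve. *)
Definition inward_tangent (N : network) (i : 'I_(net_size N)) (s : R) :
    'rV[R]_2 :=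
  (if s == 0 then 1 else -1) *: unit_tangent (net_curve i) s.

Definition regular (N : network) : Prop :=
  forall p, interior_vertex N p ->
    valence N p = 3%N /\
    forall (i j : 'I_(net_size N)) (s s' : R), i != j ->
      curve_end (net_kind i) s -> net_curve i s = p ->
      curve_end (net_kind j) s' -> net_curve j s' = p ->
      dot (inward_tangent i s) (inward_tangent j s') = cos (2 * pi / 3).

(* Integral of f with respect to the length measure of N. *)
Definition length_integral (N : network) (f : 'rV[R]_2 -> R) : R :=
  \sum_(i < net_size N)
    \int[@lebesgue_measure R]_(s in curve_dom (net_kind i))
      (f (net_curve i s) * enorm (derive1 (net_curve i) s)).

(* c restricted to the interval J is a regular injective parametrization of a
   relatively open part of A. *)
Definition local_parametrization (J : set R) (c : R -> 'rV[R]_2)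
    (A : set 'rV[R]_2) : Prop :=
  [/\ {in J &, injective c},
      (forall s, J s -> derive1 c s != 0) &
      exists2 W : set 'rV[R]_2, open W & c @` J = A `&` W].

(* J is half-open exactly when p is an end of the curve: otherwise the image
   would not be relatively open. *)
Definition moves_by_curvature (gamma : R -> network) : Prop :=
  forall (t0 : R), 0 < t0 -> forall (i : 'I_(net_size (gamma t0))) p, curve_trace i p ->
  exists (delta : R) (J : set R) (F : R -> R -> 'rV[R]_2),
    [/\ 0 < delta <= t0,
        (J = `](- delta), delta[%classic \/ J = `[0, delta[%classic),
        (F 0 t0 = p /\
         smooth_near (J `*` `]t0 - delta, t0 + delta[)
           (fun z : R * R => F z.1 z.2)),
        local_parametrization J (F^~ t0) (curve_trace i) &
        forall t : R, t0 - delta < t < t0 + delta ->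
          (exists j : 'I_(net_size (gamma t)),
             local_parametrization J (F^~ t) (curve_trace j)) /\
          (forall s, J s ->
             dot (derive1 (F s) t) (unit_normal (F^~ t) s) =
             curvature (F^~ t) s)].

(* Only the values of gamma at t >= 0 matter. *)
Definition network_flow (gamma : R -> network) : Prop :=
  [/\ forall t, 0 <= t -> is_network (gamma t),
      forall t, 0 < t -> regular (gamma t),
      forall t, 0 < t -> forall p, ~ boundary_point (gamma t) p &
      moves_by_curvature gamma].

Definition world_sheet (gamma : R -> network) : set ('rV[R]_2 * R) :=
  [set q | 0 <= q.2 /\ net_support (gamma q.2) q.1].

Definition dilation (lambda : R) (q : 'rV[R]_2 * R) : 'rV[R]_2 * R :=
  (lambda *: q.1, lambda ^+ 2 * q.2).

Definition self_similar (Gamma : set ('rV[R]_2 * R)) : Prop :=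
  forall lambda, 0 < lambda -> dilation lambda @` Gamma = Gamma.

Definition half_lines (m : nat) (u : 'I_m -> 'rV[R]_2) : set 'rV[R]_2 :=
  [set p | exists k s, 0 <= s /\ p = s *: u k].

(* Integral of f with respect to the length measure of [half_lines u], for
   pairwise distinct unit vectors u k. *)
Definition half_lines_integral (m : nat) (u : 'I_m -> 'rV[R]_2)
    (f : 'rV[R]_2 -> R) : R :=
  \sum_(k < m) \int[@lebesgue_measure R]_(s in `[0, +oo[) f (s *: u k).

Definition initial_condition (gamma : R -> network) (m : nat)
    (u : 'I_m -> 'rV[R]_2) : Prop :=
  net_support (gamma 0) = half_lines u /\
  forall f : 'rV[R]_2 -> R, continuous f ->
    (exists B : R, forall p, B < enorm p -> f p = 0) ->
    length_integral (gamma t) f @[t --> 0^'+] --> half_lines_integral u f.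

End Networks.

Section Blowup.
Variable R : realType.

Definition half_sphere : set ('rV[R]_2 * R) :=
  [set w | 0 <= w.2 /\ dot w.1 w.1 ^+ 2 + w.2 ^+ 2 = 1].

(* The model [0, oo) x S of X. It is a closed subset of R x (R^2 x R) and a
   submanifold with corners there, so its topology and smooth structure are the
   induced ones. *)
Definition blowup : set (R * ('rV[R]_2 * R)) :=
  [set q | 0 <= q.1 /\ half_sphere q.2].

(* The part of X away from F lying over A. *)
Definition blowup_lift (A : set ('rV[R]_2 * R)) : set (R * ('rV[R]_2 * R)) :=
  [set q | [/\ blowup q, 0 < q.1 & A (dilation q.1 q.2)]].

Definition blowup_closure (A : set ('rV[R]_2 * R)) :
    set (R * ('rV[R]_2 * R)) :=
  closure (blowup_lift A) `&` blowup.

(* For q <> 0 the closure adds to the orbit of q exactly its limit on F. *)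
Definition blowup_orbit (q : 'rV[R]_2 * R) : set (R * ('rV[R]_2 * R)) :=
  blowup_closure [set dilation lambda q | lambda in [set lambda | 0 < lambda]].

Definition corner (k : nat) : set 'rV[R]_k := [set v | forall i, 0 <= v 0 i].

(* M is an embedded k-dimensional smooth submanifold with boundary and corners:
   near each of its points it is parametrized by a relatively open subset
   U `&` corner k of [0, oo)^k. The last clause says that the inverse of the
   chart phi is continuous and that its image is relatively open in M. *)
Definition corner_submanifold (k : nat) (V : normedModType R) (M : set V) :
    Prop :=
  forall p, M p -> exists (U : set 'rV[R]_k) (phi : 'rV[R]_k -> V),
    [/\ open U /\ smooth U phi,
        (phi @` (U `&` @corner k)) p,
        {in U `&` @corner k &, injective phi},
        (forall x, U x -> corner x -> forall v : 'rV[R]_k, v != 0 -> 'D_v phi x != 0) &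
        forall U' : set 'rV[R]_k, open U' -> U' `<=` U ->
          exists2 W : set V, open W & phi @` (U' `&` @corner k) = M `&` W].

Definition smooth_surface (M : set (R * ('rV[R]_2 * R))) : Prop :=
  [/\ M `<=` blowup, closed M, M !=set0, connected M & corner_submanifold 2 M].

Definition smooth_curve (E : set (R * ('rV[R]_2 * R))) : Prop :=
  [/\ E `<=` blowup, closed E, E !=set0, connected E & corner_submanifold 1 E].

End Blowup.

(* Main.v *)
(* Write each curve of [gamma 1] in terms of its tangential and normal components
   w = <x, T>, n = <x, N>.  Comparing the curve with the motion of a point under
   the flow and under dilation gives kappa = n / 2, hence n e^{|x|^2/4} is constant
   and w is increasing.  So along an end |x| increases to infinity and, with the
   parabolic coordinate tau = 1 / |x|^2, the direction of x rotates at speed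
   n |x|^2 / (2 w), an explicit function of tau which is flat at tau = 0: in the
   half-sphere F the end closes up smoothly at a boundary point.  Together with
   the local parametrizations supplied by the flow, this makes the closure of each
   curve, projected to F along the dilations, a smooth compact curve K with
   boundary, and the closure of the world-sheet is the union of the products
   [0, oo) x K.  The initial condition is used only to see that every half-line of
   C_0 is the limit of some end; otherwise it would contribute an isolated orbit. *)

Require Import Defs.
From HB Require Import structures.
From mathcomp Require Import all_boot all_order all_algebra.
From mathcomp Require Import all_classical all_reals all_analysis.
From mathcomp Require Import measurable_realfun ring lra.

Set Implicit Arguments.
Unset Strict Implicit.
Unset Printing Implicit Defensive.

Import Order.TTheory GRing.Theory Num.Theory.
Import numFieldNormedType.Exports.

Local Open Scope ring_scope.
Local Open Scope classical_set_scope.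

(** * Smooth functions of one variable *)

(** The curves of the network are only C^2, and the flow supplies near each point a family [F] whose
    change of parameter to the given curve is only known to be continuous. So [F] and the curve are
    compared through their common image: any differentiable curve running in it has contact with the
    osculating parabola, which transfers tangents and curvature without an inverse function theorem.
    The point [F 0 t / sqrt t] stays on the curve at time 1; its velocity at t = 1 is [F_t - x / 2],
    hence tangent, and kappa = <x, N> / 2 follows. This argument concerns interior points of a
    curve, so the equation is used along ends, while charts at finite points, vertices included, are
    read off [F]. No theory of differential equations enters: along an end, n e^{|x|^2/4} and the
    direction of x turned back by an integrated angle are constant. In arclength the direction turns
    at speed -n / |x|^2 and tau changes at speed -2 w / |x|^4; their quotient is the rotation speed
    in tau. Two products [0, oo) x K meet in the product over the common points of the curves K, so
    intersections of surfaces reduce to finitely many points of the half-sphere. *)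

Section RealDerivatives.
Context {R : realType}.
Implicit Types (f g : R -> R) (x : R).

Lemma is_derive_add f g x df dg : is_derive x 1 f df -> is_derive x 1 g dg ->
  is_derive x 1 (fun y => f y + g y) (df + dg).
Proof. exact: is_deriveD. Qed.

Lemma is_derive_sub f g x df dg : is_derive x 1 f df -> is_derive x 1 g dg ->
  is_derive x 1 (fun y => f y - g y) (df - dg).
Proof. exact: is_deriveB. Qed.

Lemma is_derive_mul f g x df dg : is_derive x 1 f df -> is_derive x 1 g dg ->
  is_derive x 1 (fun y => f y * g y) (f x * dg + g x * df).
Proof. exact: is_deriveM. Qed.

Lemma is_derive_inv f x df : f x != 0 -> is_derive x 1 f df ->
  is_derive x 1 (fun y => (f y)^-1) (- df / f x ^+ 2).
Proof.
move=> f0 Df; have := is_deriveV f0 Df.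
by rewrite scaleNr mulNr mulrC.
Qed.

Lemma is_derive_const (c : R) x : is_derive x 1 (fun=> c) (0 : R).
Proof. exact: is_derive_cst. Qed.

Lemma is_derive_ident x : is_derive x 1 (fun y : R => y) (1 : R).
Proof. exact: is_derive_id. Qed.

Lemma is_derive_compose f g x df dg :
  is_derive (g x) 1 f df -> is_derive x 1 g dg ->
  is_derive x 1 (fun y => f (g y)) (df * dg).
Proof. exact: is_derive1_comp. Qed.

Lemma is_derive_derive1 (W : normedModType R) (f : R -> W) x df :
  is_derive x 1 f df -> derive1 f x = df.
Proof. by move=> [_ <-]; rewrite derive1E. Qed.

Lemma derivable_is_derive (W : normedModType R) (f : R -> W) x :
  derivable f x 1 -> is_derive x 1 f (derive1 f x).
Proof. by rewrite derive1E => ?; exact: derivableP. Qed.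

Lemma is_derive_continuous (W : normedModType R) (f : R -> W) x df :
  is_derive x 1 f df -> {for x, continuous f}.
Proof. by move=> [h _]; exact/differentiable_continuous/derivable1_diffP. Qed.

Lemma open_near_in (T : topologicalType) (O : set T) (p : T) :
  open O -> O p -> \forall q \near p, O q.
Proof. by move=> oO Op; exact: open_nbhs_nbhs. Qed.

Lemma is_derive_ext (W : normedModType R) (O : set R) (f g : R -> W) x df :
  open O -> O x -> (forall y, O y -> f y = g y) ->
  is_derive x 1 f df -> is_derive x 1 g df.
Proof.
move=> oO Ox fg; apply: near_eq_is_derive.
by apply: filterS (open_near_in oO Ox) => y /fg.
Qed.

End RealDerivatives.

Section Smooth1.
Context {R : realType}.

(** On an open subset of the line [Ck] amounts to this recursion on [derive1], which suits induction
    on k. [smooth_slice] and [smooth_cylinder] translate from and to the several-variable notion. *)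
Fixpoint Ck1 (W : normedModType R) (k : nat) (O : set R) (f : R -> W) : Prop :=
  if k is k'.+1 then (forall x, O x -> derivable f x 1) /\ Ck1 k' O (derive1 f)
  else forall x, O x -> {for x, continuous f}.

Definition smooth1 (W : normedModType R) (O : set R) (f : R -> W) :=
  forall k, Ck1 k O f.

Lemma Ck1W (W : normedModType R) k O (f : R -> W) : Ck1 k.+1 O f -> Ck1 k O f.
Proof.
elim: k f => [|k IH] f /=.
  by move=> [df _] x Ox; exact/differentiable_continuous/derivable1_diffP/df.
by move=> [df h]; split=> //; exact: IH.
Qed.

Lemma Ck1_sub (W : normedModType R) k (O O' : set R) (f : R -> W) :
  O' `<=` O -> Ck1 k O f -> Ck1 k O' f.
Proof.
move=> s; elim: k f => [|k IH] f /=; first by move=> h x /s /h.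
by move=> [h1 h2]; split; [move=> x /s /h1|exact: IH].
Qed.

Lemma Ck1_ext (W : normedModType R) k (O : set R) (f g : R -> W) : open O ->
  (forall x, O x -> f x = g x) -> Ck1 k O f -> Ck1 k O g.
Proof.
move=> oO; elim: k f g => [|k IH] f g fg /=.
  move=> h x Ox; have := h x Ox; rewrite /prop_for /continuous_at -fg//.
  apply: cvg_trans; apply: near_eq_cvg.
  by apply: filterS (open_near_in oO Ox) => y /fg.
move=> [h1 h2]; have fg' x : O x -> is_derive x 1 g (derive1 f x).
  by move=> Ox; apply: (is_derive_ext oO Ox fg); exact/derivable_is_derive/h1.
split=> [x /fg'[]//|]; apply: IH h2 => x Ox.
by rewrite (is_derive_derive1 (fg' x Ox)).
Qed.

Lemma Ck1_derive (W : normedModType R) k (O : set R) (f df : R -> W) : open O ->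
  (forall x, O x -> is_derive x 1 f (df x)) -> Ck1 k O df -> Ck1 k.+1 O f.
Proof.
move=> oO fdf h; split=> [x /fdf[]//|]; apply: Ck1_ext h => // x Ox.
by rewrite (is_derive_derive1 (fdf x Ox)).
Qed.

Lemma Ck1_is_derive (W : normedModType R) k (O : set R) (f : R -> W) x :
  Ck1 k.+1 O f -> O x -> is_derive x 1 f (derive1 f x).
Proof. by move=> [h _] Ox; exact/derivable_is_derive/h. Qed.

Lemma Ck1_cst (W : normedModType R) k (O : set R) (c : W) : open O ->
  Ck1 k O (fun=> c).
Proof.
move=> oO; elim: k c => [|k IH] c; first by move=> x _; exact: cst_continuous.
apply: (Ck1_derive (df := fun=> 0)) => // x _; exact: is_derive_cst.
Qed.

Lemma Ck1_id k (O : set R) : open O -> Ck1 k O (fun x : R => x).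
Proof.
move=> oO; case: k => [|k]; first by move=> x _ ; exact: cvg_id.
by apply: (@Ck1_derive _ _ _ (fun x : R => x) (fun=> 1)) => //; exact: Ck1_cst.
Qed.

Implicit Types (f g : R -> R).

Lemma Ck1D k (O : set R) f g : open O -> Ck1 k O f -> Ck1 k O g ->
  Ck1 k O (fun x => f x + g x).
Proof.
move=> oO; elim: k f g => [|k IH] f g.
  by move=> hf hg x Ox; apply: cvgD; [exact: hf|exact: hg].
move=> hf hg; apply: (Ck1_derive (df := fun x => derive1 f x + derive1 g x)) => //.
  move=> x Ox; apply: is_derive_add; [exact: Ck1_is_derive hf _|exact: Ck1_is_derive hg _].
by apply: IH; [case: hf|case: hg].
Qed.

Lemma Ck1M k (O : set R) f g : open O -> Ck1 k O f -> Ck1 k O g ->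
  Ck1 k O (fun x => f x * g x).
Proof.
move=> oO; elim: k f g => [|k IH] f g.
  by move=> hf hg x Ox; apply: cvgM; [exact: hf|exact: hg].
move=> hf hg.
apply: (Ck1_derive (df := fun x => f x * derive1 g x + g x * derive1 f x)) => //.
  move=> x Ox; apply: is_derive_mul; [exact: Ck1_is_derive hf _|exact: Ck1_is_derive hg _].
apply: Ck1D => //; apply: IH; [exact: Ck1W|by case: hg|exact: Ck1W|by case: hf].
Qed.

Lemma Ck1N k (O : set R) f : open O -> Ck1 k O f -> Ck1 k O (fun x => - f x).
Proof.
move=> oO hf; apply: (@Ck1_ext _ _ _ (fun x => (-1) * f x)) => //.
  by move=> x _; rewrite mulN1r.
by apply: Ck1M => //; exact: Ck1_cst.
Qed.

Lemma Ck1B k (O : set R) f g : open O -> Ck1 k O f -> Ck1 k O g ->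
  Ck1 k O (fun x => f x - g x).
Proof. by move=> oO hf hg; apply: Ck1D => //; exact: Ck1N. Qed.

Lemma Ck1_comp k (O O' : set R) f g : open O -> Ck1 k O' f -> Ck1 k O g ->
  (forall x, O x -> O' (g x)) -> Ck1 k O (fun x => f (g x)).
Proof.
move=> oO; elim: k f => [|k IH] f.
  move=> hf hg gO x Ox; apply: (@continuous_comp _ _ _ g f); first exact: hg.
  exact/hf/gO.
move=> hf hg gO.
apply: (Ck1_derive (df := fun x => derive1 f (g x) * derive1 g x)) => //.
  move=> x Ox; apply: is_derive_compose; last exact: Ck1_is_derive hg _.
  exact/(Ck1_is_derive hf)/gO.
apply: Ck1M => //; last by case: hg.
by apply: IH; [case: hf|exact: Ck1W|].
Qed.

(** The derivative is a polynomial in the function itself, so order k of the function yields order k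
    of its derivative. *)
Lemma Ck1_inv k : Ck1 k [set x : R | 0 < x] (fun x => x^-1).
Proof.
have oO : open [set x : R | 0 < x] by exact: open_gt.
elim: k => [|k IH].
  by move=> x /= x0; apply: inv_continuous; rewrite gt_eqF.
apply: (Ck1_derive (df := fun x => - (x^-1 * x^-1))) => //.
  move=> x /= x0; have := is_derive_inv (lt0r_neq0 x0) (is_derive_ident x).
  by rewrite mulN1r expr2 invfM.
by apply: Ck1N => //; apply: Ck1M.
Qed.

Lemma Ck1_sqrt k : Ck1 k [set x : R | 0 < x] (@Num.sqrt R).
Proof.
have oO : open [set x : R | 0 < x] by exact: open_gt.
elim: k => [|k IH]; first by move=> x _; exact: sqrt_continuous.
apply: (Ck1_derive (df := fun x => (2 * Num.sqrt x)^-1)) => //.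
apply: (@Ck1_comp _ _ [set x | 0 < x] (fun x => x^-1)) => //.
- exact: Ck1_inv.
- by apply: Ck1M => //; exact: Ck1_cst.
- by move=> x /= x0; rewrite mulr_gt0// sqrtr_gt0.
Qed.

Lemma Ck1_cos_sin k : Ck1 k setT (@cos R) /\ Ck1 k setT (@sin R).
Proof.
elim: k => [|k [IHc IHs]].
  by split => x _; [exact: continuous_cos|exact: continuous_sin].
split.
  apply: (Ck1_derive (df := fun x => - sin x)) => //; first exact: openT.
  by apply: Ck1N => //; exact: openT.
by apply: (Ck1_derive (df := fun x => cos x)) => //; exact: openT.
Qed.

End Smooth1.

(** * A flat rotation speed *)

Section Flat.
Context {R : realType}.

(* The span of these functions over all real a is stable under differentiation,
   which gives smoothness at 0. *)
Definition flat (a t : R) : R :=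
  if 0 < t then expR (a * ln t - (4 * t)^-1) else 0.

Lemma flat_gt0E (a t : R) : 0 < t -> flat a t = expR (a * ln t - (4 * t)^-1).
Proof. by rewrite /flat => ->. Qed.

Lemma flat_le0 (a t : R) : t <= 0 -> flat a t = 0.
Proof. by rewrite /flat ltNge => ->. Qed.

Lemma flat_ge0 (a t : R) : 0 <= flat a t.
Proof. by rewrite /flat; case: ifP => // _; exact: expR_ge0. Qed.

Lemma flat_pred (a t : R) : 0 < t -> flat (a - 1) t = t^-1 * flat a t.
Proof.
move=> t0; rewrite !flat_gt0E//.
have -> : t^-1 = expR (- ln t) by rewrite expRN lnK ?posrE.
by rewrite -expRD; congr expR; ring.
Qed.

Lemma flat_pred2 (a t : R) : 0 < t -> flat (a - 2) t = t ^- 2 * flat a t.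
Proof.
move=> t0; have -> : a - 2 = (a - 1) - 1 by ring.
by rewrite !flat_pred// expr2 invfM mulrA.
Qed.

(** With u = 1 / t and M = 8 (|a| + 1), the inequality ln u <= u / M + ln M bounds |a ln t| by u / 8
    plus a constant. Of the exponent -u / 4 there remains -u / 8, and e^{u/8} >= u / 8. *)
Lemma flat_bound (a : R) :
  exists2 B, 0 < B & forall t, 0 < t < 1 -> flat a t <= B * t.
Proof.
set M := 8 * (`|a| + 1); have a0 : 0 <= `|a| by exact: normr_ge0.
have M0 : 0 < M by rewrite /M; lra.
exists (expR (`|a| * ln M) * 8); first by rewrite mulr_gt0// expR_gt0.
move=> t /andP[t0 t1]; rewrite flat_gt0E//.
have lnt : ln t < 0 by rewrite ln_lt0// t0.
set u := t^-1; have u0 : 0 < u by rewrite invr_gt0.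
have h1 : - ln t <= u / M + ln M.
  have -> : - ln t = ln u by rewrite /u lnV.
  have {1}-> : u = (1 + (u / M - 1)) * M by field; rewrite gt_eqF.
  rewrite lnM ?posrE//; last by have := divr_gt0 u0 M0; lra.
  rewrite lerD2r; apply: le_trans (le_ln1Dx _) _; last lra.
  by have := divr_gt0 u0 M0; lra.
have h2 : a * ln t <= `|a| * ln M + u / 8.
  have h3 : a * ln t <= `|a| * (- ln t).
    by have := ler_norm (- a); rewrite normrN; nra.
  have h4 : `|a| * (- ln t) <= `|a| * (u / M + ln M) by exact: ler_wpM2l.
  have h5 : `|a| * (u / M) <= u / 8.
    rewrite mulrA ler_pdivrMr// /M; nra.
  by nra.
have -> : (4 * t)^-1 = u / 4 by rewrite invfM mulrC.
have h6 : a * ln t - u / 4 <= `|a| * ln M + (- (u / 8)) by lra.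
have : expR (a * ln t - u / 4) <= expR (`|a| * ln M + (- (u / 8))).
  by rewrite ler_expR.
move/le_trans; apply; rewrite expRD -mulrA ler_pM2l ?expR_gt0//.
rewrite expRN -[8 * t]invrK lef_pV2 ?posrE ?expR_gt0 ?invr_gt0 ?mulr_gt0//.
rewrite invfM -/u mulrC; apply: le_trans (expR_ge1Dx _); lra.
Qed.

(** At 0 the difference quotient of [flat a] is 0 from the left and [flat (a - 1)] from the right,
    and the linear bound sends it to 0. Differentiation thus stays inside the span of the family. *)
Lemma is_derive_flat (a t : R) :
  is_derive t 1 (flat a) (a * flat (a - 1) t + 4^-1 * flat (a - 2) t).
Proof.
case: (ltgtP t 0) => [t0|t0|->].
- rewrite !flat_le0 ?ltW// !mulr0 addr0.
  apply: (@is_derive_ext _ _ [set x : R | x < 0] (fun=> 0)) => //.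
  by move=> y /= y0; rewrite flat_le0// ltW.
- rewrite flat_pred// flat_pred2//.
  apply: (@is_derive_ext _ _ [set x : R | 0 < x]
    (fun x => expR (a * ln x - (4 * x)^-1))) => //.
  + by move=> y /= y0; rewrite flat_gt0E.
  + have h4 : is_derive t 1 (fun x => (4 * x)^-1) (- (4 * 1 + t * 0) / (4 * t) ^+ 2).
      apply: (@is_derive_inv _ (fun x => 4 * x)); first by rewrite mulf_neq0 ?gt_eqF.
      exact: is_derive_mul (is_derive_const _ _) (is_derive_ident _).
    have hl : is_derive t 1 (fun x => a * ln x) (a * t^-1 + ln t * 0).
      exact: is_derive_mul (is_derive_const _ _) (is_derive1_ln t0).
    have := is_derive_compose (is_derive_expR _) (is_derive_sub hl h4).
    move/is_derive_eq; apply; rewrite flat_gt0E//; field; exact: lt0r_neq0.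
- rewrite !flat_le0 ?mulr0 ?addr0//.
  have [B B0 hB] := flat_bound (a - 1).
  have lim0 : (h^-1 *: (flat a (h *: 1 + 0) - flat a 0)) @[h --> 0^'] --> (0 : R).
    apply/cvgrPdist_le => e e0; near=> h.
    rewrite sub0r normrN addr0 (flat_le0 a (lexx 0)) subr0.
    have -> : h *: 1 = h :> R by exact: mulr1.
    have [h0|h0] := ltP 0 h; last first.
      by rewrite flat_le0// scaler0 normr0 ltW.
    have -> : h^-1 *: flat a h = flat (a - 1) h by rewrite flat_pred.
    rewrite ger0_norm ?flat_ge0//.
    have hs : `|h| < Num.min 1 (e / B).
      by near: h; apply: dnbhs0_lt; rewrite lt_min ltr01 divr_gt0.
    rewrite gtr0_norm// lt_min in hs; case/andP: hs => h1 h2.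
    apply: le_trans (hB h _) _; first by rewrite h0 h1.
    by rewrite mulrC -ler_pdivlMr// ltW.
  split; last exact/cvg_lim/lim0.
  by apply/cvg_ex; exists 0; exact: lim0.
Unshelve. all: by end_near. Qed.

Lemma Ck1_flat k (a : R) (O : set R) : open O -> Ck1 k O (flat a).
Proof.
move=> oO; elim: k a => [|k IH] a.
  by move=> x _; exact: is_derive_continuous (is_derive_flat a x).
apply: (Ck1_derive oO (fun x _ => is_derive_flat a x)).
by apply: Ck1D => //; apply: Ck1M => //; exact: Ck1_cst.
Qed.

End Flat.

Section Angle.
Context {R : realType}.

(* n |x|^2 / (2 w) for n = K e^{-|x|^2/4}, w = sqrt (|x|^2 - n^2), |x|^2 = 1/t. *)
Definition angle_speed (K t : R) : R :=
  K / 2 * flat (- (1 / 2)) t * (Num.sqrt (1 - (K * flat (1 / 2) t) ^+ 2))^-1.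

(** For t = |x|^-2 the quantity [K * flat (1 / 2) t] is n / |x|; a square below 1 keeps w away from
    0 and the root in [angle_speed] smooth. For t <= 0 it vanishes, so one bound from above
    describes the domain. *)
Lemma angle_speed_domain (K : R) :
  exists2 e, 0 < e & forall t, t < e -> (K * flat (1 / 2) t) ^+ 2 < 1.
Proof.
have [B B0 hB] := flat_bound (1 / 2 : R).
have k0 : 0 < `|K| + 1 by have := normr_ge0 K; lra.
exists (Num.min 1 ((`|K| + 1) * B)^-1).
  by rewrite lt_min ltr01 invr_gt0 mulr_gt0.
move=> t; rewrite lt_min => /andP[t1 te].
have [t0|t0] := leP t 0; first by rewrite flat_le0// mulr0 expr0n ltr01.
have hK : `|K * flat (1 / 2) t| < 1.
  rewrite normrM (ger0_norm (flat_ge0 _ _)).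
  have h1 : flat (1 / 2) t <= B * t by apply: hB; rewrite t0 t1.
  have h2 : t * ((`|K| + 1) * B) < 1 by rewrite -ltr_pdivlMr ?mulr_gt0// div1r.
  have h3 : `|K| * flat (1 / 2) t <= `|K| * (B * t) by exact: ler_wpM2l.
  have h4 : `|K| * (B * t) <= (`|K| + 1) * (B * t).
    by rewrite ler_wpM2r// ?mulr_ge0 ?ltW//; lra.
  by apply: le_lt_trans h3 (le_lt_trans h4 _); rewrite mulrA mulrC.
by rewrite -real_normK ?num_real// expr_lt1.
Qed.

Lemma Ck1_angle_speed k (K e : R) :
  (forall t, t < e -> (K * flat (1 / 2) t) ^+ 2 < 1) ->
  Ck1 k [set t : R | t < e] (angle_speed K).
Proof.
move=> he; have oO : open [set t : R | t < e] by exact: open_lt.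
have oP : open [set t : R | 0 < t] by exact: open_gt.
apply: Ck1M => //; first by apply: Ck1M => //; [exact: Ck1_cst|exact: Ck1_flat].
apply: (@Ck1_comp _ _ _ [set t : R | 0 < t] (fun x => x^-1)) => //.
- exact: Ck1_inv.
- apply: (@Ck1_comp _ _ _ [set t : R | 0 < t] Num.sqrt) => //.
  + exact: Ck1_sqrt.
  + apply: Ck1B => //; first exact: Ck1_cst.
    by apply: Ck1M => //; apply: Ck1M => //; (exact: Ck1_cst || exact: Ck1_flat).
  + by move=> x /he /=; rewrite subr_gt0.
- by move=> x /he /=; rewrite sqrtr_gt0 subr_gt0.
Qed.

(** The antiderivative is taken on both sides of 0 because a chart must be smooth on a whole
    neighbourhood of tau = 0, beyond the end itself. The base point of the integral fixes a constant
    that the later rotation absorbs. *)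
Lemma angle_exists (K : R) : exists (e : R) (Theta : R -> R), [/\ 0 < e,
  forall t, t < e -> (K * flat (1 / 2) t) ^+ 2 < 1,
  forall t, - e < t < e -> is_derive t 1 Theta (angle_speed K t) &
  smooth1 [set t : R | - e < t < e] Theta].
Proof.
have [e e0 he] := angle_speed_domain K.
pose d := e / 2; have d0 : 0 < d by rewrite divr_gt0.
have de : d < e by rewrite /d; lra.
have cA t : t < e -> {for t, continuous (angle_speed K)}.
  exact: (Ck1_angle_speed 0 he).
have iA : lebesgue_measure.-integrable `[- d, d]%classic (EFin \o angle_speed K).
  apply: continuous_compact_integrable; first exact: segment_compact.
  apply: continuous_in_subspaceT => x; rewrite inE/= in_itv/= => /andP[_ xd].
  by apply: cA; exact: le_lt_trans xd de.
pose Theta x := (\int[lebesgue_measure]_(t in `[- d, x]) (angle_speed K t))%R.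
have hD t : - d < t < d -> is_derive t 1 Theta (angle_speed K t).
  move=> /andP[t1 t2]; have [||h1 h2] := continuous_FTC1_closed t2 iA.
  - exact: t1.
  - by apply: cA; exact: lt_trans t2 de.
  - by split => //; rewrite -derive1E.
have oO : open [set t : R | - d < t < d].
  rewrite (_ : [set t | _] = [set t : R | - d < t] `&` [set t : R | t < d]).
    by apply: openI; [exact: open_gt|exact: open_lt].
  by apply/seteqP; split => x /=; [move=> /andP[]|move=> [-> ->]].
exists d, Theta; split => //.
- by move=> t td; apply: he; exact: lt_trans td de.
- case=> [t /hD /is_derive_continuous//|k].
  apply: (Ck1_derive oO hD); apply: Ck1_sub (Ck1_angle_speed k he).
  by move=> x /= /andP[_ xd]; exact: lt_trans xd de.
Qed.

End Angle.

Section MeanValue.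
Context {R : realType}.

Lemma mean_value (f df : R -> R) (c s t : R) :
  (forall x, c < x -> is_derive x 1 f (df x)) -> c < s -> s < t ->
  exists2 z, s < z < t & f t - f s = df z * (t - s).
Proof.
move=> fdf cs st; have [||z] := @MVT _ f df s t st.
- by move=> x; rewrite in_itv/= => /andP[sx _]; apply: fdf; exact: lt_trans sx.
- apply: derivable_within_continuous => x; rewrite in_itv/= => /andP[sx _].
  by have [] := fdf x (lt_le_trans cs sx).
by rewrite in_itv/=; exists z.
Qed.

Lemma zero_derive_const (f : R -> R) (c s t : R) :
  (forall x, c < x -> is_derive x 1 f 0) -> c < s -> c < t -> f s = f t.
Proof.
move=> fdf; wlog st : s t / s < t => [hw cs ct|cs ct].
  have [st|ts|->//] := ltgtP s t; first exact: hw.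
  by apply/esym; exact: hw.
have [z _] := mean_value (df := fun=> 0) fdf cs st.
by rewrite mul0r => /eqP; rewrite subr_eq0 => /eqP.
Qed.

Lemma pos_derive_incr (f df : R -> R) (c s t : R) :
  (forall x, c < x -> is_derive x 1 f (df x)) ->
  (forall x, c < x -> 0 < df x) -> c < s -> s < t -> f s < f t.
Proof.
move=> fdf df0 cs st; have [z /andP[sz _] e] := mean_value fdf cs st.
by rewrite -subr_gt0 e mulr_gt0 ?subr_gt0// df0// (lt_trans cs).
Qed.

End MeanValue.

(** * Ends of self-expanders *)

Section Expander.
Context {R : realType}.

(* (a, b) and (a', b') are the first and second derivatives of (x, y);
   [ray_curvature] is kappa = <x, N> / 2 cleared of denominators. *)
Record expander_ray (x y a b a' b' : R -> R) : Prop := ExpanderRay {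
  ray_dx : forall s : R, 0 < s -> is_derive s 1 x (a s);
  ray_dy : forall s : R, 0 < s -> is_derive s 1 y (b s);
  ray_da : forall s : R, 0 < s -> is_derive s 1 a (a' s);
  ray_db : forall s : R, 0 < s -> is_derive s 1 b (b' s);
  ray_regular : forall s : R, 0 < s -> 0 < a s ^+ 2 + b s ^+ 2;
  ray_curvature : forall s : R, 0 < s -> a s * b' s - b s * a' s =
    (a s ^+ 2 + b s ^+ 2) * (y s * a s - x s * b s) / 2;
  ray_cont_x : {within `[0, +oo[, continuous x};
  ray_cont_y : {within `[0, +oo[, continuous y};
  ray_proper : forall B : R, exists B' : R, forall s : R, 0 <= s ->
    x s ^+ 2 + y s ^+ 2 <= B -> s <= B' }.

Variables (x y a b a' b' : R -> R).
Hypothesis ray : expander_ray x y a b a' b'.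

Let sqnorm (s : R) : R := x s ^+ 2 + y s ^+ 2.
Let speed (s : R) : R := Num.sqrt (a s ^+ 2 + b s ^+ 2).
Let normal (s : R) : R := (y s * a s - x s * b s) / speed s.
Let tangential (s : R) : R := (x s * a s + y s * b s) / speed s.

Let speed_gt0 (s : R) : 0 < s -> 0 < speed s.
Proof. by move=> s0; rewrite sqrtr_gt0; exact: (ray_regular ray). Qed.

Let speed_sqr (s : R) : 0 < s -> speed s ^+ 2 = a s ^+ 2 + b s ^+ 2.
Proof. by move=> s0; rewrite sqr_sqrtr// ltW// (ray_regular ray). Qed.

Let is_derive_sqnorm (s : R) : 0 < s ->
  is_derive s 1 sqnorm (2 * (x s * a s + y s * b s)).
Proof.
move=> s0; have dx := ray_dx ray s0; have dy := ray_dy ray s0.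
by move: (is_derive_add (is_derive_mul dx dx) (is_derive_mul dy dy))
  => /is_derive_eq; apply; ring.
Qed.

Let is_derive_speed (s : R) : 0 < s ->
  is_derive s 1 speed ((a s * a' s + b s * b' s) / speed s).
Proof.
move=> s0; have da := ray_da ray s0; have db := ray_db ray s0.
have h : is_derive s 1 (fun s => a s ^+ 2 + b s ^+ 2)
    (2 * (a s * a' s + b s * b' s)).
  by move: (is_derive_add (is_derive_mul da da) (is_derive_mul db db))
    => /is_derive_eq; apply; ring.
have := @is_derive_compose _ Num.sqrt _ s _ _
  (is_derive1_sqrt (ray_regular ray s0)) h.
move/is_derive_eq; apply; rewrite -/(speed s); field.
exact/lt0r_neq0/speed_gt0.
Qed.

(** In arclength Frenet gives n' = -kappa w, and kappa = n / 2. In the given parameter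
    [x s * a s + y s * b s] is w times the speed. *)
Let is_derive_normal (s : R) : 0 < s ->
  is_derive s 1 normal (- (normal s * (x s * a s + y s * b s)) / 2).
Proof.
move=> s0; have dx := ray_dx ray s0; have dy := ray_dy ray s0.
have da := ray_da ray s0; have db := ray_db ray s0.
have l0 := lt0r_neq0 (speed_gt0 s0).
have dn := is_derive_mul (is_derive_sub (is_derive_mul dy da)
  (is_derive_mul dx db)) (is_derive_inv l0 (is_derive_speed s0)).
apply: is_derive_eq dn _; rewrite /normal.
set X := x s; set Y := y s; set A := a s; set B := b s.
set A' := a' s; set B' := b' s; set l := speed s in l0 *.
have e1 : l ^+ 2 = A ^+ 2 + B ^+ 2 := speed_sqr s0.
have e2 : A * B' - B * A' = (A ^+ 2 + B ^+ 2) * (Y * A - X * B) / 2 :=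
  ray_curvature ray s0.
apply/eqP; rewrite -subr_eq0; apply/eqP.
(* Over the denominator l^3, and with l^2 replaced by A^2 + B^2, the numerator is a multiple of the
   curvature equation. *)
rewrite (_ : _ - _ = ((Y * A' - X * B') * l ^+ 2 - (Y * A - X * B) *
  (A * A' + B * B') + (Y * A - X * B) * (X * A + Y * B) / 2 * l ^+ 2) / l ^+ 3);
  last by field.
rewrite e1 (_ : _ * _ - _ + _ = (X * A + Y * B) * ((A ^+ 2 + B ^+ 2) *
  (Y * A - X * B) / 2 - (A * B' - B * A'))); last by field.
by rewrite e2 subrr mulr0 mul0r.
Qed.

(** In arclength w' = 1 + kappa n = 1 + n^2 / 2, which is positive; here both terms carry the speed
    as a factor. *)
Let is_derive_tangential (s : R) : 0 < s -> is_derive s 1 tangential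
  (speed s + (y s * a s - x s * b s) ^+ 2 / (2 * speed s)).
Proof.
move=> s0; have dx := ray_dx ray s0; have dy := ray_dy ray s0.
have da := ray_da ray s0; have db := ray_db ray s0.
have l0 := lt0r_neq0 (speed_gt0 s0).
have dn := is_derive_mul (is_derive_add (is_derive_mul dx da)
  (is_derive_mul dy db)) (is_derive_inv l0 (is_derive_speed s0)).
apply: is_derive_eq dn _.
set X := x s; set Y := y s; set A := a s; set B := b s.
set A' := a' s; set B' := b' s; set l := speed s in l0 *.
have e1 : l ^+ 2 = A ^+ 2 + B ^+ 2 := speed_sqr s0.
have e2 : A * B' - B * A' = (A ^+ 2 + B ^+ 2) * (Y * A - X * B) / 2 :=
  ray_curvature ray s0.
apply/eqP; rewrite -subr_eq0; apply/eqP.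
rewrite (_ : _ - _ = ((X * A' + Y * B' + A ^+ 2 + B ^+ 2 - l ^+ 2 -
  (Y * A - X * B) ^+ 2 / 2) * l ^+ 2 - (X * A + Y * B) *
  (A * A' + B * B')) / l ^+ 3); last by field.
rewrite e1 (_ : _ * _ - _ = (Y * A - X * B) * ((A * B' - B * A') -
  (A ^+ 2 + B ^+ 2) * (Y * A - X * B) / 2)); last by field.
by rewrite e2 subrr mulr0 mul0r.
Qed.

Let normal_decay :
  exists K, forall s : R, 0 < s -> normal s = K * expR (- (sqnorm s / 4)).
Proof.
pose m (s : R) : R := normal s * expR (sqnorm s / 4).
have dm (s : R) : 0 < s -> is_derive s 1 m 0.
  move=> s0.
  have d4 : is_derive s 1 (fun s => sqnorm s / 4)
      (sqnorm s * 0 + 4^-1 * (2 * (x s * a s + y s * b s))).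
    exact: is_derive_mul (is_derive_sqnorm s0) (is_derive_const _ _).
  have := is_derive_mul (is_derive_normal s0)
    (@is_derive_compose _ expR (fun s => sqnorm s / 4) s _ _
       (is_derive_expR _) d4).
  by move/is_derive_eq; apply; field.
exists (m 1) => s s0.
rewrite (zero_derive_const dm ltr01 s0) /m -mulrA -expRD subrr expR0.
by rewrite mulr1.
Qed.

(** Properness makes |x| exceed somewhere its value at parameter 1, so |x|^2 has positive
    derivative, and w is positive, at some point in between; from there on w increases. *)
Let tangential_gt0 : exists2 s0, 0 < s0 & forall s : R, s0 <= s -> 0 < tangential s.
Proof.
have [B' hB'] := ray_proper ray (sqnorm 1).
pose S := Num.max 2 (B' + 1); have S1 : 1 < S by rewrite lt_max ltr1n.
have hS : sqnorm 1 < sqnorm S.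
  rewrite ltNge; apply/negP => /(hB' S).
  rewrite (le_trans ler01 (ltW S1)) => /(_ isT).
  by rewrite /S ge_max; lra.
have [z /andP[z1 _] e] := mean_value is_derive_sqnorm ltr01 S1.
have z0 : 0 < z := lt_trans ltr01 z1.
exists z => // s zs.
have tz : 0 < tangential z.
  rewrite divr_gt0 ?speed_gt0//.
  have : 0 < 2 * (x z * a z + y z * b z) * (S - 1) by rewrite -e subr_gt0.
  by rewrite pmulr_lgt0 ?subr_gt0// pmulr_rgt0.
move: zs; rewrite le_eqVlt => /predU1P[<-//|zs].
apply: lt_trans tz (pos_derive_incr is_derive_tangential _ z0 zs) => t t0.
by rewrite ltr_wpDr ?speed_gt0// divr_ge0 ?sqr_ge0// mulr_ge0// ltW// speed_gt0.
Qed.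

Let sqnorm_normal_tangential (s : R) : 0 < s ->
  sqnorm s = normal s ^+ 2 + tangential s ^+ 2.
Proof.
move=> s0; have l0 := lt0r_neq0 (speed_gt0 s0).
have l2 := speed_sqr s0.
have -> : normal s ^+ 2 + tangential s ^+ 2 =
  sqnorm s * ((a s ^+ 2 + b s ^+ 2) / speed s ^+ 2).
  by rewrite /normal /tangential /sqnorm; field.
by rewrite -l2 divff ?mulr1// expf_neq0.
Qed.

(** Since |x|^2 = n^2 + w^2, the root in [angle_speed] at t = |x|^-2 is |w| / |x|; the sign
    hypothesis on w removes the absolute value. *)
Let angle_speed_sqnorm K (s : R) : 0 < s -> 0 < sqnorm s -> 0 < tangential s ->
  normal s = K * expR (- (sqnorm s / 4)) ->
  angle_speed K (sqnorm s)^-1 = normal s * sqnorm s / (2 * tangential s).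
Proof.
move=> s0 r0 w0 nK; set t := (sqnorm s)^-1; have t0 : 0 < t by rewrite invr_gt0.
set r := Num.sqrt (sqnorm s); have rp : 0 < r by rewrite sqrtr_gt0.
have r2 : r ^+ 2 = sqnorm s by rewrite sqr_sqrtr// ltW.
have lnt : 1 / 2 * ln t = - ln r.
  by rewrite /t lnV ?posrE// -r2 lnXn// mulr2n; field.
have ft : flat (1 / 2) t = r^-1 * expR (- (sqnorm s / 4)).
  rewrite flat_gt0E// lnt expRD expRN lnK ?posrE//.
  by congr (_ * expR (- _)); rewrite /t invfM invrK mulrC.
have ft' : flat (- (1 / 2)) t = r * expR (- (sqnorm s / 4)).
  have -> : - (1 / 2) = 1 / 2 - 1 :> R by field.
  rewrite flat_pred// ft /t invrK -r2; field; exact: lt0r_neq0.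
rewrite /angle_speed ft ft'.
rewrite (_ : K * (r^-1 * _) = r^-1 * normal s); last by rewrite nK; ring.
have -> : 1 - (r^-1 * normal s) ^+ 2 = (tangential s / r) ^+ 2.
  have := sqnorm_normal_tangential s0; rewrite -r2 => e.
  apply: (mulIf (expf_neq0 2 (lt0r_neq0 rp))).
  have -> : (1 - (r^-1 * normal s) ^+ 2) * r ^+ 2 = r ^+ 2 - normal s ^+ 2.
    by field; exact: lt0r_neq0.
  rewrite [RHS](_ : _ = tangential s ^+ 2); last by field; exact: lt0r_neq0.
  by rewrite e; ring.
rewrite sqrtr_sqr ger0_norm; last by rewrite divr_ge0 ?ltW.
have -> : K / 2 * (r * expR (- (sqnorm s / 4))) =
   r * (K * expR (- (sqnorm s / 4))) / 2 by field.
rewrite -nK -r2; field; by rewrite !lt0r_neq0.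
Qed.

(** [E1] and [E2] are the coordinates of x / |x| as functions of tau = 1 / |x|^2, extended smoothly
    past tau = 0. The condition tau < e is written as [1 < e * |x|^2] so that it fails at x = 0,
    where the formal inverse would be 0. The last clause says that all small tau occur, so that the
    end really reaches tau = 0. *)
Lemma expander_end : exists (e : R) (E1 E2 : R -> R), [/\ 0 < e,
  smooth1 [set t : R | - e < t < e] E1 /\ smooth1 [set t : R | - e < t < e] E2,
  forall s : R, 0 <= s -> 1 < e * (x s ^+ 2 + y s ^+ 2) ->
    x s = Num.sqrt (x s ^+ 2 + y s ^+ 2) * E1 (x s ^+ 2 + y s ^+ 2)^-1 /\
    y s = Num.sqrt (x s ^+ 2 + y s ^+ 2) * E2 (x s ^+ 2 + y s ^+ 2)^-1 &
  forall t : R, 0 < t < e -> exists2 s : R, 0 <= s & x s ^+ 2 + y s ^+ 2 = t^-1].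
Proof.
have [K nK] := normal_decay; have [s0 s00 ws0] := tangential_gt0.
have [d [Ang [d0 dK dAng smAng]]] := angle_exists K.
have [B' hB'] := ray_proper ray d^-1.
pose s1 := Num.max s0 (B' + 1).
have s01 : s0 <= s1 by rewrite le_max lexx.
have s10 : 0 < s1 by exact: lt_le_trans s01.
have large (s : R) : s1 <= s -> 0 < sqnorm s /\ (sqnorm s)^-1 < d.
  move=> ss; have s0' : 0 < s by exact: lt_le_trans ss.
  have : d^-1 < sqnorm s.
    rewrite ltNge; apply/negP => /(hB' _ (ltW s0')).
    by move: ss; rewrite /s1 ge_max => /andP[_]; lra.
  move=> h; have q0 : 0 < sqnorm s by apply: lt_trans h; rewrite invr_gt0.
  by split => //; rewrite invf_plt ?posrE.
have wpos (s : R) : s1 <= s -> 0 < tangential s.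
  by move=> ss; apply: ws0; exact: le_trans ss.
pose t (s : R) : R := (sqnorm s)^-1.
pose X (s : R) : R := x s / Num.sqrt (sqnorm s).
pose Y (s : R) : R := y s / Num.sqrt (sqnorm s).
pose q (s : R) : R := normal s * speed s / sqnorm s.
have dXY (s : R) : s1 < s -> [/\ is_derive s 1 X (q s * Y s),
    is_derive s 1 Y (- (q s * X s)) &
    is_derive s 1 (fun s => Ang (t s)) (- q s)].
  move=> /ltW ss; have sp : 0 < s by exact: lt_le_trans ss.
  have [q0 qd] := large s ss; have w0 := wpos s ss.
  have r0 : 0 < Num.sqrt (sqnorm s) by rewrite sqrtr_gt0.
  have l0 := speed_gt0 sp.
  have dr := @is_derive_compose _ Num.sqrt _ s _ _
    (is_derive1_sqrt q0) (is_derive_sqnorm sp).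
  have nE : normal s * speed s = y s * a s - x s * b s.
    by rewrite /normal divfK// lt0r_neq0.
  have r2 : Num.sqrt (sqnorm s) ^+ 2 = sqnorm s by rewrite sqr_sqrtr// ltW.
  have r3 : sqnorm s = x s ^+ 2 + y s ^+ 2 by [].
  split.
  - have := is_derive_mul (ray_dx ray sp) 
      (@is_derive_inv _ (fun s => Num.sqrt (sqnorm s)) s _ (lt0r_neq0 r0) dr).
    move/is_derive_eq; apply; rewrite /q /Y nE.
    set r := Num.sqrt (sqnorm s) in r0 r2 *; rewrite -r2 in r3 *.
    apply/eqP; rewrite -subr_eq0; apply/eqP.
    rewrite (_ : _ - _ = a s * (r ^+ 2 - (x s ^+ 2 + y s ^+ 2)) / r ^+ 3).
      by rewrite r3 subrr mulr0 mul0r.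
    by field; exact: lt0r_neq0.
  - have := is_derive_mul (ray_dy ray sp) 
      (@is_derive_inv _ (fun s => Num.sqrt (sqnorm s)) s _ (lt0r_neq0 r0) dr).
    move/is_derive_eq; apply; rewrite /q /X nE.
    set r := Num.sqrt (sqnorm s) in r0 r2 *; rewrite -r2 in r3 *.
    apply/eqP; rewrite -subr_eq0; apply/eqP.
    rewrite (_ : _ - _ = b s * (r ^+ 2 - (x s ^+ 2 + y s ^+ 2)) / r ^+ 3).
      by rewrite r3 subrr mulr0 mul0r.
    by field; exact: lt0r_neq0.
  - have dt := is_derive_inv (lt0r_neq0 q0) (is_derive_sqnorm sp).
    have hT : is_derive (t s) 1 Ang (angle_speed K (t s)).
      apply: dAng; rewrite qd andbT.
      by apply: (@lt_trans _ _ 0); rewrite ?oppr_lt0 ?invr_gt0.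
    have := @is_derive_compose _ Ang t s _ _ hT dt.
    move/is_derive_eq; apply; rewrite /t (angle_speed_sqnorm sp q0 w0 (nK s sp)).
    have wE : tangential s * speed s = x s * a s + y s * b s.
      by rewrite /tangential divfK// lt0r_neq0.
    by rewrite -wE /q; field; rewrite !lt0r_neq0.
have dcos (s : R) : s1 < s ->
    is_derive s 1 (fun s => cos (Ang (t s))) (sin (Ang (t s)) * q s).
  move=> ss; have [_ _ dT] := dXY s ss.
  have := @is_derive_compose _ cos _ s _ _ (is_derive_cos _) dT.
  by move/is_derive_eq; apply; ring.
have dsin (s : R) : s1 < s ->
    is_derive s 1 (fun s => sin (Ang (t s))) (- (cos (Ang (t s)) * q s)).
  move=> ss; have [_ _ dT] := dXY s ss.
  have := @is_derive_compose _ sin _ s _ _ (is_derive_sin _) dT.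
  by move/is_derive_eq; apply; ring.
(* (Z1, Z2) is the direction x / |x| turned back by the angle [Ang (t s)]. Its derivative vanishes,
   so the direction is a fixed vector rotated by that angle. *)
pose Z1 (s : R) : R := X s * cos (Ang (t s)) + Y s * sin (Ang (t s)).
pose Z2 (s : R) : R := Y s * cos (Ang (t s)) - X s * sin (Ang (t s)).
have dZ1 (s : R) : s1 < s -> is_derive s 1 Z1 0.
  move=> ss; have [dX dY _] := dXY s ss.
  have := is_derive_add (is_derive_mul dX (dcos s ss)) (is_derive_mul dY (dsin s ss)).
  by move/is_derive_eq; apply; ring.
have dZ2 (s : R) : s1 < s -> is_derive s 1 Z2 0.
  move=> ss; have [dX dY _] := dXY s ss.
  have := is_derive_sub (is_derive_mul dY (dcos s ss)) (is_derive_mul dX (dsin s ss)).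
  by move/is_derive_eq; apply; ring.
pose S := s1 + 1; have S1 : s1 < S by rewrite /S; lra.
pose E1 (t : R) : R := Z1 S * cos (Ang t) - Z2 S * sin (Ang t).
pose E2 (t : R) : R := Z1 S * sin (Ang t) + Z2 S * cos (Ang t).
have EX (s : R) : s1 < s -> X s = E1 (t s) /\ Y s = E2 (t s).
  move=> ss; rewrite /E1 /E2 (zero_derive_const dZ1 S1 ss).
  rewrite (zero_derive_const dZ2 S1 ss) /Z1 /Z2.
  have := cos2Dsin2 (Ang (t s)); set C := cos _; set D := sin _ => e.
  split.
    by rewrite -[LHS]mulr1 -e; ring.
  by rewrite -[LHS]mulr1 -e; ring.
have csq : {within `[0, +oo[, continuous sqnorm}.
  have hx := ray_cont_x ray; have hy := ray_cont_y ray.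
  move=> s; rewrite /continuous_at /sqnorm.
  by apply: cvgD; apply: cvgM; (exact: hx || exact: hy).
have [c _ cmax] : exists2 c, c \in `[0, s1]%R &
    forall t, t \in `[0, s1]%R -> sqnorm t <= sqnorm c.
  apply: EVT_max; first exact: ltW.
  by apply: continuous_subspaceW csq; exact: subset_itvl.
have sq0 (s : R) : 0 <= sqnorm s by rewrite addr_ge0// sqr_ge0.
(* For tau below this e, |x|^2 = 1 / tau exceeds the maximum of |x|^2 over [0, s1], so the parameter
   is above s1, where the formulas hold. *)
pose e := Num.min d (sqnorm c + 1)^-1.
have c1 : 0 < sqnorm c + 1 by have := sq0 c; lra.
have e0 : 0 < e by rewrite lt_min d0 invr_gt0.
have oO : open [set t : R | - e < t < e].
  rewrite (_ : [set t | _] = [set t : R | - e < t] `&` [set t : R | t < e]).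
    by apply: openI; [exact: open_gt|exact: open_lt].
  by apply/seteqP; split => u /=; [move=> /andP[]|move=> [-> ->]].
have smT k : Ck1 k [set t : R | - e < t < e] Ang.
  apply: Ck1_sub (smAng k) => u /= /andP[u1 u2].
  have ed : e <= d by rewrite /e ge_min lexx.
  by apply/andP; split; lra.
have smC k : Ck1 k [set t : R | - e < t < e] (fun u => cos (Ang u)).
  by apply: (@Ck1_comp _ k _ setT cos) => //; have [] := @Ck1_cos_sin R k.
have smS k : Ck1 k [set t : R | - e < t < e] (fun u => sin (Ang u)).
  by apply: (@Ck1_comp _ k _ setT sin) => //; have [] := @Ck1_cos_sin R k.
exists e, E1, E2; split => //.
- by split => k; [apply: Ck1B|apply: Ck1D] => //; apply: Ck1M => //; exact: Ck1_cst.
- move=> s s_ge0 es.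
  have s1s : s1 < s.
    rewrite ltNge; apply/negP => ss; have : sqnorm s <= sqnorm c.
      by apply: cmax; rewrite in_itv/= s_ge0.
    move=> h; move: es; apply/negP; rewrite -leNgt.
    apply: (@le_trans _ _ ((sqnorm c + 1)^-1 * sqnorm s)).
      by apply: ler_wpM2r; [exact: sq0|rewrite /e ge_min lexx orbT].
    by rewrite mulrC; change (sqnorm s / (sqnorm c + 1) <= 1); rewrite ler_pdivrMr// mul1r; lra.
  have [q0 _] := large s (ltW s1s); have [eX eY] := EX s s1s.
  have r0 : 0 < Num.sqrt (sqnorm s) by rewrite sqrtr_gt0.
  by rewrite -/(sqnorm s) -/(t s) -eX -eY /X /Y; split; field; exact: lt0r_neq0.
- move=> u /andP[u0 ue].
  have h1 : sqnorm s1 < u^-1.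
    have : sqnorm s1 <= sqnorm c by apply: cmax; rewrite in_itv/= lexx ltW.
    move=> h; apply: le_lt_trans h _; apply: (@lt_trans _ _ (sqnorm c + 1)).
      by lra.
    rewrite -[X in X < _]invrK ltf_pV2 ?posrE ?invr_gt0//.
    by apply: lt_le_trans ue _; rewrite /e ge_min lexx orbT.
  have [C hC] := ray_proper ray u^-1.
  pose S' := Num.max (s1 + 1) (C + 1).
  have S'1 : s1 < S' by rewrite lt_max; apply/orP; left; lra.
  have h2 : u^-1 < sqnorm S'.
    rewrite ltNge; apply/negP => /(hC S').
    rewrite (ltW (lt_trans s10 S'1)) => /(_ isT).
    by rewrite /S' ge_max => /andP[_]; lra.
  have [||s hs es] := @IVT R sqnorm s1 S' u^-1 (ltW S'1).
  + apply: continuous_subspaceW csq => z /=; rewrite !in_itv/= andbT.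
    by move=> /andP[z1 _]; exact: le_trans (ltW s10) z1.
  + by rewrite ge_min le_max (ltW h1) (ltW h2) orbT.
  + exists s => //; move: hs; rewrite in_itv/= => /andP[h _].
    exact: le_trans (ltW s10) h.
Qed.

End Expander.

(** * Corner charts *)

Section Coordinates.
Context {R : realType}.

Lemma cvg_row (T : Type) (F : set_system T) (FF : Filter F) n (f : T -> 'rV[R]_n)
    (l : 'rV[R]_n) :
  (forall j, f x 0 j @[x --> F] --> l 0 j) -> f @ F --> l.
Proof.
move=> h; apply/cvgrPdist_le => /= e e0; near=> x.
rewrite /Num.Def.normr/= mx_normrE (bigmax_le _ (ltW e0))//= => -[i j] _.
rewrite !mxE/= ord1; move: j; near: x; apply: filter_forall => j.
exact: ((cvgrPdist_le _ _).1 (h j)).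
Unshelve. all: by end_near. Qed.

Definition row2 (a b : R) : 'rV[R]_2 := \row_(i < 2) (if i == 0 then a else b).

Lemma row2_0 a b : row2 a b 0 0 = a. Proof. by rewrite mxE. Qed.

Lemma row2_1 a b : row2 a b 0 1 = b. Proof. by rewrite mxE. Qed.

Lemma forall_ord2 (P : 'I_2 -> Prop) : P 0 -> P 1 -> forall i, P i.
Proof.
move=> P0 P1 [[|[|//]] hi]; first by rewrite (_ : Ordinal hi = 0)//; exact/val_inj.
by rewrite (_ : Ordinal hi = 1)//; exact/val_inj.
Qed.

Lemma row2P (v w : 'rV[R]_2) : v 0 0 = w 0 0 -> v 0 1 = w 0 1 -> v = w.
Proof. by move=> h0 h1; apply/rowP; exact: forall_ord2. Qed.

Lemma row2_eta (v : 'rV[R]_2) : row2 (v 0 0) (v 0 1) = v.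
Proof. by apply: row2P; rewrite ?row2_0 ?row2_1. Qed.

Lemma cvg_row2 (T : Type) (F : set_system T) (FF : Filter F) (f g : T -> R)
    (a b : R) : f @ F --> a -> g @ F --> b ->
  row2 (f x) (g x) @[x --> F] --> row2 a b.
Proof.
move=> fa gb; apply: cvg_row; apply: forall_ord2.
  by under eq_fun do rewrite row2_0; rewrite row2_0.
by under eq_fun do rewrite row2_1; rewrite row2_1.
Qed.

Lemma is_derive_pair (V W1 W2 : normedModType R) (f : V -> W1) (g : V -> W2)
    x v df dg : is_derive x v f df -> is_derive x v g dg ->
  is_derive x v (fun y => (f y, g y)) (df, dg).
Proof.
move=> [f1 f2] [g1 g2].
have h : (h^-1 *: ((f (h *: v + x), g (h *: v + x)) - (f x, g x)))
    @[h --> (0 : R)^'] --> (df, dg).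
  by apply: cvg_pair; [rewrite -f2|rewrite -g2].
split; last exact/cvg_lim/h.
by apply/cvg_ex; exists (df, dg).
Qed.

Lemma is_derive_row2 (V : normedModType R) (f g : V -> R) x v df dg :
  is_derive x v f df -> is_derive x v g dg ->
  is_derive x v (fun y => row2 (f y) (g y)) (row2 df dg).
Proof.
move=> [f1 f2] [g1 g2].
have h : (h^-1 *: (row2 (f (h *: v + x)) (g (h *: v + x)) - row2 (f x) (g x)))
    @[h --> (0 : R)^'] --> row2 df dg.
  apply: cvg_row; apply: forall_ord2.
    by under eq_fun do rewrite !mxE/=; rewrite row2_0 -f2.
  by under eq_fun do rewrite !mxE/=; rewrite row2_1 -g2.
split; last exact/cvg_lim/h.
by apply/cvg_ex; exists (row2 df dg).
Qed.

Lemma is_derive_coord (V : normedModType R) n (f : V -> 'rV[R]_n) x v df j :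
  is_derive x v f df -> is_derive x v (fun y => f y 0 j) (df 0 j).
Proof.
move=> [f1 <-]; rewrite derive_mx// mxE; apply: derivableP.
by have /derivable_mxP := f1; exact.
Qed.

Lemma is_derive_of_coord n (W : normedModType R) (g : R -> W)
    (x v : 'rV[R]_n) j :
  derivable g (x 0 j) 1 ->
  is_derive x v (fun y : 'rV[R]_n => g (y 0 j)) (v 0 j *: derive1 g (x 0 j)).
Proof.
move=> dg; have Dg : differentiable g (x 0 j) by exact/derivable1_diffP.
have Dc : differentiable (fun y : 'rV[R]_n => y 0 j) x by exact: differentiable_coord.
have Dgc : differentiable (g \o (fun y : 'rV[R]_n => y 0 j)) x.
  exact: differentiable_comp.
split; first exact: diff_derivable.
rewrite (deriveE v Dgc) diff_comp//= deriv1E//.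
congr (_ *: _).
have [_ <-] := @is_derive_coord _ n id x v _ j (is_derive_id x v).
by rewrite deriveE.
Qed.

End Coordinates.

Section Charts.
Context {R : realType}.

Lemma smooth1_derive1n (V : normedModType R) (O : set R) (f : R -> V) n :
  smooth1 O f -> smooth1 O (derive1n n f).
Proof.
move=> h; elim: n => [//|n IH] k; rewrite derive1nS.
by have [] := IH k.+1.
Qed.

Lemma open_coord n (O : set R) (j : 'I_n) :
  open O -> open [set x : 'rV[R]_n | O (x 0 j)].
Proof.
move=> oO; apply: (@open_comp _ _ (fun x : 'rV[R]_n => x 0 j) O) => //.
by move=> x _; exact: coord_continuous.
Qed.

Section Cylinder.
Variables (V : normedModType R) (k : nat) (O : set R) (psi : R -> V) (j : 'I_k.+1).
Hypotheses (oO : open O) (smpsi : smooth1 O psi).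

(** For the surfaces [0, oo) x K this is used with k = 1 and j = 1; for the orbits k = 0, j = 0 and
    [psi] is constant. *)
Let param (x : 'rV[R]_k.+1) : R * V := (x 0 0, psi (x 0 j)).

(** Closed form of the iterated derivatives: the first component is linear, so it survives a single
    derivative; the second collects one factor [v 0 j] per derivative. *)
Let param_derive (vs : seq 'rV[R]_k.+1) (x : 'rV[R]_k.+1) : R * V :=
  (if vs is v :: vs' then (if vs' is [::] then v 0 0 else 0) else x 0 0,
   (\prod_(v <- vs) v 0 j) *: derive1n (size vs) psi (x 0 j)).

Let is_derive_param_derive vs (x v : 'rV[R]_k.+1) : O (x 0 j) ->
  is_derive x v (param_derive vs) (param_derive (v :: vs) x).
Proof.
move=> Ox; apply: is_derive_pair.
  case: vs => [|w [|w' vs]]; [|exact: is_derive_cst..].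
  exact: (@is_derive_coord _ _ _ id x v _ 0 (is_derive_id x v)).
rewrite big_cons mulrC -scalerA /=.
apply: (@is_deriveZ _ _ _ (fun y : 'rV[R]_k.+1 => derive1n (size vs) psi (y 0 j))).
apply: is_derive_of_coord.
by have [h _] := @smooth1_derive1n V O psi (size vs) smpsi 1; exact: h.
Qed.

Let iter_derive_param vs (x : 'rV[R]_k.+1) : O (x 0 j) ->
  iter_derive vs param x = param_derive vs x.
Proof.
elim: vs x => [|v vs IH] x Ox.
  by rewrite /= /param_derive big_nil scale1r.
have h : \forall y \near x, iter_derive vs param y = param_derive vs y.
  by apply: filterS (open_near_in (open_coord (j := j) oO) Ox) => y; exact: IH.
by rewrite /= (near_eq_derive _ h); have [_ ->] := is_derive_param_derive vs v Ox.
Qed.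

Lemma smooth_cylinder : smooth [set x : 'rV[R]_k.+1 | O (x 0 j)] param.
Proof.
move=> n vs x _ Ox; have near_eq : \forall y \near x,
    param_derive vs y = iter_derive vs param y.
  apply: filterS (open_near_in (open_coord (j := j) oO) Ox) => y Oy.
  by rewrite iter_derive_param.
split=> [|_ v]; last first.
  by apply: near_eq_derivable near_eq _; have [] := is_derive_param_derive vs v Ox.
rewrite /prop_for /continuous_at iter_derive_param//.
apply: cvg_trans (near_eq_cvg near_eq) _.
have h1 : (param_derive vs y).1 @[y --> x] --> (param_derive vs x).1.
  rewrite /param_derive /=.
  case: (vs) => [|w [|w' vs']] /=.
  - exact: coord_continuous.
  - exact: (@cst_continuous 'rV[R]_k.+1 R (w 0 0) x).
  - exact: (@cst_continuous 'rV[R]_k.+1 R 0 x).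
have h2 : (param_derive vs y).2 @[y --> x] --> (param_derive vs x).2.
  have hc : {for x, continuous (derive1n (size vs) psi \o
      (fun y : 'rV[R]_k.+1 => y 0 j))}.
    apply: continuous_comp; first exact: coord_continuous.
    by have := @smooth1_derive1n V O psi (size vs) smpsi 0; exact.
  exact: (continuous_comp hc (@scaler_continuous _ V _ _)).
exact: (cvg_pair h1 h2).
Qed.

Lemma derive_cylinder (x v : 'rV[R]_k.+1) : O (x 0 j) ->
  'D_v param x = (v 0 0, v 0 j *: derive1 psi (x 0 j)).
Proof.
by move=> Ox; have := iter_derive_param [:: v] Ox; rewrite /param_derive big_seq1.
Qed.

End Cylinder.

(** The local condition of [corner_submanifold 1], with R in place of rows of length 1. A chart at
    an interior point of the curve is one whose parameter s is positive. *)
Definition curve_chart (V : normedModType R) (K : set V) (p : V) : Prop :=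
  exists (O : set R) (psi : R -> V),
    [/\ open O /\ smooth1 O psi,
        exists2 s, O s /\ 0 <= s & psi s = p,
        forall s t, O s -> 0 <= s -> O t -> 0 <= t -> psi s = psi t -> s = t,
        forall s, O s -> 0 <= s -> derive1 psi s != 0 &
        forall O', open O' -> O' `<=` O ->
          exists2 W : set V, open W & psi @` (O' `&` [set s | 0 <= s]) = K `&` W].

Definition cylinder (V : normedModType R) (K : set V) : set (R * V) :=
  [set q | 0 <= q.1 /\ K q.2].

Lemma cylinder_corner_submanifold (V : normedModType R) (K : set V) :
  (forall p, K p -> curve_chart K p) -> corner_submanifold 2 (cylinder K).
Proof.
move=> chart [c p] /= [c0 Kp].
have [dom [psi [[odom smpsi] [s [ds s0] psis] inj dpsi opn]]] := chart p Kp.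
exists [set x | dom (x 0 1)], (fun x => (x 0 0, psi (x 0 1))); split.
- by split; [exact: open_coord|exact: smooth_cylinder].
- exists (row2 c s); last by rewrite row2_0 row2_1 psis.
  split; first by rewrite /= row2_1.
  by apply: forall_ord2; rewrite ?row2_0 ?row2_1.
- move=> x y; rewrite !inE => -[/= Ox cx] [/= Oy cy] [e1 e2].
  by apply: row2P => //; exact: inj.
- move=> x Ox cx v v0; rewrite (@derive_cylinder V 1 dom psi 1 odom smpsi)//.
  apply: contra v0 => /eqP[e1 e2]; apply/eqP/row2P; rewrite mxE//.
  move/eqP: e2; rewrite scaler_eq0 => /predU1P[//|].
  by rewrite (negbTE (dpsi _ Ox (cx 1))).
move=> U' oU' U'O.
(* W is the union of the boxes I x W' for which U' contains I x O' and W' cuts psi(O') out of K. A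
   union is taken because U' need not be a box. *)
pose W (q : R * V) := exists I O' W', [/\ [/\ open I, open O' & open W'],
  I q.1 /\ W' q.2, forall a b, I a -> O' b -> U' (row2 a b), O' `<=` dom &
  psi @` (O' `&` [set s | 0 <= s]) = K `&` W'].
exists W.
  rewrite openE => -[a b] [I [D' [W' [[oI oD' oW'] [/= Ia Wb] h1 h2 h3]]]].
  exists (I, W').
    by split; exact: open_nbhs_nbhs.
  by move=> [a' b'] [/= Ia' Wb']; exists I, D', W'.
apply/seteqP; split => [_ [x [U'x cx] <-]|[a b] [[/= a0 Kb] [I [D' [W' [_ [/= Ia Wb] h1 h2 h3]]]]]].
  split.
    split; first exact: cx.
    have [W0 _ e] := opn dom odom (@subset_refl _ _).
    have : (K `&` W0) (psi (x 0 1)).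
      by rewrite -e; exists (x 0 1) => //; split; [exact: U'O|exact: cx].
    by case.
  have cr : {for (x 0 0, x 0 1), continuous (fun z : R * R => row2 z.1 z.2)}.
    rewrite /prop_for /continuous_at /=.
    by apply: cvg_row2; [exact: cvg_fst|exact: cvg_snd].
  have : nbhs (x 0 0, x 0 1) ((fun z : R * R => row2 z.1 z.2) @^-1` U').
    by apply: cr; rewrite /= row2_eta; exact: open_nbhs_nbhs.
  case=> -[A B] [/= nA nB] AB.
  have openB : open (B^° `&` dom) by apply: openI => //; exact: open_interior.
  have BO : B^° `&` dom `<=` dom by move=> z [].
  have [W' oW' e] := opn _ openB BO.
  have : (K `&` W') (psi (x 0 1)).
    rewrite -e; exists (x 0 1) => //; split; last exact: cx.
    by split; [exact: nB|exact: U'O].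
  case=> Kx W'x; exists A^°, (B^° `&` dom), W'; split => //.
  - by split => //; exact: open_interior.
  - move=> a b /interior_subset Aa [/interior_subset Bb _].
    exact: (AB (a, b)).
have : (K `&` W') b by [].
rewrite -h3 => -[s' [D's' s'0] e].
exists (row2 a s'); last by rewrite row2_0 row2_1 e.
split; first exact: h1.
by apply: forall_ord2; rewrite ?row2_0 ?row2_1.
Qed.

End Charts.

Section PlaneNorm.
Context {R : realType}.
Implicit Types v w : 'rV[R]_2.

Lemma dotE v w : dot v w = v 0 0 * w 0 0 + v 0 1 * w 0 1.
Proof.
rewrite /dot big_ord_recl big_ord1; congr (_ + _ * _); congr (_ _ _); exact/val_inj.
Qed.

Lemma dot_ge0 v : 0 <= dot v v.
Proof. by rewrite dotE -!expr2 addr_ge0// sqr_ge0. Qed.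

Lemma enorm_sqr v : enorm v ^+ 2 = v 0 0 ^+ 2 + v 0 1 ^+ 2.
Proof. by rewrite /enorm sqr_sqrtr ?dot_ge0// dotE -!expr2. Qed.

Lemma enorm_ge0 v : 0 <= enorm v.
Proof. exact: sqrtr_ge0. Qed.

Lemma row_coord_continuous (i : 'I_2) : continuous (fun v : 'rV[R]_2 => v 0 i).
Proof. exact: coord_continuous. Qed.

Lemma dot_continuous : continuous (fun v : 'rV[R]_2 => dot v v).
Proof.
move=> v; rewrite (_ : (fun v => _) = fun v : 'rV[R]_2 => v 0 0 * v 0 0 + v 0 1 * v 0 1).
  have h i : {for v, continuous (fun v : 'rV[R]_2 => v 0 i)}.
    exact: row_coord_continuous.
  exact: (continuousD (continuousM (h 0) (h 0)) (continuousM (h 1) (h 1))).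
by apply/funext => w; rewrite dotE.
Qed.

Lemma enorm_continuous : continuous (@enorm R).
Proof.
move=> v; apply: (@continuous_comp _ _ _ (fun v => dot v v) Num.sqrt).
  exact: dot_continuous.
exact: sqrt_continuous.
Qed.

End PlaneNorm.

(** * Local parametrizations of embedded curves *)

Section Embedded.
Context {R : realType}.

Record embedded (D : set R) (c : R -> 'rV[R]_2) : Prop := Embedded {
  emb_closed : closed D;
  emb_cont : forall s, D s -> {for s, continuous c};
  emb_inj : forall s t, D s -> D t -> c s = c t -> s = t;
  emb_proper : forall B, exists B', forall s, D s -> enorm (c s) <= B -> `|s| <= B' }.

Variables (D : set R) (c : R -> 'rV[R]_2).
Hypothesis emb : embedded D c.

(** Near q the norm of c is bounded, so by properness only a compact part of A contributes, and its
    image is compact. *)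
Lemma embedded_closed_image (A : set R) (q : 'rV[R]_2) : closed A -> A `<=` D ->
  closure (c @` A) q -> (c @` A) q.
Proof.
move=> cA AD clq; have [B' hB'] := emb_proper emb (enorm q + 1).
pose K := A `&` `[- B', B']%classic.
have cK : compact K.
  rewrite /K setIC; apply: compact_closedI => //; exact: segment_compact.
have cont : {within K, continuous c}.
  apply: continuous_in_subspaceT => s; rewrite inE => -[/AD Ds _].
  exact: (emb_cont emb).
have ccK : closed (c @` K).
  apply: compact_closed; last exact: continuous_compact.
  exact: norm_hausdorff.
suff : (c @` K) q by move=> [s [As _] <-]; exists s.
apply: ccK => V nV.
have nB : nbhs q [set p | enorm p < enorm q + 1].
  have : nbhs (enorm q) [set x | x < enorm q + 1].
    by apply: open_nbhs_nbhs; split; [exact: open_lt|rewrite /= ltrDl].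
  exact: enorm_continuous.
have [_ [[s As <-] [Vs sB]]] := clq _ (filterI nV nB).
exists (c s); split => //; exists s => //; split => //=.
by rewrite in_itv/= -ler_norml; apply: hB'; [exact: AD|exact: ltW].
Qed.

Lemma embedded_closed_trace : closed (c @` D).
Proof. by move=> q; apply: embedded_closed_image => //; exact: emb_closed emb. Qed.

(** The parameters of D at distance at least e from s have closed image, which misses c s by
    injectivity; W is its complement. This is the continuity of the inverse of c. *)
Lemma embedded_inverse s e : D s -> 0 < e ->
  exists W : set 'rV[R]_2, [/\ open W, W (c s) &
    forall t, D t -> W (c t) -> `|t - s| < e].
Proof.
move=> Ds e0; pose A := D `&` [set t | e <= `|t - s|].
have cA : closed A.
  apply: closedI; first exact: emb_closed emb.
  apply: (@preimage_closed _ _ (fun t => `|t - s|) [set x | e <= x]).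
    move=> t _; apply: cvg_norm; apply: cvgB; [exact: cvg_id|exact: cvg_cst].
  exact: closed_ge.
exists (~` (c @` A)); split.
- apply: closed_openC => q.
  by apply: embedded_closed_image => //; move=> t [].
- move=> [t [Dt /= et] ct]; move: et; rewrite (emb_inj emb Dt Ds ct) subrr normr0.
  by rewrite leNgt e0.
- move=> t Dt Wt; rewrite ltNge; apply/negP => et; apply: Wt.
  by exists t.
Qed.

End Embedded.

Section LocalChart.
Context {R : realType}.

Definition half_open_or_open (d : R) (J : set R) : Prop :=
  J = `](- d), d[%classic \/ J = `[0, d[%classic.

Variables (D : set R) (c : R -> 'rV[R]_2) (d : R) (J : set R).
Variables (F : R -> 'rV[R]_2) (W : set 'rV[R]_2).
Hypotheses (emb : embedded D c) (J_shape : half_open_or_open d J).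
Hypotheses (F_cont : forall x, J x -> {for x, continuous F}).
Hypotheses (F_inj : forall x y, J x -> J y -> F x = F y -> x = y).
Hypotheses (oW : open W) (F_image : F @` J = (c @` D) `&` W).

(** The change of parameter c^-1 o F. Only its continuity is established, but an injective
    continuous function on an interval is monotone, and this is enough for charts. The default 0 is
    never taken for want of a preimage when x is in J. *)
Definition transition (x : R) : R := xget 0 [set s | D s /\ c s = F x].

Local Notation phi := transition.

Lemma transitionP x : J x -> D (phi x) /\ c (phi x) = F x.
Proof.
move=> Jx; have [s Ds cs] : (c @` D) (F x).
  have : (F @` J) (F x) by exists x.
  by rewrite F_image => -[].
exact: (@xgetPex _ 0 [set s | D s /\ c s = F x] (ex_intro _ s (conj Ds cs))).
Qed.

Lemma transition_inj x y : J x -> J y -> phi x = phi y -> x = y.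
Proof.
move=> Jx Jy e; apply: F_inj => //.
by rewrite -(transitionP Jx).2 -(transitionP Jy).2 e.
Qed.

Lemma transition_unique x s : J x -> D s -> c s = F x -> phi x = s.
Proof.
move=> Jx Ds cs; have [Dp cp] := transitionP Jx.
by apply: (emb_inj emb) => //; rewrite cp.
Qed.

Lemma transition_near x e : J x -> 0 < e ->
  \forall y \near x, J y -> `|phi y - phi x| < e.
Proof.
move=> Jx e0; have [Dx cx] := transitionP Jx.
have [V [oV Vx hV]] := embedded_inverse emb Dx e0.
have : nbhs x (F @^-1` V).
  by apply: F_cont => //; apply: open_nbhs_nbhs; split => //; rewrite -cx.
apply: filterS => y Vy Jy; have [Dy cy] := transitionP Jy.
by apply: hV => //; rewrite cy.
Qed.

Lemma transition_continuous (A : set R) : A `<=` J -> {within A, continuous phi}.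
Proof.
move=> AJ; apply/subspace_continuousP => x Ax.
apply/cvgrPdist_lt => e e0; rewrite near_withinE.
apply: filterS (transition_near (AJ _ Ax) e0) => y h Ay.
by rewrite distrC; apply: h; exact: AJ.
Qed.

Lemma transition_ivt a b v : J a -> J b -> a <= b ->
  Num.min (phi a) (phi b) <= v <= Num.max (phi a) (phi b) ->
  exists x, [/\ a <= x <= b, J x & phi x = v].
Proof.
move=> Ja Jb ab hv.
have abJ : `[a, b]%classic `<=` J.
  move: Ja Jb; case: J_shape => -> /=; rewrite !in_itv/= => /andP[a1 a2] /andP[b1 b2].
    move=> x; rewrite /= !in_itv/= => /andP[ax xb].
    by rewrite (lt_le_trans a1 ax) (le_lt_trans xb b2).
  move=> x; rewrite /= !in_itv/= => /andP[ax xb].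
  by rewrite (le_trans a1 ax) (le_lt_trans xb b2).
have [x xab xv] := IVT ab (transition_continuous abJ) hv.
by exists x; split => //; exact: abJ.
Qed.

(** By monotonicity phi x lies strictly between phi a and phi b, so all parameters near phi x are
    values of phi on [a, b]. *)
Lemma transition_interior a b x (A : set R) : J a -> J b -> a < x < b ->
  `[a, b]%classic `<=` A -> exists2 e : R, 0 < e &
    forall y : R, D y -> `|y - phi x| < e -> (F @` (A `&` J)) (c y).
Proof.
move=> Ja Jb /andP[ax xb] abA.
have abJ : `[a, b]%classic `<=` J.
  move: Ja Jb; case: J_shape => -> /=; rewrite !in_itv/= => /andP[a1 a2] /andP[b1 b2].
    move=> y; rewrite /= !in_itv/= => /andP[ay yb].
    by rewrite (lt_le_trans a1 ay) (le_lt_trans yb b2).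
  move=> y; rewrite /= !in_itv/= => /andP[ay yb].
  by rewrite (le_trans a1 ay) (le_lt_trans yb b2).
have Jx : J x by apply: abJ; rewrite /= in_itv/= !ltW.
have ab : a < b by exact: lt_trans xb.
have phiab : (phi a < phi x < phi b) \/ (phi b < phi x < phi a).
  have [||h|h] := @itv_continuous_inj_mono R phi `[a, b]%R.
  - exact: transition_continuous.
  - by move=> y z hy hz; apply: transition_inj; exact: abJ.
  - by left; rewrite !h// in_itv/= ?lexx ?ltW.
  - by right; rewrite !h// in_itv/= ?lexx ?ltW.
exists (Num.min `|phi a - phi x| `|phi b - phi x|).
  by rewrite lt_min !normr_gt0 !subr_eq0; case: phiab => /andP[h1 h2];
    rewrite !(lt_eqF h1, lt_eqF h2, gt_eqF h1, gt_eqF h2).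
move=> y Dy; rewrite lt_min => /andP[h1 h2].
have [z [/andP[az zb] Jz pz]] : exists z, [/\ a <= z <= b, J z & phi z = y].
  apply: (transition_ivt Ja Jb (ltW ab)); rewrite ge_min le_max.
  case: phiab => /andP[h3 h4].
    have e1 : `|phi a - phi x| = phi x - phi a by rewrite ltr0_norm ?opprB// subr_lt0.
    have e2 : `|phi b - phi x| = phi b - phi x by rewrite gtr0_norm ?subr_gt0.
    move: h1 h2; rewrite e1 e2 !ltr_norml => /andP[h5 h6] /andP[h7 h8].
    by apply/andP; split; apply/orP; [left|right]; lra.
  have e1 : `|phi a - phi x| = phi a - phi x by rewrite gtr0_norm ?subr_gt0.
  have e2 : `|phi b - phi x| = phi x - phi b by rewrite ltr0_norm ?opprB// subr_lt0.
  move: h1 h2; rewrite e1 e2 !ltr_norml => /andP[h5 h6] /andP[h7 h8].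
  by apply/andP; split; apply/orP; [right|left]; lra.
exists z; first by split => //; apply: abA; rewrite /= in_itv/= az.
by rewrite -pz (transitionP Jz).2.
Qed.

(** At the closed end of J there are no values of phi on the left to compare with. Instead, openness
    of W writes every nearby point of the trace as F s, and a parameter s beyond b is handled by the
    intermediate value theorem. *)
Lemma transition_end (b : R) (A : set R) : J = `[0, d[%classic -> 0 < b < d ->
  `[0, b]%classic `<=` A -> exists2 e : R, 0 < e &
    forall y : R, D y -> `|y - phi 0| < e -> (F @` (A `&` J)) (c y).
Proof.
move=> JE /andP[b0 bd] bA.
have JP x : J x = (0 <= x < d) :> Prop by rewrite JE /= in_itv.
have J0 : J 0 by rewrite JP lexx (lt_trans b0 bd).
have Jb : J b by rewrite JP (ltW b0).
have [D0 c0] := transitionP J0.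
have nW : nbhs (c (phi 0)) W.
  apply: open_nbhs_nbhs; split => //; rewrite c0.
  have : (F @` J) (F 0) by exists 0.
  by rewrite F_image => -[].
have := emb_cont emb D0 nW => /nbhs_ballP[e1 /= e10 he1].
have pb0 : phi b != phi 0.
  by apply/eqP => /(transition_inj Jb J0) e; move: b0; rewrite e ltxx.
exists (Num.min e1 `|phi b - phi 0|).
  by rewrite lt_min e10 normr_gt0 subr_eq0.
move=> y Dy; rewrite lt_min => /andP[y1 y2].
have [s Js Fs] : (F @` J) (c y).
  rewrite F_image; split; first by exists y.
  by apply: he1; rewrite /ball/= distrC.
have ps := transition_unique Js Dy (esym Fs).
have [sb|bs] := leP s b.
  exists s => //; split => //; apply: bA; rewrite /= in_itv/= sb andbT.
  by move: Js; rewrite JP => /andP[].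
(* As |y - phi 0| < |phi b - phi 0|, either y lies between phi 0 and phi b, hence is a value on
   [0, b], or phi 0 lies between phi b and phi s = y, hence would be taken twice. *)
have [hy|hy] : (Num.min (phi 0) (phi b) <= y <= Num.max (phi 0) (phi b)) \/
    (Num.min (phi b) (phi s) <= phi 0 <= Num.max (phi b) (phi s)).
  rewrite !ge_min !le_max ps.
  have /orP[h1|h1] : (phi b < phi 0) || (phi 0 < phi b) by rewrite -neq_lt.
  - move: y2; rewrite ltr_norml ltr0_norm ?subr_lt0// => /andP[h2 h3].
    have [h4|h4] := leP y (phi 0); [left|right]; apply/andP; split; apply/orP.
    + by right; lra.
    + by left.
    + by left; lra.
    + by right; lra.
  - move: y2; rewrite ltr_norml gtr0_norm ?subr_gt0// => /andP[h2 h3].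
    have [h4|h4] := leP y (phi 0); [right|left]; apply/andP; split; apply/orP.
    + by right.
    + by left; lra.
    + by left; lra.
    + by right; lra.
- have [x [/andP[x0 xb] Jx px]] := transition_ivt J0 Jb (ltW b0) hy.
  exists x; first by split => //; apply: bA; rewrite /= in_itv/= x0.
  by rewrite -(transitionP Jx).2 px.
- have [x [/andP[bx xs] Jx px]] := transition_ivt Jb Js (ltW bs) hy.
  have e := transition_inj Jx J0 px.
  by move: bx; rewrite e leNgt b0.
Qed.

(** The hypothesis makes only the image of all of J relatively open; a chart requires this for every
    open set of parameters. *)
Lemma local_chart_open (A : set R) : open A ->
  exists2 V : set 'rV[R]_2, open V & F @` (A `&` J) = (c @` D) `&` V.
Proof.
move=> oA.
pose V (q : 'rV[R]_2) := exists U : set 'rV[R]_2, [/\ open U, U q &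
  (c @` D) `&` U `<=` F @` (A `&` J)].
exists V.
  rewrite openE => q [U [oU Uq hU]].
  by apply: filterS (open_near_in oU Uq) => q' Uq'; exists U.
apply/seteqP; split => [_ [x [Ax Jx] <-]|q [Dq [U [_ Uq hU]]]]; last exact: hU.
have [Dx cx] := transitionP Jx.
split; first by exists (phi x).
have [e e0 he] : exists2 e : R, 0 < e &
    forall y : R, D y -> `|y - phi x| < e -> (F @` (A `&` J)) (c y).
  have /nbhs_ballP[r /= r0 hr] : nbhs x A by exact: open_nbhs_nbhs.
  have ball_r y : `|y - x| < r -> A y by move=> h; apply: hr; rewrite /ball/= distrC.
  have [JE|JE] := J_shape.
    have /andP[x1 x2] : - d < x < d by move: Jx; rewrite JE /= in_itv.
    pose h := Num.min (r / 2) (Num.min ((x + d) / 2) ((d - x) / 2)).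
    have h0 : 0 < h by rewrite !lt_min; apply/and3P; split; lra.
    have [h1 h2 h3] : [/\ h <= r / 2, h <= (x + d) / 2 & h <= (d - x) / 2].
      by rewrite /h !ge_min !lexx !orbT.
    apply: (@transition_interior (x - h) (x + h)).
    - by rewrite JE /= in_itv/=; apply/andP; split; lra.
    - by rewrite JE /= in_itv/=; apply/andP; split; lra.
    - by apply/andP; split; lra.
    - move=> y; rewrite /= in_itv/= => /andP[y1 y2]; apply: ball_r.
      by rewrite ltr_norml; apply/andP; split; lra.
  have : 0 <= x < d by move: Jx; rewrite JE /= in_itv.
  case/andP; rewrite le_eqVlt => /predU1P[x0|x1] x2.
    pose h := Num.min (r / 2) (d / 2).
    have [h1 h2] : h <= r / 2 /\ h <= d / 2 by rewrite /h !ge_min !lexx !orbT.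
    have h0 : 0 < h by rewrite !lt_min; apply/andP; split; lra.
    rewrite -x0; apply: (@transition_end h) => //; first by apply/andP; split; lra.
    move=> y; rewrite /= in_itv/= => /andP[y1 y2]; apply: ball_r.
    by rewrite -x0 subr0 ltr_norml; apply/andP; split; lra.
  pose h := Num.min (r / 2) (Num.min (x / 2) ((d - x) / 2)).
  have h0 : 0 < h by rewrite !lt_min; apply/and3P; split; lra.
  have [h1 h2 h3] : [/\ h <= r / 2, h <= x / 2 & h <= (d - x) / 2].
    by rewrite /h !ge_min !lexx !orbT.
  apply: (@transition_interior (x - h) (x + h)).
  - by rewrite JE /= in_itv/=; apply/andP; split; lra.
  - by rewrite JE /= in_itv/=; apply/andP; split; lra.
  - by apply/andP; split; lra.
  - move=> y; rewrite /= in_itv/= => /andP[y1 y2]; apply: ball_r.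
    by rewrite ltr_norml; apply/andP; split; lra.
have [U [oU Ux hU]] := embedded_inverse emb Dx e0.
exists U; split => //; first by rewrite -cx.
by move=> _ [[y Dy <-] Uy]; apply: he => //; exact: hU.
Qed.

(** If J were half-open, both phi 0 - e1 / 2 and phi 0 + e1 / 2 would be values at positive
    parameters, and phi would take the value phi 0 again between them. *)
Lemma transition_line : D = setT -> 0 < d ->
  J = `](- d), d[%classic /\
  ((forall x y, J x -> J y -> x < y -> phi x < phi y) \/
   (forall x y, J x -> J y -> x < y -> phi y < phi x)).
Proof.
move=> DT d0.
suff JE : J = `](- d), d[%classic.
  split=> //; have [||h|h] := @itv_continuous_inj_mono R phi `](- d), d[%R.
  - by apply: transition_continuous; rewrite JE.
  - by move=> x y hx hy; apply: transition_inj; rewrite JE.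
  - by left=> x y; rewrite JE => Jx Jy; exact: h.
  - by right=> x y; rewrite JE => Jx Jy xy; exact: (h y x).
case: J_shape => // JE; exfalso.
have JP x : J x = (0 <= x < d) :> Prop by rewrite JE /= in_itv.
have J0 : J 0 by rewrite JP lexx.
have [D0 c0] := transitionP J0.
have nW : nbhs (c (phi 0)) W.
  apply: open_nbhs_nbhs; split => //; rewrite c0.
  have : (F @` J) (F 0) by exists 0.
  by rewrite F_image => -[].
have := emb_cont emb D0 nW => /nbhs_ballP[e1 /= e10 he1].
have hit y : `|y - phi 0| < e1 -> exists2 x, J x & phi x = y.
  move=> hy; have [x Jx Fx] : (F @` J) (c y).
    rewrite F_image; split; first by exists y; rewrite ?DT.
    by apply: he1; rewrite /ball/= distrC.
  by exists x => //; apply: transition_unique; rewrite ?DT.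
have [x1 J1 p1] : exists2 x, J x & phi x = phi 0 - e1 / 2.
  by apply: hit; rewrite addrAC subrr sub0r normrN gtr0_norm; lra.
have [x2 J2 p2] : exists2 x, J x & phi x = phi 0 + e1 / 2.
  by apply: hit; rewrite addrAC subrr add0r gtr0_norm; lra.
have pos x : J x -> phi x != phi 0 -> 0 < x.
  rewrite JP => /andP[x0 _] px; rewrite lt_neqAle x0 andbT.
  by apply: contra px => /eqP <-.
have x10 : 0 < x1 by apply: pos => //; rewrite p1 lt_eqF//; lra.
have x20 : 0 < x2 by apply: pos => //; rewrite p2 gt_eqF//; lra.
have [x [x0 Jx px]] : exists x, [/\ 0 < x, J x & phi x = phi 0].
  have [x12|x21] := leP x1 x2.
    have [|x [/andP[h1 h2] Jx px]] := transition_ivt J1 J2 x12 (v := phi 0).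
      by rewrite ge_min le_max p1 p2; apply/andP; split; apply/orP; [left|right]; lra.
    by exists x; split => //; exact: lt_le_trans h1.
  have [|x [/andP[h1 h2] Jx px]] := transition_ivt J2 J1 (ltW x21) (v := phi 0).
    by rewrite ge_min le_max p1 p2; apply/andP; split; apply/orP; [right|left]; lra.
  by exists x; split => //; exact: lt_le_trans h1.
by move: x0; rewrite (transition_inj Jx J0 px) ltxx.
Qed.

End LocalChart.

Section AffineReparametrization.
Context {R : realType} {V : normedModType R}.

Lemma is_derive_affine (F : R -> V) (m b x : R) dF :
  is_derive (m * x + b) 1 F dF ->
  is_derive x 1 (fun y => F (m * y + b)) (m *: dF).
Proof.
move=> [h1 h2]; pose g (y : R) : R := m * y + b.
have dg : is_derive x 1 g m.
  have := is_derive_add (is_derive_mul (is_derive_const m x) (is_derive_ident x))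
    (is_derive_const b x).
  by move/is_derive_eq; apply; rewrite mulr0 mulr1 !addr0.
have Dg : differentiable g x by apply/derivable1_diffP; case: dg.
have DF : differentiable F (g x) by exact/derivable1_diffP.
have DFg : differentiable (F \o g) x by exact: differentiable_comp.
split; first exact/derivable1_diffP.
rewrite (deriveE (1 : R) DFg) diff_comp//= (deriv1E h1) -(deriveE _ Dg).
by case: dg => _ ->; rewrite derive1E h2.
Qed.

Lemma Ck1Z k (dom : set R) (c : R) (f : R -> V) : open dom ->
  Ck1 k dom f -> Ck1 k dom (fun x => c *: f x).
Proof.
move=> od; elim: k f => [|k IH] f.
  move=> hf x dx; exact: (continuous_comp (hf x dx) (@scaler_continuous _ V _ _)).
move=> hf; apply: (Ck1_derive (df := fun x => c *: derive1 f x)) => //.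
  by move=> x dx; apply: is_deriveZ; exact: Ck1_is_derive hf _.
by apply: IH; case: hf.
Qed.

Lemma affine_continuous (m b : R) : continuous (fun x : R => m * x + b).
Proof.
by move=> x; apply: cvgD; [apply: cvgM; [exact: cvg_cst|exact: cvg_id]|exact: cvg_cst].
Qed.

Lemma open_affine (m b : R) (dom : set R) :
  open dom -> open [set x : R | dom (m * x + b)].
Proof.
move=> od; apply: (@open_comp _ _ (fun x : R => m * x + b)) => //.
by move=> x _; exact: affine_continuous.
Qed.

Lemma smooth1_affine (dom : set R) (m b : R) (F : R -> V) : open dom ->
  smooth1 dom F -> smooth1 [set x : R | dom (m * x + b)] (fun x => F (m * x + b)).
Proof.
move=> od hF k; elim: k F hF => [|k IH] F hF.
  move=> x /= dx; apply: (@continuous_comp _ _ _ (fun x : R => m * x + b) F).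
    exact: affine_continuous.
  exact: (hF 0%N).
have oa := open_affine (m := m) (b := b) od.
apply: (Ck1_derive (df := fun x => m *: derive1 F (m * x + b))) => //.
  by move=> x dx; apply: is_derive_affine; exact: Ck1_is_derive (hF 1%N) dx.
by apply: Ck1Z => //; apply: IH => k'; have [] := hF k'.+1.
Qed.

Lemma derive1_affine (F : R -> V) (m b x : R) : derivable F (m * x + b) 1 ->
  derive1 (fun y => F (m * y + b)) x = m *: derive1 F (m * x + b).
Proof.
by move=> h; apply: is_derive_derive1; exact/is_derive_affine/derivable_is_derive.
Qed.

End AffineReparametrization.

(** * Charts of plane curves from local parametrizations *)

Section PlaneCharts.
Context {R : realType}.

Record param_near (D : set R) (c : R -> 'rV[R]_2) (p : 'rV[R]_2)
    (d : R) (J dom : set R) (F : R -> 'rV[R]_2) (W : set 'rV[R]_2) : Prop :=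
  ParamNear {
    pn_d : 0 < d;
    pn_J : half_open_or_open d J;
    pn_open : open dom;
    pn_sub : J `<=` dom;
    pn_smooth : smooth1 dom F;
    pn_base : F 0 = p;
    pn_inj : forall x y, J x -> J y -> F x = F y -> x = y;
    pn_regular : forall x, J x -> derive1 F x != 0;
    pn_openW : open W;
    pn_image : F @` J = (c @` D) `&` W }.

Variables (D : set R) (c : R -> 'rV[R]_2) (p : 'rV[R]_2) (d : R) (J dom : set R).
Variables (F : R -> 'rV[R]_2) (W : set 'rV[R]_2).
Hypotheses (emb : embedded D c) (pn : param_near D c p d J dom F W).

Let F_cont x : J x -> {for x, continuous F}.
Proof. by move=> Jx; apply: (pn_smooth pn 0%N); exact: (pn_sub pn). Qed.

Let F_derivable x : J x -> derivable F x 1.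
Proof.
by move=> Jx; have [h _] := pn_smooth pn 1%N; apply: h; exact: (pn_sub pn).
Qed.

Let chart_open := local_chart_open emb (pn_J pn) F_cont (pn_inj pn) (pn_openW pn)
  (pn_image pn).

(** Charts use parameters in [0, oo), so F is precomposed with an affine map: a shift turns ]-d,
    d[ into ]0, 2 d[, and m = -1 reverses the direction. *)
Lemma shift_chart (P : set 'rV[R]_2) (m b : R) (dom' : set R) :
  m != 0 -> open dom' -> (forall x, dom' x -> 0 <= x -> J (m * x + b)) ->
  (forall x, dom' x -> dom (m * x + b)) ->
  (exists2 s, dom' s /\ 0 <= s & F (m * s + b) = p) ->
  (forall A, open A -> A `<=` dom' -> exists2 V : set 'rV[R]_2, open V &
    (fun x => F (m * x + b)) @` (A `&` [set s | 0 <= s]) = P `&` V) ->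
  curve_chart P p.
Proof.
move=> m0 od' J' d' [s ds ps] hV; exists dom', (fun x => F (m * x + b)); split => //.
- split => // k; apply: Ck1_sub (smooth1_affine m b (pn_open pn) (pn_smooth pn) k).
  by move=> x /d'.
- by exists s.
- move=> x y dx x0 dy y0 /(pn_inj pn (J' _ dx x0) (J' _ dy y0)) /addIr.
  exact: mulfI.
- move=> x dx x0; have Jx := J' _ dx x0.
  rewrite derive1_affine; last exact: F_derivable.
  rewrite scaler_eq0 negb_or m0.
  exact: (pn_regular pn).
Qed.

Lemma full_chart : curve_chart (c @` D) p.
Proof.
have d0 := pn_d pn; have [JE|JE] := pn_J pn.
- apply: (@shift_chart _ 1 (- d) ([set x | dom (1 * x - d)] `&` `]0, 2 * d[%classic)).
  + exact: oner_neq0.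
  + by apply: openI; [exact: open_affine (pn_open pn)|exact: interval_open].
  + move=> x [_ /=]; rewrite in_itv/= => /andP[x0 x1] _.
    by rewrite JE /= in_itv/=; apply/andP; split; lra.
  + by move=> x [].
  + exists d; last by rewrite mul1r subrr (pn_base pn).
    split; last exact: ltW.
    split; last by rewrite /= in_itv/=; apply/andP; split; lra.
    rewrite /= mul1r subrr; apply: (pn_sub pn); rewrite JE /= in_itv/=.
    by apply/andP; split; lra.
  + move=> A oA Ad.
    have [V oV hV] := chart_open (open_affine (m := 1) (b := d) oA).
    exists V => //; rewrite -hV; apply/seteqP; split => [_ [x [Ax x0] <-]|_ [x [/= Ax Jx] <-]].
      have [_ /=] := Ad _ Ax; rewrite in_itv/= => /andP[x1 x2].
      exists (1 * x - d) => //; split; first by rewrite /= mul1r mul1r subrK.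
      by rewrite JE /= in_itv/=; apply/andP; split; lra.
    exists (1 * x + d); last by rewrite mul1r mul1r addrK.
    split => //; move: Jx; rewrite JE /= in_itv/= => /andP[h1 h2]; lra.
- apply: (@shift_chart _ 1 0 ([set x | dom (1 * x + 0)] `&` `]-oo, d[%classic)).
  + exact: oner_neq0.
  + by apply: openI; [exact: open_affine (pn_open pn)|exact: interval_open].
  + move=> x [_ /=]; rewrite in_itv/= => x1 x0.
    by rewrite JE /= in_itv/= mul1r addr0 x0.
  + by move=> x [].
  + exists 0; last by rewrite mul1r addr0 (pn_base pn).
    split => //; split; last by rewrite /= in_itv/=.
    rewrite /= mul1r addr0; apply: (pn_sub pn); rewrite JE /= in_itv/= lexx.
    exact: d0.
  + move=> A oA Ad; have [V oV hV] := chart_open oA.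
    exists V => //; rewrite -hV; apply/seteqP; split => [_ [x [Ax x0] <-]|_ [x [/= Ax Jx] <-]].
      exists x; last by rewrite mul1r addr0.
      split => //; have [_ /=] := Ad _ Ax; rewrite in_itv/= => x1.
      by rewrite JE /= in_itv/= x1 andbT.
    exists x; last by rewrite mul1r addr0.
    by split => //; move: Jx; rewrite JE /= in_itv/= => /andP[].
Qed.

(** At the cut c 0 only one side of F belongs to the half of the line, and F has to be oriented
    towards it; at other points the chart is shrunk until it stays off the cut. *)
Lemma half_line_chart s : D = setT -> 0 <= s -> c s = p ->
  curve_chart (c @` `[0, +oo[%classic) p.
Proof.
move=> DT s0 cs; have d0 := pn_d pn.
have [JE mono] := transition_line emb (pn_J pn) F_cont (pn_inj pn) (pn_openW pn)
  (pn_image pn) DT d0.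
set phi := transition D c F in mono.
have JP x : J x = (- d < x < d) :> Prop by rewrite JE /= in_itv.
have phiP x : J x -> c (phi x) = F x.
  by move=> /(transitionP (pn_image pn))[].
have J0 : J 0 by rewrite JP oppr_lt0 d0.
have phi0 : phi 0 = s.
  apply: (transition_unique emb (pn_image pn)) => //; first by rewrite DT.
  by rewrite (pn_base pn).
(* m orients F so that [phi (m * x)] increases with x; the flip preserves J because ]-d, d[ is
   symmetric. *)
have [m m1 inc] : exists2 m : R, m = 1 \/ m = -1 & forall x y, J (m * x) ->
    J (m * y) -> x < y -> phi (m * x) < phi (m * y).
  case: mono => mono; [exists 1|exists (-1)]; [by left| |by right|].
    by move=> x y; rewrite !mul1r; exact: mono.
  by move=> x y Jx Jy xy; apply: mono => //; lra.
have m0 : m != 0 by case: m1 => ->; rewrite ?oner_neq0 ?oppr_eq0 ?oner_neq0.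
have JM x : J (m * x) = (- d < x < d) :> Prop.
  rewrite JP; case: m1 => ->; rewrite ?mul1r// mulN1r ltrN2.
  by rewrite andbC ltrNl.
have mm x : m * (m * x) = x by case: m1 => ->; rewrite ?mul1r// !mulN1r opprK.
have cinj x y : c x = c y -> x = y by apply: (emb_inj emb); rewrite DT.
move: s0; rewrite le_eqVlt => /predU1P[s0|s0].
- apply: (@shift_chart _ m 0 ([set x | dom (m * x + 0)] `&` `](- d), d[%classic)).
  + exact: m0.
  + by apply: openI; [exact: open_affine (pn_open pn)|exact: interval_open].
  + by move=> x [_ /=]; rewrite in_itv/= => h _; rewrite addr0 JM.
  + by move=> x [].
  + exists 0; last by rewrite mulr0 addr0 (pn_base pn).
    split=> //; split; first by rewrite /= mulr0 addr0; apply: (pn_sub pn).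
    by rewrite /= in_itv/= oppr_lt0 d0.
  + move=> A oA Ad; have [V oV hV] := chart_open (open_affine (m := m) (b := 0) oA).
    have hA x : A x -> - d < x < d by move=> /Ad[_ /=]; rewrite in_itv.
    exists V => //; apply/seteqP; split => [_ [x [Ax x0] <-]|q [[t /= t0 tq] Vq]].
      have Jx : J (m * x) by rewrite JM; exact: hA.
      have [_ Vx] : ((c @` D) `&` V) (F (m * x)).
        rewrite -hV; exists (m * x) => //; split => //.
        by rewrite /= addr0 mm.
      rewrite addr0; split => //; exists (phi (m * x)); last by rewrite phiP.
      rewrite /= in_itv/= andbT [leLHS]s0 -phi0.
      have /predU1P[<-|x0'] : (0 == x) || (0 < x) by rewrite -le_eqVlt.
        by rewrite mulr0.
      by rewrite -{1}(mulr0 m); apply/ltW/inc => //; rewrite mulr0.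
    have : ((c @` D) `&` V) q by split => //; exists t; rewrite ?DT.
    rewrite -hV => -[x [/= Ax Jx] Fx].
    exists (m * x); last by rewrite addr0 mm.
    rewrite addr0 in Ax; split => //=; rewrite leNgt; apply/negP => mx.
    have := inc (m * x) 0; rewrite mm mulr0 phi0 => /(_ Jx J0 mx).
    rewrite -s0 (cinj (phi x) t) ?phiP ?tq// ltNge.
    by move: t0; rewrite in_itv/= andbT => ->.
(* Here phi 0 = s > 0, and b will be so small that phi stays positive on ]-b, b[. *)
- have := transition_near emb F_cont (pn_image pn) J0 s0.
  rewrite -/phi phi0 => /nbhs_ballP[e /= e0 he].
  pose b := Num.min (e / 2) (d / 2).
  have [b1 b2] : b <= e / 2 /\ b <= d / 2 by rewrite /b !ge_min !lexx orbT.
  have b0 : 0 < b by rewrite lt_min; apply/andP; split; lra.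
  have pos x : - b < x < b -> 0 < phi (m * x).
    move=> /andP[x1 x2]; have Jx : J (m * x) by rewrite JM; apply/andP; split; lra.
    have := he (m * x); rewrite /ball/= sub0r normrN.
    have -> : `|m * x| = `|x| by case: m1 => ->; rewrite ?mul1r// mulN1r normrN.
    have xe : `|x| < e by rewrite ltr_norml; apply/andP; split; lra.
    by move=> /(_ xe Jx); rewrite ltr_norml => /andP[]; lra.
  apply: (@shift_chart _ m (- (m * b))
    ([set x | dom (m * x - m * b)] `&` `]0, 2 * b[%classic)).
  + exact: m0.
  + by apply: openI; [exact: open_affine (pn_open pn)|exact: interval_open].
  + move=> x [_ /=]; rewrite in_itv/= => /andP[x1 x2] _.
    by rewrite -mulrBr JM; apply/andP; split; lra.
  + by move=> x [].
  + exists b; last by rewrite subrr (pn_base pn).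
    split; last exact: ltW.
    split; first by rewrite /= subrr; exact: (pn_sub pn).
    by rewrite /= in_itv/=; apply/andP; split; lra.
  + move=> A oA Ad.
    have hA x : A x -> 0 < x < 2 * b by move=> /Ad[_ /=]; rewrite in_itv.
    have [V oV hV] := chart_open (open_affine (m := m) (b := b) oA).
    exists V => //; apply/seteqP; split => [_ [x [Ax x0] <-]|q [[t /= t0 tq] Vq]].
      have /andP[x1 x2] := hA _ Ax.
      have Jx : J (m * (x - b)) by rewrite JM; apply/andP; split; lra.
      have [_ Vx] : ((c @` D) `&` V) (F (m * (x - b))).
        rewrite -hV; exists (m * (x - b)) => //; split => //.
        by rewrite /= mm subrK.
      rewrite -mulrBr; split => //; exists (phi (m * (x - b))); last by rewrite phiP.
      rewrite /= in_itv/= andbT; apply/ltW/pos.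
      by apply/andP; split; lra.
    have : ((c @` D) `&` V) q by split => //; exists t; rewrite ?DT.
    rewrite -hV => -[x [/= Ax Jx] Fx].
    exists (m * x + b); last by rewrite mulrDr mm addrK.
    by split => //=; have /andP[/ltW] := hA _ Ax.
Qed.

End PlaneCharts.

(** * The expander equation *)

Section Slices.
Context {R : realType} {V : normedModType R}.

Lemma slice_fst_quotient (f : R * R -> V) (s t : R) :
  (fun h : R => h^-1 *: ((f \o shift (s, t)) (h *: ((1, 0) : R * R)) - f (s, t))) =
  (fun h : R => h^-1 *:
     (((fun s => f (s, t)) \o shift s) (h *: (1 : R)) - f (s, t))).
Proof.
apply/funext => h; congr (_ *: (f _ - _)).
by congr (_, _); rewrite /= scaler0 add0r.
Qed.

Lemma slice_snd_quotient (f : R * R -> V) (s t : R) :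
  (fun h : R => h^-1 *: ((f \o shift (s, t)) (h *: ((0, 1) : R * R)) - f (s, t))) =
  (fun h : R => h^-1 *:
     (((fun t => f (s, t)) \o shift t) (h *: (1 : R)) - f (s, t))).
Proof.
apply/funext => h; congr (_ *: (f _ - _)).
by congr (_, _); rewrite /= scaler0 add0r.
Qed.

Lemma derivable_slice_fst (f : R * R -> V) (s t : R) :
  derivable f (s, t) (1, 0) -> derivable (fun s => f (s, t)) s 1.
Proof. by rewrite /derivable slice_fst_quotient. Qed.

Lemma derive1_slice_fst (f : R * R -> V) (s t : R) :
  derive1 (fun s => f (s, t)) s = 'D_(1, 0) f (s, t).
Proof. by rewrite derive1E /derive slice_fst_quotient. Qed.

Lemma derivable_slice_snd (f : R * R -> V) (s t : R) :
  derivable f (s, t) (0, 1) -> derivable (fun t => f (s, t)) t 1.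
Proof. by rewrite /derivable slice_snd_quotient. Qed.

Lemma derive1n_slice (f : R * R -> V) (t : R) n s :
  derive1n n (fun s => f (s, t)) s = iter_derive (nseq n ((1, 0) : R * R)) f (s, t).
Proof.
elim: n s => [//|n IH] s; rewrite derive1nS /= -derive1_slice_fst.
by congr (derive1 _ s); apply/funext.
Qed.

Lemma pair_cst_continuous (t : R) : continuous (fun s : R => (s, t)).
Proof.
move=> s; exact: (cvg_pair (@cvg_id _ (nbhs s)) (@cst_continuous _ _ t s)).
Qed.

Lemma open_slice (U : set (R * R)) (t : R) :
  open U -> open [set s | U (s, t)].
Proof.
move=> oU; apply: (@open_comp _ _ (fun s : R => (s, t)) U) => //.
by move=> s _; exact: pair_cst_continuous.
Qed.

Lemma smooth_slice (U : set (R * R)) (f : R * R -> V) (t : R) : open U ->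
  smooth U f -> smooth1 [set s | U (s, t)] (fun s => f (s, t)).
Proof.
move=> oU sf.
suff h k n : Ck1 k [set s | U (s, t)] (derive1n n (fun s => f (s, t))).
  by move=> k; exact: (h k 0%N).
elim: k n => [|k IH] n /=.
  move=> s Us.
  have sz : (size (nseq n ((1, 0)%R : R * R)) <= n)%N by rewrite size_nseq.
  have [hc _] := sf n (nseq n ((1, 0) : R * R)) (s, t) sz Us.
  have -> : derive1n n (fun s => f (s, t)) =
      iter_derive (nseq n ((1, 0) : R * R)) f \o (fun s => (s, t)).
    by apply/funext => r; exact: derive1n_slice.
  apply: continuous_comp; first exact: pair_cst_continuous.
  exact: hc.
split; last by rewrite -derive1nS.
move=> s Us.
have sz : (size (nseq n ((1, 0)%R : R * R)) <= n.+1)%N by rewrite size_nseq.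
have [_ hd] := sf n.+1 (nseq n ((1, 0) : R * R)) (s, t) sz Us.
have -> : derive1n n (fun s => f (s, t)) =
    fun s => iter_derive (nseq n ((1, 0) : R * R)) f (s, t).
  by apply/funext => r; exact: derive1n_slice.
by apply: derivable_slice_fst; apply: hd; rewrite size_nseq.
Qed.

End Slices.

(** * Contact of plane curves with the osculating parabola *)

Section Contact.
Context {R : realType}.

Lemma linear_approx (h : R -> R) (s dh e : R) : is_derive s 1 h dh -> 0 < e ->
  \forall t \near s, `|h t - h s - dh * (t - s)| <= e * `|t - s|.
Proof.
move=> [dd dE] e0; have : (k^-1 *: (h (k *: 1 + s) - h s)) @[k --> 0^'] --> dh.
  by rewrite -dE.
move=> /cvgrPdist_le/(_ e e0); rewrite near_withinE.
move=> /nbhs_ballP[r /= r0 hr]; apply/nbhs_ballP; exists r => //= t.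
rewrite /ball/= distrC => tr.
have [->|ts] := eqVneq t s; first by rewrite !subrr mulr0 subrr normr0 mulr0.
have ts0 : t - s != 0 by rewrite subr_eq0.
have := hr (t - s); rewrite /ball/= sub0r normrN => /(_ tr ts0).
have -> : (t - s) *: 1 + s = t by rewrite [_ *: _]mulr1 subrK.
move=> h1; have -> : h t - h s - dh * (t - s) =
    - (dh - (t - s)^-1 *: (h t - h s)) * (t - s).
  by rewrite /GRing.scale/=; field.
by rewrite normrM normrN ler_wpM2r.
Qed.

(** Mean value theorem for h minus its Taylor polynomial m / 2 (t - s)^2, whose derivative at u is
    at most e |u - s| by the linear approximation of [dh]. *)
Lemma quadratic_approx (h dh : R -> R) (s m e : R) :
  (\forall t \near s, is_derive (t : R) 1 h (dh t)) -> is_derive s 1 dh m ->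
  h s = 0 -> dh s = 0 -> 0 < e ->
  \forall t \near s, `|h t - m / 2 * (t - s) ^+ 2| <= e * (t - s) ^+ 2.
Proof.
move=> near_dh ddh hs dhs e0.
have hn : nbhs (s : R) (fun t : R => is_derive t 1 h (dh t) /\
    `|dh t - dh s - m * (t - s)| <= e * `|t - s|).
  exact: filterI near_dh (linear_approx ddh e0).
have [r /= r0 hr] := (nbhs_ballP _ _).1 hn.
apply/nbhs_ballP; exists r => //= t tr.
pose k (u : R) : R := h u - m / 2 * (u - s) ^+ 2.
have dk (u : R) : ball s r u -> is_derive u 1 k (dh u - m * (u - s)).
  move=> /hr[du _].
  have d1 := is_derive_sub (is_derive_ident u) (is_derive_const s u).
  have := is_derive_sub du (is_derive_mul (is_derive_const (m / 2) u)
    (is_derive_mul d1 d1)).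
  by move/is_derive_eq; apply; field.
have kb (u : R) : ball s r u -> `|dh u - m * (u - s)| <= e * `|u - s|.
  by move=> /hr[_]; rewrite dhs subr0.
have ks : k s = 0 by rewrite /k hs subrr expr0n mulr0 subrr.
have sq : (t - s) ^+ 2 = `|t - s| * `|t - s| by rewrite -normrM -expr2 ger0_norm ?sqr_ge0.
rewrite -/(k t) sq.
have br a b u : ball s r a -> ball s r b -> a <= u <= b -> ball s r u.
  rewrite /ball/= !ltr_norml => /andP[a1 a2] /andP[b1 b2] /andP[u1 u2].
  by apply/andP; split; lra.
have bs : ball s r s by exact: ballxx.
have [st|ts|<-] := ltgtP s t; last by rewrite ks normr0 !mulr_ge0// ltW.
- have hd (u : R) : s <= u <= t -> is_derive u 1 k (dh u - m * (u - s)).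
    by move=> hu; apply: dk; exact: br hu.
  have [||z] := @MVT _ k (fun u => dh u - m * (u - s)) s t st.
  + by move=> u; rewrite in_itv/= => /andP[u1 u2]; apply: hd; rewrite !ltW.
  + apply: derivable_within_continuous => u; rewrite in_itv/= => hu.
    by have [] := hd u hu.
  rewrite in_itv/= ks subr0 => /andP[sz zt] ->; rewrite normrM mulrA.
  rewrite ler_wpM2r//; apply: le_trans (kb z _) _.
    by apply: (br s t) => //; rewrite !ltW.
  have n1 : `|z - s| = z - s by rewrite gtr0_norm ?subr_gt0.
  have n2 : `|t - s| = t - s by rewrite gtr0_norm ?subr_gt0.
  by apply: ler_wpM2l; [exact: ltW|rewrite n1 n2 lerD2r ltW].
- have hd (u : R) : t <= u <= s -> is_derive u 1 k (dh u - m * (u - s)).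
    by move=> hu; apply: dk; exact: br hu.
  have [||z] := @MVT _ k (fun u => dh u - m * (u - s)) t s ts.
  + by move=> u; rewrite in_itv/= => /andP[u1 u2]; apply: hd; rewrite !ltW.
  + apply: derivable_within_continuous => u; rewrite in_itv/= => hu.
    by have [] := hd u hu.
  rewrite in_itv/= ks sub0r => /andP[tz zs] e1.
  rewrite -normrN e1 normrM mulrA [`|s - t|]distrC.
  rewrite ler_wpM2r//; apply: le_trans (kb z _) _.
    by apply: (br t s) => //; rewrite !ltW.
  have n1 : `|z - s| = s - z by rewrite ltr0_norm ?subr_lt0// opprB.
  have n2 : `|t - s| = s - t by rewrite ltr0_norm ?subr_lt0// opprB.
  by apply: ler_wpM2l; [exact: ltW|rewrite n1 n2 lerD2l lerN2 ltW].
Qed.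

(* The curve [(x, y)] is, to second order at [s], the parabola
   [g = rho f^2] in the orthogonal frame given by its tangent. *)
Lemma osculating_parabola (x y a b : R -> R) (s a' b' e : R) :
  (\forall t \near s, is_derive (t : R) 1 x (a t)) ->
  (\forall t \near s, is_derive (t : R) 1 y (b t)) ->
  is_derive s 1 a a' -> is_derive s 1 b b' ->
  0 < a s ^+ 2 + b s ^+ 2 -> 0 < e ->
  let f (t : R) : R := a s * (x t - x s) + b s * (y t - y s) in
  let g (t : R) : R := a s * (y t - y s) - b s * (x t - x s) in
  let rho := (a s * b' - b s * a') / (2 * (a s ^+ 2 + b s ^+ 2) ^+ 2) in
  \forall t \near s, `|g t - rho * f t ^+ 2| <= e * f t ^+ 2.
Proof.
move=> dx dy da db l0 e0 f g rho; set l := _ + _ in l0.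
have dX (t : R) : is_derive t 1 x (a t) -> is_derive t 1 (fun t => x t - x s) (a t).
  by move=> h; move: (is_derive_sub h (is_derive_const (x s) t)); rewrite subr0.
have dY (t : R) : is_derive t 1 y (b t) -> is_derive t 1 (fun t => y t - y s) (b t).
  by move=> h; move: (is_derive_sub h (is_derive_const (y s) t)); rewrite subr0.
have df : \forall t \near s, is_derive (t : R) 1 f (a s * a t + b s * b t).
  apply: filterS2 dx dy => t /dX h1 /dY h2.
  have := is_derive_add (is_derive_mul (is_derive_const (a s) t) h1)
    (is_derive_mul (is_derive_const (b s) t) h2).
  by move/is_derive_eq; apply; ring.
have dg : \forall t \near s, is_derive (t : R) 1 g (a s * b t - b s * a t).
  apply: filterS2 dx dy => t /dX h1 /dY h2.
  have := is_derive_sub (is_derive_mul (is_derive_const (a s) t) h2)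
    (is_derive_mul (is_derive_const (b s) t) h1).
  by move/is_derive_eq; apply; ring.
have fs : f s = 0 by rewrite /f !subrr !mulr0 addr0.
have gs : g s = 0 by rewrite /g !subrr !mulr0 subr0.
have dfs : is_derive s 1 f l.
  by move: (nbhs_singleton df); rewrite -!expr2.
pose H (t : R) : R := g t - rho * f t ^+ 2.
pose H' (t : R) : R := (a s * b t - b s * a t) - rho * (2 * f t * (a s * a t + b s * b t)).
have dH : \forall t \near s, is_derive (t : R) 1 H (H' t).
  apply: filterS2 df dg => t h1 h2.
  have := is_derive_sub h2 (is_derive_mul (is_derive_const rho t)
    (is_derive_mul h1 h1)).
  by move/is_derive_eq; apply; rewrite /H'; ring.
have ddH : is_derive s 1 H' 0.
  have h1 := is_derive_sub (is_derive_mul (is_derive_const (a s) s) db)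
    (is_derive_mul (is_derive_const (b s) s) da).
  have h2 := is_derive_add (is_derive_mul (is_derive_const (a s) s) da)
    (is_derive_mul (is_derive_const (b s) s) db).
  have h3 := is_derive_mul (is_derive_mul (is_derive_const 2 s) dfs) h2.
  have := is_derive_sub h1 (is_derive_mul (is_derive_const rho s) h3).
  move/is_derive_eq; apply; rewrite fs !mulr0 /rho -/l.
  by field; exact: lt0r_neq0.
have Hs : H s = 0 by rewrite /H gs fs expr0n mulr0 subr0.
have H's : H' s = 0 by rewrite /H' fs mulr0 mul0r mulr0; ring.
(* f has derivative l at s, so |f t| >= (l / 2) |t - s| nearby; this tolerance turns an error in (t
   - s)^2 into one in f^2. *)
have e1 : 0 < e * (l / 2) ^+ 2 by rewrite mulr_gt0// exprn_gt0// divr_gt0.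
have l2 : 0 < l / 2 by rewrite divr_gt0.
apply: filterS2 (quadratic_approx dH ddH Hs H's e1) (linear_approx dfs l2) => t.
rewrite -/(H t) mul0r mul0r subr0 fs subr0 => h1 h2.
apply: le_trans h1 _; rewrite -mulrA ler_pM2l// -exprMn.
have h3 : l / 2 * `|t - s| <= `|f t|.
  have h4 : `|l * (t - s)| <= `|f t| + l / 2 * `|t - s|.
    apply: le_trans (_ : `|f t| + `|f t - l * (t - s)| <= _); last by rewrite lerD2l.
    by have := ler_normB (f t) (f t - l * (t - s)); rewrite opprB addrC subrK.
  by rewrite normrM gtr0_norm// in h4; lra.
rewrite -[leRHS]real_normK ?num_real// -[leLHS]real_normK ?num_real//.
by rewrite ler_pXn2r ?nnegrE// normrM (gtr0_norm l2).
Qed.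

End Contact.

Section ParabolaContact.
Context {R : realType}.

Lemma arbitrarily_small_eq0 (m C : R) :
  (forall e : R, 0 < e -> e <= 1 -> `|m| <= e * C) -> m = 0.
Proof.
move=> h; apply/eqP; apply: contraT => m0.
have mp : 0 < `|m| by rewrite normr_gt0.
have C0 : 0 < C by have := h 1 ltr01 (lexx _); rewrite mul1r; exact: lt_le_trans.
pose e := Num.min 1 (`|m| / (2 * C)).
have e0 : 0 < e by rewrite lt_min ltr01 divr_gt0// mulr_gt0.
have e1 : e <= 1 by rewrite ge_min lexx.
have e2 : e * C <= `|m| / 2.
  rewrite -ler_pdivlMr// /e ge_min; apply/orP; right.
  by rewrite -mulrA -invfM.
by have := le_trans (h e e0 e1) e2; lra.
Qed.

Variables (G F : R -> R) (s rho k : R).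
Hypotheses (dF : is_derive s 1 F k) (Fs : F s = 0) (Gs : G s = 0).
(** G is rho F^2 up to o(F^2). The estimate is one-sided so that the parameter intervals ]-d, d[ and
    [0, d[ are treated alike. *)
Hypothesis parab : forall e : R, 0 < e ->
  \forall t \near s^'+, `|G t - rho * F t ^+ 2| <= e * F t ^+ 2.

Let near_right (P : set R) : (\forall t \near s, P t) -> \forall t \near s^'+, P t.
Proof. by move=> h; rewrite near_withinE; apply: filterS h => t. Qed.

Let sqr_ler (u v : R) : `|u| <= v -> u ^+ 2 <= v ^+ 2.
Proof.
move=> uv; rewrite -real_normK ?num_real// ler_pXn2r ?nnegrE//.
exact: le_trans uv.
Qed.

(** G is O(F^2), hence O((t - s)^2), whereas a nonzero derivative would make it of order t - s. *)
Lemma parabola_first_order m : is_derive s 1 G m -> m = 0.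
Proof.
move=> dG; apply: (@arbitrarily_small_eq0 _ (1 + (`|rho| + 1) * (`|k| + 1) ^+ 2)).
move=> e e0 e1; near (s^'+) => t.
have st : s < t by near: t; exact: nbhs_right_gt.
have te : t < s + e by near: t; apply: nbhs_right_lt; rewrite ltrDl.
have h1 : `|G t - G s - m * (t - s)| <= e * `|t - s|.
  by near: t; apply: near_right; exact: linear_approx.
have h2 : `|F t - F s - k * (t - s)| <= 1 * `|t - s|.
  by near: t; apply: near_right; exact: linear_approx.
have h3 : `|G t - rho * F t ^+ 2| <= 1 * F t ^+ 2 by near: t; exact: parab.
move: h1 h2 h3; rewrite Gs Fs !subr0 !mul1r (_ : `|t - s| = t - s); last by rewrite gtr0_norm ?subr_gt0.
set h := t - s; have h0 : 0 < h by rewrite subr_gt0.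
have he : h <= e by rewrite /h; lra.
move=> h1 h2 h3.
have h4 : `|F t| <= (`|k| + 1) * h.
  have := ler_normD (F t - k * h) (k * h); rewrite subrK normrM (gtr0_norm h0).
  by rewrite mulrDl mul1r; lra.
have h5 := sqr_ler h4.
have h6 : `|G t| <= (`|rho| + 1) * F t ^+ 2.
  have := ler_normD (G t - rho * F t ^+ 2) (rho * F t ^+ 2).
  by rewrite subrK normrM (ger0_norm (sqr_ge0 _)); lra.
have h7 : `|m| * h <= e * h + `|G t|.
  have := ler_normB (G t) (G t - m * h).
  by rewrite opprB addrC subrK normrM (gtr0_norm h0); lra.
have h8 : (`|rho| + 1) * F t ^+ 2 <= (`|rho| + 1) * ((`|k| + 1) * h) ^+ 2.
  by rewrite ler_wpM2l// addr_ge0.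
rewrite -(ler_pM2r h0); apply: le_trans h7 _.
have h9 : (`|rho| + 1) * ((`|k| + 1) * h) ^+ 2 <=
    (`|rho| + 1) * (`|k| + 1) ^+ 2 * (e * h).
  rewrite exprMn mulrA; apply: ler_wpM2l.
    by rewrite mulr_ge0 ?sqr_ge0 ?addr_ge0.
  by rewrite expr2; apply: ler_wpM2r => //; exact: ltW.
by lra.
Unshelve. all: by end_near. Qed.

(** To second order G is m h^2 / 2 and F is k h with h = t - s; substitute in G = rho F^2. *)
Lemma parabola_second_order dG m :
  (\forall t \near s, is_derive (t : R) 1 G (dG t)) -> is_derive s 1 dG m ->
  m = 2 * rho * k ^+ 2.
Proof.
move=> nG ddG; have dGs : dG s = 0.
  exact: parabola_first_order (nbhs_singleton nG).
apply/eqP; rewrite -subr_eq0; apply/eqP.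
apply: (@arbitrarily_small_eq0 _
  (2 * (1 + `|rho| * (2 * `|k| + 1) + (`|k| + 1) ^+ 2))).
move=> e e0 e1; near (s^'+) => t.
have st : s < t by near: t; exact: nbhs_right_gt.
have h1 : `|G t - m / 2 * (t - s) ^+ 2| <= e * (t - s) ^+ 2.
  by near: t; apply: near_right; exact: (quadratic_approx nG).
have h2 : `|F t - F s - k * (t - s)| <= e * `|t - s|.
  by near: t; apply: near_right; exact: linear_approx.
have h3 : `|G t - rho * F t ^+ 2| <= e * F t ^+ 2 by near: t; exact: parab.
move: h1 h2 h3; rewrite Fs !subr0 (_ : `|t - s| = t - s); last by rewrite gtr0_norm ?subr_gt0.
set h := t - s; have h0 : 0 < h by rewrite subr_gt0.
move=> h1 h2 h3; have hh : 0 < h ^+ 2 by rewrite exprn_gt0.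
have h4 : `|F t| <= (`|k| + 1) * h.
  have := ler_normD (F t - k * h) (k * h); rewrite subrK normrM (gtr0_norm h0).
  have : e * h <= h by rewrite ler_piMl// ltW.
  by lra.
have h5 := sqr_ler h4.
have h6 : `|F t ^+ 2 - k ^+ 2 * h ^+ 2| <= e * (2 * `|k| + 1) * h ^+ 2.
  have -> : F t ^+ 2 - k ^+ 2 * h ^+ 2 = (F t - k * h) * (F t + k * h) by ring.
  have -> : e * (2 * `|k| + 1) * h ^+ 2 = (e * h) * ((2 * `|k| + 1) * h) by ring.
  rewrite normrM ler_pM//; apply: le_trans (ler_normD _ _) _.
  by rewrite normrM (gtr0_norm h0); lra.
have h7 : `|rho * (F t ^+ 2 - k ^+ 2 * h ^+ 2)| <=
    `|rho| * (e * (2 * `|k| + 1) * h ^+ 2) by rewrite normrM ler_wpM2l.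
have h8 : e * F t ^+ 2 <= e * ((`|k| + 1) * h) ^+ 2 by rewrite ler_pM2l.
have h9 : `|(m - 2 * rho * k ^+ 2) / 2| * h ^+ 2 <= e * h ^+ 2 +
    `|rho| * (e * (2 * `|k| + 1) * h ^+ 2) + e * ((`|k| + 1) * h) ^+ 2.
  rewrite -[X in _ * X <= _]gtr0_norm// -normrM.
  have -> : (m - 2 * rho * k ^+ 2) / 2 * h ^+ 2 =
    (G t - rho * F t ^+ 2) + rho * (F t ^+ 2 - k ^+ 2 * h ^+ 2) -
    (G t - m / 2 * h ^+ 2) by field.
  apply: le_trans (ler_normB _ _) _; have := ler_normD (G t - rho * F t ^+ 2)
    (rho * (F t ^+ 2 - k ^+ 2 * h ^+ 2)).
  by lra.
have n2 : `|(m - 2 * rho * k ^+ 2) / 2| = `|m - 2 * rho * k ^+ 2| / 2.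
  by rewrite normrM (gtr0_norm (_ : 0 < 2^-1 :> R)).
by rewrite -(ler_pM2r hh); move: h9; rewrite n2 exprMn; lra.
Unshelve. all: by end_near. Qed.

End ParabolaContact.

Section CurveContact.
Context {R : realType}.

Variables (D : set R) (c : R -> 'rV[R]_2) (a b : R -> R) (s a' b' : R).
Hypotheses (emb : embedded D c) (Ds : D s).
Hypotheses (dx : \forall t \near s, is_derive (t : R) 1 (fun t => c t 0 0) (a t))
  (dy : \forall t \near s, is_derive (t : R) 1 (fun t => c t 0 1) (b t))
  (da : is_derive s 1 a a') (db : is_derive s 1 b b')
  (reg : 0 < a s ^+ 2 + b s ^+ 2).
Variables (q : R -> 'rV[R]_2) (t0 qa qb : R).
Hypotheses (qt0 : q t0 = c s).
Hypotheses (q_trace : \forall t \near t0^'+, (c @` D) (q t)).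
Hypotheses (dqx : is_derive t0 1 (fun t => q t 0 0) qa)
  (dqy : is_derive t0 1 (fun t => q t 0 1) qb).

Let rho := (a s * b' - b s * a') / (2 * (a s ^+ 2 + b s ^+ 2) ^+ 2).
Let F t := a s * (q t 0 0 - c s 0 0) + b s * (q t 0 1 - c s 0 1).
Let G t := a s * (q t 0 1 - c s 0 1) - b s * (q t 0 0 - c s 0 0).

Let q_cont : {for t0, continuous q}.
Proof.
apply: cvg_row; apply: forall_ord2; first exact: is_derive_continuous dqx.
exact: is_derive_continuous dqy.
Qed.

(** The point q t is c u for some u, and continuity of the inverse of c brings u into the range of
    the osculating estimate. The dependence of u on t may be arbitrary. *)
Let parab (e : R) : 0 < e ->
  \forall t \near t0^'+, `|G t - rho * F t ^+ 2| <= e * F t ^+ 2.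
Proof.
move=> e0.
have /nbhs_ballP[r /= r0 hr] := osculating_parabola dx dy da db reg e0.
have [W [oW Wc hW]] := embedded_inverse emb Ds r0.
have near_W : \forall t \near t0^'+, W (q t).
  rewrite near_withinE; apply: (@filterS _ (nbhs t0) _ (q @^-1` W)) => //.
  by apply: q_cont; apply: open_nbhs_nbhs; rewrite qt0.
apply: filterS2 q_trace near_W => t [u Du cu] Wu.
rewrite -cu in Wu; rewrite /F /G -cu.
have /= h := hr u; apply: h.
by rewrite /ball/= distrC; exact: hW.
Qed.

Let dF : is_derive t0 1 F (a s * qa + b s * qb).
Proof.
have hx := is_derive_sub dqx (is_derive_const (c s 0 0) t0).
have hy := is_derive_sub dqy (is_derive_const (c s 0 1) t0).
have := is_derive_add (is_derive_mul (is_derive_const (a s) t0) hx)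
  (is_derive_mul (is_derive_const (b s) t0) hy).
by move/is_derive_eq; apply; ring.
Qed.

Let Fs : F t0 = 0. Proof. by rewrite /F qt0 !subrr !mulr0 addr0. Qed.
Let Gs : G t0 = 0. Proof. by rewrite /G qt0 !subrr !mulr0 subr0. Qed.

Lemma contact_first_order : a s * qb - b s * qa = 0.
Proof.
apply: (parabola_first_order dF Fs Gs parab).
have hx := is_derive_sub dqx (is_derive_const (c s 0 0) t0).
have hy := is_derive_sub dqy (is_derive_const (c s 0 1) t0).
have := is_derive_sub (is_derive_mul (is_derive_const (a s) t0) hy)
  (is_derive_mul (is_derive_const (b s) t0) hx).
by move/is_derive_eq; apply; ring.
Qed.

Lemma contact_second_order (dqx' dqy' : R -> R) qa' qb' :
  (\forall t \near t0, is_derive (t : R) 1 (fun t => q t 0 0) (dqx' t)) ->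
  (\forall t \near t0, is_derive (t : R) 1 (fun t => q t 0 1) (dqy' t)) ->
  is_derive t0 1 dqx' qa' -> is_derive t0 1 dqy' qb' ->
  a s * qb' - b s * qa' = 2 * rho * (a s * qa + b s * qb) ^+ 2.
Proof.
move=> nx ny hx' hy'.
apply: (parabola_second_order dF Fs Gs parab
  (dG := fun t => a s * dqy' t - b s * dqx' t)).
  apply: filterS2 nx ny => t hx hy.
  have h1 := is_derive_sub hx (is_derive_const (c s 0 0) t).
  have h2 := is_derive_sub hy (is_derive_const (c s 0 1) t).
  have := is_derive_sub (is_derive_mul (is_derive_const (a s) t) h2)
    (is_derive_mul (is_derive_const (b s) t) h1).
  by move/is_derive_eq; apply; ring.
Qed.

End CurveContact.

Section ContactAlgebra.
Context {R : realType}.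

(* Parallel tangents [(al, be) = lam (a, b)] let the curvature of the second
   curve be read off the first one. *)
Lemma contact_algebra (a b K p0 p1 al be al' be' w0 w1 n : R) :
  0 < a ^+ 2 + b ^+ 2 -> a * be - b * al = 0 ->
  a * be' - b * al' =
    2 * (K / (2 * (a ^+ 2 + b ^+ 2) ^+ 2)) * (a * al + b * be) ^+ 2 ->
  a * (w1 - p1 / 2) - b * (w0 - p0 / 2) = 0 ->
  0 < al ^+ 2 + be ^+ 2 -> n ^+ 2 = al ^+ 2 + be ^+ 2 ->
  w0 * - (n^-1 * be) + w1 * (n^-1 * al) =
    (al' * - (n^-1 * be) + be' * (n^-1 * al)) / n ^+ 2 ->
  K = (a ^+ 2 + b ^+ 2) * (p1 * a - p0 * b) / 2.
Proof.
set l := a ^+ 2 + b ^+ 2 => l0 par second first2 reg n2 floweq.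
have ln := lt0r_neq0 l0.
have n0 : n != 0 by apply: contraTneq reg => n0; rewrite -n2 n0 expr0n ltxx.
have flow1 : (al * w1 - be * w0) * n ^+ 2 = al * be' - be * al'.
  have -> : (al * w1 - be * w0) * n ^+ 2 =
    (w0 * - (n^-1 * be) + w1 * (n^-1 * al)) * n ^+ 3 by field.
  by rewrite floweq; field.
pose lam := (a * al + b * be) / l.
have lamE : a * al + b * be = lam * l by rewrite /lam divfK.
have alE : al = lam * a.
  have -> : lam * a = al + b * (a * be - b * al) / l by rewrite /lam /l; field.
  by rewrite par mulr0 mul0r addr0.
have beE : be = lam * b.
  have -> : lam * b = be - a * (a * be - b * al) / l by rewrite /lam /l; field.
  by rewrite par mulr0 mul0r subr0.
have lam0 : lam != 0.
  by apply: contraTneq reg => e; rewrite alE beE e !mul0r expr0n addr0 ltxx.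
have nl : n ^+ 2 = lam ^+ 2 * l by rewrite n2 alE beE /l; ring.
(* As w - p / 2 is tangent, the normal velocity is half of <p, N>; this turns the flow equation into
   one for the curvature. *)
have h1 : a * w1 - b * w0 = (p1 * a - p0 * b) / 2.
  by apply/eqP; rewrite -subr_eq0; apply/eqP; rewrite -[RHS]first2; field.
have h2 : a * be' - b * al' = K * lam ^+ 2.
  by rewrite second lamE; field.
have lam3 : lam ^+ 3 != 0 by rewrite expf_neq0.
apply: (mulfI lam3).
have -> : lam ^+ 3 * K = al * be' - be * al'.
  have -> : al * be' - be * al' = lam * (a * be' - b * al') by rewrite alE beE; ring.
  by rewrite h2; ring.
rewrite -flow1 nl; have -> : al * w1 - be * w0 = lam * (a * w1 - b * w0).
  by rewrite {1}alE {1}beE; ring.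
by rewrite h1; field.
Qed.

End ContactAlgebra.

(** * The flow at time 1 *)

Section FlowAtTimeOne.
Context {R : realType}.

Lemma curve_dom_closed (k : curve_kind) : closed (@curve_dom R k).
Proof.
case: k => /=; [exact: interval_closed|exact: interval_closed|exact: closedT].
Qed.

Lemma curve_end_dom (k : curve_kind) (s : R) : curve_end k s -> curve_dom k s.
Proof.
case: k => //= [[]|] ->; rewrite in_itv/= ?lexx ?ler01//.
Qed.

Lemma proper_embedding_embedded (k : curve_kind) (c : R -> 'rV[R]_2) :
  proper_embedding k c -> embedded (curve_dom k) c.
Proof.
case=> -[U [oU DU cU]] inj _ prop; split => //.
- exact: curve_dom_closed.
- by move=> s /DU Us; have [] := cU [::] s isT Us.
- by move=> s t Ds Dt; apply: inj; rewrite inE.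
Qed.

Lemma proper_embedding_C2 (k : curve_kind) (c : R -> 'rV[R]_2) :
  proper_embedding k c -> exists U : set R, [/\ open U, curve_dom k `<=` U,
    forall s, U s -> derivable c s 1 &
    forall s, U s -> derivable (derive1 c) s 1].
Proof.
case=> -[U [oU DU cU]] _ _ _; exists U; split => // s Us.
  by have [_ h] := cU [::] s isT Us; exact: h.
have [_ h] := cU [:: 1] s isT Us; have := h isT 1.
by rewrite /= (_ : 'D_1 c = derive1 c)//; apply/funext => r; rewrite derive1E.
Qed.

Variable gamma : R -> network R.
Hypothesis flow : network_flow gamma.
Hypothesis similar : self_similar (world_sheet gamma).

Lemma support_self_similar (t : R) p : 0 < t ->
  net_support (gamma t) p <-> net_support (gamma 1) ((Num.sqrt t)^-1 *: p).
Proof.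
move=> t0; have r0 : 0 < Num.sqrt t by rewrite sqrtr_gt0.
have rn := lt0r_neq0 r0; have r2 : Num.sqrt t ^+ 2 = t by rewrite sqr_sqrtr// ltW.
split=> h.
  have : world_sheet gamma (p, t) by split => //=; exact: ltW.
  rewrite -(similar r0) => -[[q u] [/= u0 hq]] [e1 e2].
  have u1 : u = 1.
    by apply: (mulfI (lt0r_neq0 t0)); rewrite mulr1 -[RHS]e2 r2.
  rewrite u1 in hq.
  by rewrite -e1 scalerA mulVf// scale1r.
have : world_sheet gamma ((Num.sqrt t)^-1 *: p, 1) by split => //=; exact: ler01.
move=> w; have : (dilation (Num.sqrt t) @` world_sheet gamma) (p, t).
  exists ((Num.sqrt t)^-1 *: p, 1) => //.
  by rewrite /dilation/= scalerA divff// scale1r mulr1 r2.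
by rewrite similar// => -[].
Qed.

(** The flow does not relate the indices of curves at different times, so for t near 1 the point F 0
    t is only recorded as a point of the support. *)
Lemma flow_param (i : 'I_(net_size (gamma 1))) p : curve_trace i p ->
  exists (d : R) (J dom : set R) (F : R -> R -> 'rV[R]_2) (W : set 'rV[R]_2),
  [/\ param_near (curve_dom (net_kind i)) (net_curve i) p d J dom (F^~ 1) W,
      derivable (F 0) 1 1,
      dot (derive1 (F 0) 1) (unit_normal (F^~ 1) 0) = curvature (F^~ 1) 0 &
      \forall t \near (1 : R), net_support (gamma t) (F 0 t)].
Proof.
move=> ip; have [_ _ _ moves] := flow.
have [d [J [F [/andP[d0 _] JE [F0 [U [oU JU sU]]] [Finj Freg [W oW FW]] Ft]]]] :=
  moves 1 ltr01 i p ip.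
have J0 : J 0 by case: JE => ->; rewrite /= in_itv/= ?lexx ?oppr_lt0 d0.
have in1 : 1 - d < 1 < 1 + d by apply/andP; split; lra.
have JU1 s : J s -> U (s, 1).
  by move=> Js; apply: JU; split => //=; rewrite in_itv.
exists d, J, [set s | U (s, 1)], F, W; split.
- split => //.
  + exact: open_slice.
  + exact: (smooth_slice 1 oU sU).
  + by move=> x y Jx Jy; apply: Finj; rewrite inE.
- apply: (derivable_slice_snd (f := fun z => F z.1 z.2)).
  by have [_ h] := sU 1%N [::] (0, 1) isT (JU1 0 J0); exact: h.
- by have [_ h] := Ft 1 in1; exact: h.
- apply/nbhs_ballP; exists d => //= t; rewrite /ball/= ltr_norml => /andP[t1 t2].
  have td : 1 - d < t < 1 + d by apply/andP; split; lra.
  have [[j [_ _ [V _ FV]]] _] := Ft t td.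
  exists j => //; have : (F^~ t @` J) (F 0 t) by exists 0.
  by rewrite FV => -[].
Qed.

(** Distinct curves meet only at ends of both, and an end parameter has no neighbourhood inside the
    domain. *)
Lemma interior_point_unique (i j : 'I_(net_size (gamma 1))) (s e : R) :
  0 < e -> (forall t, `|t - s| < e -> curve_dom (net_kind i) t) ->
  j != i -> ~ curve_trace j (net_curve i s).
Proof.
move=> e0 De ji jc; have [net _ _ _] := flow.
have [pe inter] := net 1 ler01.
have emb := proper_embedding_embedded (pe i).
have Ds : curve_dom (net_kind i) s by apply: De; rewrite subrr normr0.
have trace_s : curve_trace i (net_curve i s) by exists s.
have [|[s' es' cs'] _] := inter i j _ _ trace_s jc; first by rewrite eq_sym.
have ss : s' = s by apply: (emb_inj emb) => //; exact: curve_end_dom.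
rewrite ss in es'; have n1 := De (s - e / 2); have n2 := De (s + e / 2).
have h1 : `|s - e / 2 - s| < e by rewrite ltr_norml; apply/andP; split; lra.
have h2 : `|s + e / 2 - s| < e by rewrite ltr_norml; apply/andP; split; lra.
move: (n1 h1) (n2 h2) es' => {n1 n2 De}.
case: (net_kind i) => //=; rewrite !in_itv/=.
  by move=> /andP[h3 h4] /andP[h5 h6] [] h7; lra.
by rewrite !andbT => h3 h4 h5; lra.
Qed.

(** Two curves through c s run in the trace: [q1], the parametrization F at time 1, whose contact
    carries the curvature of F over to c, and [q2 t = F 0 t / sqrt t], whose velocity F_t - c s / 2
    has to be tangent. The ball around s makes c s an interior point of its curve, which is what
    confines [q2] to that curve. *)
Lemma expander_equation (i : 'I_(net_size (gamma 1))) (s e : R) :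
  0 < e -> (forall t, `|t - s| < e -> curve_dom (net_kind i) t) ->
  let c := net_curve i in
  let v := derive1 c s in let w := derive1 (derive1 c) s in
  v 0 0 * w 0 1 - v 0 1 * w 0 0 =
  (v 0 0 ^+ 2 + v 0 1 ^+ 2) * (c s 0 1 * v 0 0 - c s 0 0 * v 0 1) / 2.
Proof.
move=> e0 De c v w; have [net _ _ _] := flow.
have [pe inter] := net 1 ler01; have pei := pe i.
have emb := proper_embedding_embedded pei.
have Ds : curve_dom (net_kind i) s by apply: De; rewrite subrr normr0.
have [U [oU DU dc ddc]] := proper_embedding_C2 pei.
have nU : \forall t \near s, U t by apply: open_near_in => //; exact: DU.
have dx : \forall t \near s,
    is_derive (t : R) 1 (fun t => c t 0 0) (derive1 c t 0 0).
  by apply: filterS nU => t Ut; exact/is_derive_coord/derivable_is_derive/dc.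
have dy : \forall t \near s,
    is_derive (t : R) 1 (fun t => c t 0 1) (derive1 c t 0 1).
  by apply: filterS nU => t Ut; exact/is_derive_coord/derivable_is_derive/dc.
have da : is_derive s 1 (fun t => derive1 c t 0 0) (w 0 0).
  exact/is_derive_coord/derivable_is_derive/ddc/DU.
have db : is_derive s 1 (fun t => derive1 c t 0 1) (w 0 1).
  exact/is_derive_coord/derivable_is_derive/ddc/DU.
have nz (z : 'rV[R]_2) : z != 0 -> 0 < z 0 0 ^+ 2 + z 0 1 ^+ 2.
  move=> z0; rewrite lt_neqAle addr_ge0 ?sqr_ge0// andbT eq_sym.
  apply: contra z0; rewrite paddr_eq0 ?sqr_ge0// !sqrf_eq0 => /andP[/eqP z1 /eqP z2].
  by apply/eqP/row2P; rewrite ?z1 ?z2 mxE.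
have reg : 0 < v 0 0 ^+ 2 + v 0 1 ^+ 2.
  by apply: nz; have [_ _ h _] := pei; exact: h.
have trace_s : curve_trace i (c s) by exists s.
have [d [J [dom [F [W [pn dF0 floweq near_supp]]]]]] := flow_param trace_s.
have [d0 JE odom Jdom smF F0 _ Freg _ FW] := pn.
have J0 : J 0 by case: JE => ->; rewrite /= in_itv/= ?lexx ?oppr_lt0 d0.
pose q1 (t : R) : 'rV[R]_2 := F t 1.
have smq : smooth1 dom q1 := smF.
have near_dom : \forall t \near (0 : R), dom t by apply: open_near_in => //; exact: Jdom.
have dq1 : \forall t \near (0 : R), is_derive (t : R) 1 q1 (derive1 q1 t).
  by apply: filterS near_dom => t dt; exact: (@Ck1_is_derive _ _ 0 dom q1 t (smq 1%N) dt).
have q1_trace : \forall t \near 0^'+, (c @` curve_dom (net_kind i)) (q1 t).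
  near=> t; have Jt : J t.
    have t0 : 0 < t by near: t; exact: nbhs_right_gt.
    have td : t < d by near: t; exact: nbhs_right_lt.
    have tnd : - d < t by apply: lt_trans t0; rewrite oppr_lt0.
    by case: JE => ->; rewrite /= in_itv/= td ?tnd ?(ltW t0).
  have : ((F^~ 1) @` J) (q1 t) by exists t.
  by rewrite FW => -[].
have dq1x : is_derive (0 : R) 1 (fun t => q1 t 0 0) (derive1 q1 0 0 0).
  by apply: is_derive_coord; exact: nbhs_singleton dq1.
have dq1y : is_derive (0 : R) 1 (fun t => q1 t 0 1) (derive1 q1 0 0 1).
  by apply: is_derive_coord; exact: nbhs_singleton dq1.
have first1 := contact_first_order emb Ds dx dy da db reg F0 q1_trace dq1x dq1y.
have ddq1 : is_derive (0 : R) 1 (derive1 q1) (derive1 (derive1 q1) 0).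
  by have [_ h] := smq 2%N; apply: (@Ck1_is_derive _ _ 0 dom _ 0 h); exact: Jdom.
have nq1 k : \forall t \near (0 : R),
    is_derive (t : R) 1 (fun t => q1 t 0 k) (derive1 q1 t 0 k).
  by apply: filterS dq1 => t h; exact: is_derive_coord.
have ddq1x k : is_derive (0 : R) 1 (fun t => derive1 q1 t 0 k)
    (derive1 (derive1 q1) 0 0 k) by exact: is_derive_coord.
have second1 := contact_second_order emb Ds dx dy da db reg F0 q1_trace dq1x dq1y
  (nq1 0) (nq1 1) (ddq1x 0) (ddq1x 1).
pose q2 (t : R) : 'rV[R]_2 := (Num.sqrt t)^-1 *: F 0 t.
have q2c : q2 1 = c s by rewrite /q2 sqrtr1 invr1 scale1r.
have dsq : is_derive (1 : R) 1 (fun t => (Num.sqrt t)^-1) (- (1 / 2) : R).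
  have h0 : Num.sqrt 1 != 0 :> R by rewrite sqrtr1 oner_neq0.
  have := is_derive_inv h0 (is_derive1_sqrt ltr01).
  by move/is_derive_eq; apply; rewrite sqrtr1; field.
have dF0' := derivable_is_derive dF0.
have dq2 j : is_derive (1 : R) 1 (fun t => q2 t 0 j)
    (derive1 (F 0) 1 0 j - c s 0 j / 2).
  have := is_derive_mul dsq (@is_derive_coord _ _ _ _ _ _ _ j dF0').
  rewrite (_ : (fun y => _) = (fun t => q2 t 0 j)); last first.
    by apply/funext => t; rewrite mxE.
  by move/is_derive_eq; apply; rewrite sqrtr1 -F0; field.
have q2_cont : {for (1 : R), continuous q2}.
  by apply: cvg_row => j; exact: is_derive_continuous (dq2 j).
(* Self-similarity puts [q2 t] on the network at time 1. Every other curve has a closed trace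
   missing c s, so for t near 1 it is curve i that contains [q2 t]. *)
have other := interior_point_unique e0 De.
have q2_trace : \forall t \near 1^'+, (c @` curve_dom (net_kind i)) (q2 t).
  rewrite near_withinE.
  have near_other : \forall t \near (1 : R), forall j, j != i -> ~ curve_trace j (q2 t).
    apply: (@filter_forall R _ (fun j t => j != i -> ~ curve_trace j (q2 t))
      (nbhs (1 : R))) => j.
    case: (eqVneq j i) => [->|ji]; first exact: nearW.
    have cl := embedded_closed_trace (proper_embedding_embedded (pe j)).
    have : nbhs (1 : R) (q2 @^-1` (~` curve_trace j)).
      apply: q2_cont; apply: open_nbhs_nbhs; split; first exact: closed_openC.
      by rewrite q2c; exact: other.
    by apply: filterS => t h _.
  have pos : \forall t \near (1 : R), 0 < t by exact: lt_nbhsr.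
  apply: filterS3 near_other near_supp pos => t h1 h2 t0 _.
  have [j _ hj] := (support_self_similar _ t0).1 h2.
  have [ji|ji] := eqVneq j i; first by move: hj; rewrite ji.
  by have := h1 j ji hj.
have first2 := contact_first_order emb Ds dx dy da db reg q2c q2_trace (dq2 0) (dq2 1).
have reg1 := nz _ (Freg 0 J0).
move: floweq; rewrite /curvature /unit_normal /unit_tangent !dotE /rot90 !mxE /=.
exact: contact_algebra reg first1 second1 first2 reg1 (enorm_sqr _).
Unshelve. all: by end_near. Qed.

End FlowAtTimeOne.

(** * Projection to the half-sphere *)

Section HalfSphere.
Context {R : realType}.
Local Notation spacetime := ('rV[R]_2 * R)%type.

(** Homogeneous of degree 4 under the dilations and equal to 1 on S, hence the double square root in
    [scale_to_sphere]. *)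
Definition quartic (q : spacetime) : R := dot q.1 q.1 ^+ 2 + q.2 ^+ 2.

Definition scale_to_sphere (q : spacetime) : R := (Num.sqrt (Num.sqrt (quartic q)))^-1.

Definition normalize (q : spacetime) : spacetime := dilation (scale_to_sphere q) q.

Definition sigma (p : 'rV[R]_2) : spacetime := normalize (p, 1).

Definition sigma_inv (z : spacetime) : 'rV[R]_2 := (Num.sqrt z.2)^-1 *: z.1.

Lemma dilation_comp a b (q : spacetime) : dilation a (dilation b q) = dilation (a * b) q.
Proof. by rewrite /dilation /= scalerA mulrA exprMn. Qed.

Lemma dilation1 (q : spacetime) : dilation 1 q = q.
Proof. by case: q => p t; rewrite /dilation /= scale1r expr1n mul1r. Qed.

Lemma dotZ (a : R) (p : 'rV[R]_2) : dot (a *: p) (a *: p) = a ^+ 2 * dot p p.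
Proof. by rewrite !dotE !mxE; ring. Qed.

Lemma quartic_ge0 q : 0 <= quartic q.
Proof. by rewrite addr_ge0// sqr_ge0. Qed.

Lemma quartic_dilation a q : quartic (dilation a q) = a ^+ 4 * quartic q.
Proof. by rewrite /quartic /dilation /= dotZ; ring. Qed.

Lemma quartic_gt0 (q : spacetime) : q != (0, 0) -> 0 < quartic q.
Proof.
case: q => p t qn0; rewrite lt_neqAle quartic_ge0 andbT eq_sym.
apply: contra qn0; rewrite /quartic /= paddr_eq0 ?sqr_ge0// !sqrf_eq0.
rewrite dotE -!expr2 paddr_eq0 ?sqr_ge0// !sqrf_eq0 => /andP[/andP[/eqP p0 /eqP p1] /eqP t0].
by apply/eqP; congr (_, _) => //; apply: row2P; rewrite mxE.
Qed.

Lemma scale_to_sphere_gt0 q : 0 < quartic q -> 0 < scale_to_sphere q.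
Proof. by move=> q0; rewrite invr_gt0 !sqrtr_gt0. Qed.

Lemma scale_to_sphere4 q : 0 < quartic q -> scale_to_sphere q ^+ 4 * quartic q = 1.
Proof.
move=> q0; rewrite exprVn (_ : _ ^+ 4 = quartic q) ?mulVf ?lt0r_neq0//.
by rewrite (exprM _ 2 2) sqr_sqrtr ?sqrtr_ge0// sqr_sqrtr// ltW.
Qed.

Lemma half_sphereE (z : spacetime) : half_sphere z = (0 <= z.2 /\ quartic z = 1) :> Prop.
Proof. by []. Qed.

Lemma half_sphere_neq0 (z : spacetime) : half_sphere z -> z != (0, 0).
Proof.
move=> [_ h]; apply/eqP => z0; move: h; rewrite z0 /= dotE !mxE.
by rewrite !mul0r addr0 !expr0n addr0 => /esym/eqP; rewrite oner_eq0.
Qed.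

Lemma normalize_half_sphere q : 0 <= q.2 -> 0 < quartic q -> half_sphere (normalize q).
Proof.
move=> q2 q0; rewrite half_sphereE quartic_dilation scale_to_sphere4//; split=> //=.
by rewrite mulr_ge0// sqr_ge0.
Qed.

Lemma half_sphere_dilation_inj (a b : R) (z w : spacetime) : 0 < a -> 0 < b ->
  half_sphere z -> half_sphere w -> dilation a z = dilation b w -> a = b /\ z = w.
Proof.
move=> a0 b0 [_ hz] [_ hw] e.
have ab : a = b.
  have : quartic (dilation a z) = quartic (dilation b w) by rewrite e.
  rewrite !quartic_dilation (hz : quartic z = 1) (hw : quartic w = 1) !mulr1.
  by move/eqP; rewrite eqrXn2 ?ltW// => /eqP.
split => //; rewrite -[z]dilation1 -[w]dilation1 -(mulVf (lt0r_neq0 b0)).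
by rewrite -!dilation_comp -e ab.
Qed.

Lemma normalize_dilation (a : R) (z : spacetime) : 0 < a -> half_sphere z -> normalize (dilation a z) = z.
Proof.
move=> a0 hz; have [z2 qz] := hz.
have q0 : 0 < quartic (dilation a z).
  by rewrite quartic_dilation (qz : quartic z = 1) mulr1 exprn_gt0.
have hn : half_sphere (normalize (dilation a z)).
  by apply: normalize_half_sphere => //=; rewrite mulr_ge0// sqr_ge0.
have := scale_to_sphere_gt0 q0; set b := scale_to_sphere _ => b0.
have e : dilation 1 (normalize (dilation a z)) = dilation (b * a) z.
  by rewrite dilation1 /normalize dilation_comp.
by have [] := half_sphere_dilation_inj ltr01 (mulr_gt0 b0 a0) hn hz e.
Qed.

Lemma quartic_at1_gt0 (p : 'rV[R]_2) : 0 < quartic (p, 1).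
Proof. by rewrite /quartic /= expr1n ltr_wpDl ?sqr_ge0. Qed.

Lemma sigma_half_sphere p : half_sphere (sigma p).
Proof. by apply: normalize_half_sphere; [exact: ler01|exact: quartic_at1_gt0]. Qed.

Lemma sigma2_gt0 p : 0 < (sigma p).2.
Proof.
by rewrite /= mulr1 exprn_gt0// scale_to_sphere_gt0// quartic_at1_gt0.
Qed.

Lemma sigmaK : cancel sigma sigma_inv.
Proof.
move=> p; have m0 := scale_to_sphere_gt0 (quartic_at1_gt0 p).
rewrite /sigma_inv /sigma /normalize /= mulr1 sqrtr_sqr gtr0_norm//.
by rewrite scalerA mulVf ?scale1r// lt0r_neq0.
Qed.

Lemma sigma_invK (z : spacetime) : half_sphere z -> 0 < z.2 -> sigma (sigma_inv z) = z.
Proof.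
move=> hz z2; have r0 : 0 < (Num.sqrt z.2)^-1 by rewrite invr_gt0 sqrtr_gt0.
rewrite /sigma (_ : (_, 1) = dilation (Num.sqrt z.2)^-1 z) ?normalize_dilation//.
rewrite /dilation /sigma_inv; congr (_, _).
by rewrite exprVn sqr_sqrtr ?ltW// mulVf// lt0r_neq0.
Qed.

Lemma quartic_continuous : continuous quartic.
Proof.
move=> q; have h1 : {for q, continuous (fun q : spacetime => dot q.1 q.1)}.
  apply: (@continuous_comp _ _ _ fst (fun v : 'rV[R]_2 => dot v v)).
    exact: cvg_fst.
  exact: dot_continuous.
have h2 : {for q, continuous (fun q : spacetime => q.2)} by exact: cvg_snd.
exact: (continuousD (continuousM h1 h1) (continuousM h2 h2)).
Qed.

Lemma half_sphere_closed : closed (@half_sphere R).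
Proof.
rewrite (_ : @half_sphere R = [set q | 0 <= q.2] `&` quartic @^-1` [set 1]); last first.
  by apply/seteqP; split => z; rewrite half_sphereE.
apply: closedI.
  apply: (@preimage_closed _ _ snd [set x : R | 0 <= x]); last exact: closed_ge.
  by move=> z _; exact: cvg_snd.
apply: preimage_closed; first by move=> z _; exact: quartic_continuous.
exact: closed_eq.
Qed.

Lemma normalize_continuous q : 0 < quartic q -> {for q, continuous normalize}.
Proof.
move=> q0; have hs : {for q, continuous scale_to_sphere}.
  have h : {for q, continuous (fun q => Num.sqrt (Num.sqrt (quartic q)))}.
    apply: (@continuous_comp _ _ _ (fun q => Num.sqrt (quartic q)) Num.sqrt).
      apply: (@continuous_comp _ _ _ quartic Num.sqrt).
        exact: quartic_continuous.
      exact: sqrt_continuous.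
    exact: sqrt_continuous.
  by apply: cvgV => //; rewrite lt0r_neq0// !sqrtr_gt0.
have h2 : {for q, continuous (fun q : spacetime => q.2)} by exact: cvg_snd.
have h1 : {for q, continuous (fun q : spacetime => q.1)} by exact: cvg_fst.
exact: (cvg_pair (cvgZ hs h1) (continuousM (continuousM hs hs) h2)).
Qed.

Lemma sigma_continuous : continuous sigma.
Proof.
move=> p; apply: (@continuous_comp _ _ _ (fun p : 'rV[R]_2 => (p, 1 : R)) normalize).
  exact: (cvg_pair (@cvg_id _ (nbhs p)) (@cst_continuous _ _ (1 : R) p)).
exact/normalize_continuous/quartic_at1_gt0.
Qed.

Lemma sigma_inv_continuous z : 0 < z.2 -> {for z, continuous sigma_inv}.
Proof.
move=> z2; have h1 : {for z, continuous (fun q : spacetime => q.1)} by exact: cvg_fst.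
have h : {for z, continuous (fun q : spacetime => Num.sqrt q.2)}.
  apply: (@continuous_comp _ _ _ snd Num.sqrt); first exact: cvg_snd.
  exact: sqrt_continuous.
apply: cvgZ; last exact: h1.
by apply: cvgV => //; rewrite lt0r_neq0// sqrtr_gt0.
Qed.

(* F is identified with the half-sphere, and [sigma] with the projection of the
   slice t = 1 to F along the orbits of the dilations. *)
Definition sphere_closure (P : set 'rV[R]_2) : set spacetime := closure (sigma @` P).

Lemma sphere_closure_half_sphere P : sphere_closure P `<=` @half_sphere R.
Proof.
rewrite /sphere_closure (closure_id (@half_sphere R)).1; last exact: half_sphere_closed.
by apply: closure_subset => _ [p _ <-]; exact: sigma_half_sphere.
Qed.

(** On the open half-sphere [sigma] has the continuous inverse [sigma_inv], so the closure adds
    points on the boundary circle only. *)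
Lemma sphere_closure_gt0 P z : closed P -> 0 < z.2 ->
  sphere_closure P z <-> (sigma @` P) z.
Proof.
move=> cP z2; split=> [Kz|]; last exact: subset_closure.
have hz := sphere_closure_half_sphere Kz.
exists (sigma_inv z); last exact: sigma_invK.
apply: cP => U nU.
have nz : nbhs z (sigma_inv @^-1` U) by exact: sigma_inv_continuous.
have [_ [[p Pp <-] /=]] := Kz _ nz.
by rewrite sigmaK => Up; exists p.
Qed.

Lemma sphere_closure_compact P : compact P -> sphere_closure P = sigma @` P.
Proof.
move=> cP; rewrite /sphere_closure -(closure_id _).1//.
apply: compact_closed; first exact: norm_hausdorff.
apply: continuous_compact => //.
by apply: continuous_subspaceT; exact: sigma_continuous.
Qed.

End HalfSphere.

Section SmoothVectors.
Context {R : realType}.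

Lemma Ck1_pair (V W : normedModType R) k (dom : set R) (f : R -> V) (g : R -> W) :
  open dom -> Ck1 k dom f -> Ck1 k dom g -> Ck1 k dom (fun x => (f x, g x)).
Proof.
move=> od; elim: k f g => [|k IH] f g.
  by move=> hf hg x dx; exact: (cvg_pair (hf x dx) (hg x dx)).
move=> hf hg; apply: (Ck1_derive (df := fun x => (derive1 f x, derive1 g x))) => //.
  move=> x dx; apply: is_derive_pair; [exact: Ck1_is_derive hf _|exact: Ck1_is_derive hg _].
by apply: IH; [case: hf|case: hg].
Qed.

Lemma Ck1_row2 k (dom : set R) (f g : R -> R) : open dom ->
  Ck1 k dom f -> Ck1 k dom g -> Ck1 k dom (fun x => row2 (f x) (g x)).
Proof.
move=> od; elim: k f g => [|k IH] f g.
  by move=> hf hg x dx; exact: (cvg_row2 _ (hf x dx) (hg x dx)).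
move=> hf hg; apply: (Ck1_derive (df := fun x => row2 (derive1 f x) (derive1 g x))) => //.
  move=> x dx; apply: is_derive_row2; [exact: Ck1_is_derive hf _|exact: Ck1_is_derive hg _].
by apply: IH; [case: hf|case: hg].
Qed.

Lemma Ck1_coord n k (dom : set R) (f : R -> 'rV[R]_n) j : open dom ->
  Ck1 k dom f -> Ck1 k dom (fun x => f x 0 j).
Proof.
move=> od; elim: k f => [|k IH] f.
  move=> hf x dx; apply: (@continuous_comp _ _ _ f (fun v : 'rV[R]_n => v 0 j)).
    exact: hf.
  exact: coord_continuous.
move=> hf; apply: (Ck1_derive (df := fun x => derive1 f x 0 j)) => //.
  by move=> x dx; apply: is_derive_coord; exact: Ck1_is_derive hf _.
by apply: IH; case: hf.
Qed.

Lemma Ck1_inv_sqrt2 k (dom : set R) (f : R -> R) : open dom -> Ck1 k dom f ->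
  (forall x, dom x -> 0 < f x) ->
  Ck1 k dom (fun x => (Num.sqrt (Num.sqrt (f x)))^-1).
Proof.
move=> od hf f0.
apply: (@Ck1_comp _ _ _ [set x : R | 0 < x] (fun x => x^-1)) => //.
- exact: Ck1_inv.
- apply: (@Ck1_comp _ _ _ [set x : R | 0 < x] Num.sqrt) => //; first exact: Ck1_sqrt.
  apply: (@Ck1_comp _ _ _ [set x : R | 0 < x] Num.sqrt) => //; first exact: Ck1_sqrt.
  by move=> x /f0 /=; rewrite sqrtr_gt0.
- by move=> x /f0 /=; rewrite !sqrtr_gt0.
Qed.

End SmoothVectors.

Section SphereChart.
Context {R : realType}.

Lemma sigmaE (p : 'rV[R]_2) : let m := scale_to_sphere (p, 1 : R) in
  sigma p = (row2 (m * p 0 0) (m * p 0 1), m * m).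
Proof.
rewrite /= /sigma /normalize /dilation /=; congr (_, _); last by rewrite mulr1 expr2.
by apply: row2P; rewrite !mxE.
Qed.

Variables (dom : set R) (psi : R -> 'rV[R]_2).
Hypotheses (od : open dom) (sp : smooth1 dom psi).

Let mu s := scale_to_sphere (psi s, 1 : R).

Let Ck1_mu k : Ck1 k dom mu.
Proof.
apply: Ck1_inv_sqrt2 => //; last by move=> x _; exact: quartic_at1_gt0.
have h j : Ck1 k dom (fun s => psi s 0 j) by exact: Ck1_coord.
apply: (@Ck1_ext _ _ _ _ (fun s => (psi s 0 0 * psi s 0 0 + psi s 0 1 * psi s 0 1) *
  (psi s 0 0 * psi s 0 0 + psi s 0 1 * psi s 0 1) + 1)) => //.
  by move=> x _; rewrite /quartic /= dotE expr1n -expr2.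
apply: Ck1D => //; last exact: Ck1_cst.
by apply: Ck1M => //; apply: Ck1D => //; apply: Ck1M.
Qed.

Lemma smooth_sigma : smooth1 dom (sigma \o psi).
Proof.
move=> k; apply: (@Ck1_ext _ _ _ _ (fun s => (row2 (mu s * psi s 0 0) (mu s * psi s 0 1),
  mu s * mu s))) => //; first by move=> s _; rewrite /= sigmaE.
have h j : Ck1 k dom (fun s => psi s 0 j) by exact: Ck1_coord.
have hm := Ck1_mu k.
by apply: Ck1_pair => //; last exact: Ck1M; apply: Ck1_row2 => //; exact: Ck1M.
Qed.

Lemma derive1_sigma_neq0 s : dom s -> derive1 psi s != 0 ->
  derive1 (sigma \o psi) s != 0.
Proof.
move=> ds; apply: contra => /eqP d0.
have m0 : 0 < mu s by exact/scale_to_sphere_gt0/quartic_at1_gt0.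
have dm := Ck1_is_derive (Ck1_mu 1) ds.
have dp := Ck1_is_derive (sp 1%N) ds.
have dj j := @is_derive_coord _ _ _ _ _ _ _ j dp.
have h : is_derive s 1 (sigma \o psi) (row2
    (mu s * (derive1 psi s 0 0) + psi s 0 0 * derive1 mu s)
    (mu s * (derive1 psi s 0 1) + psi s 0 1 * derive1 mu s),
    mu s * derive1 mu s + mu s * derive1 mu s).
  apply: (is_derive_ext od ds (f := fun s => (row2 (mu s * psi s 0 0) (mu s * psi s 0 1),
    mu s * mu s))); first by move=> r _; rewrite /= sigmaE.
  exact: is_derive_pair (is_derive_row2 (is_derive_mul dm (dj 0))
    (is_derive_mul dm (dj 1))) (is_derive_mul dm dm).
move: d0; rewrite (is_derive_derive1 h) => -[e1 e2].
(* The last component of [sigma (psi s)] is mu^2 with mu > 0, so its derivative already forces mu' =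
   0; the first two then give mu psi' = 0. *)
have dm0 : derive1 mu s = 0.
  move/eqP: e2; rewrite -mulr2n mulrn_eq0 /= mulf_eq0 (negbTE (lt0r_neq0 m0)).
  by move/eqP.
have e3 j : mu s * derive1 psi s 0 j = 0 -> derive1 psi s 0 j = 0.
  by move/eqP; rewrite mulf_eq0 (negbTE (lt0r_neq0 m0)) => /eqP.
apply/eqP/row2P; rewrite mxE; apply: e3.
  by have := congr1 (fun v : 'rV[R]_2 => v 0 0) e1; rewrite row2_0 dm0 mulr0 addr0 mxE.
by have := congr1 (fun v : 'rV[R]_2 => v 0 1) e1; rewrite row2_1 dm0 mulr0 addr0 mxE.
Qed.

End SphereChart.

Section LiftChart.
Context {R : realType}.

Lemma curve_chart_sphere_closure (P : set 'rV[R]_2) p : closed P ->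
  curve_chart P p -> curve_chart (sphere_closure P) (sigma p).
Proof.
move=> cP [dom [psi [[od sp] [s ds ps] inj reg opn]]].
exists dom, (sigma \o psi); split.
- by split => //; exact: smooth_sigma.
- by exists s => //=; rewrite ps.
- by move=> x y dx x0 dy y0 /(can_inj sigmaK); exact: inj.
- by move=> x dx x0; apply: (derive1_sigma_neq0 od) => //; exact: reg.
move=> A oA Ad; have [V oV hV] := opn A oA Ad.
exists [set z | 0 < z.2 /\ V (sigma_inv z)].
  rewrite openE => z [z2 Vz].
  have n1 : nbhs z (snd @^-1` [set x : R | 0 < x]).
    by apply: cvg_snd; apply: open_nbhs_nbhs; split => //; exact: open_gt.
  have n2 : nbhs z (sigma_inv @^-1` V).
    by apply: sigma_inv_continuous => //; exact: open_nbhs_nbhs.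
  exact: filterI n1 n2.
apply/seteqP; split => [_ [x Ax <-]|z [Kz [z2 Vz]]].
  have [Px Vx] : (P `&` V) (psi x) by rewrite -hV; exists x.
  split; last by split; [exact: sigma2_gt0|rewrite /= sigmaK].
  by apply: subset_closure; exists (psi x).
have [q Pq qz] := (sphere_closure_gt0 cP z2).1 Kz.
have : (P `&` V) q by split => //; move: Vz; rewrite -qz sigmaK.
by rewrite -hV => -[x Ax xq]; exists x => //=; rewrite xq.
Qed.

End LiftChart.

Section EndChart.
Context {R : realType}.

(** For |x|^-2 = t the point [sigma x] has height t / sqrt (1 + t^2) and horizontal part (1 +
    t^2)^{-1/4} x / |x|. The scalar factors are smooth across t = 0, and the height alone recovers t
    through [end_time]. *)
Definition end_radius (t : R) : R := Num.sqrt (1 + t ^+ 2).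
Definition end_height (t : R) : R := t / end_radius t.
Definition end_time (y : R) : R := y / Num.sqrt (1 - y ^+ 2).

Lemma end_radius_gt0 (t : R) : 0 < end_radius t.
Proof. by rewrite sqrtr_gt0 ltr_wpDr ?sqr_ge0. Qed.

Lemma end_radius_sqr (t : R) : end_radius t ^+ 2 = 1 + t ^+ 2.
Proof. by rewrite sqr_sqrtr// addr_ge0 ?sqr_ge0. Qed.

Lemma end_height_sqr (t : R) : 1 - end_height t ^+ 2 = (end_radius t)^-1 ^+ 2.
Proof.
have r0 := lt0r_neq0 (end_radius_gt0 t).
have -> : 1 - end_height t ^+ 2 = (end_radius t ^+ 2 - t ^+ 2) / end_radius t ^+ 2.
  by rewrite /end_height; field.
by rewrite end_radius_sqr addrK mul1r exprVn -end_radius_sqr.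
Qed.

Lemma end_heightK : cancel end_height end_time.
Proof.
move=> t; have r0 := end_radius_gt0 t.
rewrite /end_time end_height_sqr sqrtr_sqr gtr0_norm ?invr_gt0// invrK.
by rewrite /end_height divfK// lt0r_neq0.
Qed.

Lemma end_height_lt1 (t : R) : -1 < end_height t < 1.
Proof.
rewrite -ltr_norml -(@ltr_pXn2r _ 2)// ?nnegrE// real_normK ?num_real// expr1n.
by rewrite -subr_gt0 end_height_sqr exprn_gt0// invr_gt0 end_radius_gt0.
Qed.

Lemma end_time_continuous (y : R) : -1 < y < 1 -> {for y, continuous end_time}.
Proof.
move=> /andP[y1 y2]; have hy : {for y, continuous (fun y : R => y)} by exact: cvg_id.
have h1 : {for y, continuous (fun y : R => 1 - y ^+ 2)}.
  exact: (continuousB (@cst_continuous _ _ (1 : R) y) (continuousM hy hy)).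
have h2 : {for y, continuous (fun y : R => Num.sqrt (1 - y ^+ 2))}.
  exact: (continuous_comp h1 (@sqrt_continuous R _)).
apply: (continuousM hy); apply: cvgV => //.
by rewrite lt0r_neq0// sqrtr_gt0; nra.
Qed.

Lemma Ck1_end_radius k (dom : set R) : open dom -> Ck1 k dom end_radius.
Proof.
move=> od; apply: (@Ck1_comp _ _ _ [set x : R | 0 < x] Num.sqrt) => //.
- exact: Ck1_sqrt.
- apply: Ck1D => //; first exact: Ck1_cst.
  by apply: (@Ck1M _ _ _ (fun x => x) (fun x => x)) => //; exact: Ck1_id.
- by move=> x _ /=; rewrite ltr_wpDr ?sqr_ge0.
Qed.

Lemma Ck1_end_height k (dom : set R) : open dom -> Ck1 k dom end_height.
Proof.
move=> od; apply: Ck1M => //; first exact: Ck1_id.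
apply: (@Ck1_comp _ _ _ [set x : R | 0 < x] (fun x => x^-1)) => //.
- exact: Ck1_inv.
- exact: Ck1_end_radius.
- by move=> x _; exact: end_radius_gt0.
Qed.

Lemma is_derive_end_height (t : R) : is_derive t 1 end_height ((end_radius t) ^- 3).
Proof.
have r0 := lt0r_neq0 (end_radius_gt0 t).
have p0 : 0 < 1 + t ^+ 2 by rewrite ltr_wpDr ?sqr_ge0.
have di := is_derive_ident t.
have dr : is_derive t 1 end_radius (t / end_radius t).
  have h := is_derive_add (is_derive_const 1 t) (is_derive_mul di di).
  have := @is_derive_compose _ Num.sqrt (fun t => 1 + t * t) t _ _ (is_derive1_sqrt p0) h.
  by move/is_derive_eq; apply; rewrite -/(end_radius t); field.
have := is_derive_mul di (is_derive_inv r0 dr).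
move/is_derive_eq; apply.
have -> : t * (- (t / end_radius t) / end_radius t ^+ 2) + (end_radius t)^-1 * 1 =
  (end_radius t ^+ 2 - t ^+ 2) / end_radius t ^+ 3 by field.
by rewrite end_radius_sqr addrK mul1r.
Qed.

Lemma sigma2_height (p : 'rV[R]_2) : let q := dot p p in 0 < q ->
  (sigma p).2 = end_height q^-1.
Proof.
move=> q q0; rewrite sigmaE /= -invfM -expr2 sqr_sqrtr ?sqrtr_ge0//.
rewrite /quartic /= expr1n -/q /end_height /end_radius.
have -> : 1 + q^-1 ^+ 2 = (q ^+ 2 + 1) * (q^-1) ^+ 2 by field; exact: lt0r_neq0.
rewrite sqrtrM ?addr_ge0 ?sqr_ge0// sqrtr_sqr gtr0_norm ?invr_gt0//.
by field; rewrite !lt0r_neq0// sqrtr_gt0 ltr_wpDl ?sqr_ge0.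
Qed.

Variables (P : set 'rV[R]_2) (e : R) (E1 E2 : R -> R).
Hypotheses (cP : closed P) (e0 : 0 < e).
Hypotheses (smE1 : smooth1 [set t : R | - e < t < e] E1)
  (smE2 : smooth1 [set t : R | - e < t < e] E2).
Hypothesis P_end : forall p, P p -> 1 < e * dot p p ->
  p = Num.sqrt (dot p p) *: row2 (E1 (dot p p)^-1) (E2 (dot p p)^-1).
Hypothesis P_onto : forall t : R, 0 < t < e -> exists2 p, P p & dot p p = t^-1.

Let dom := [set t : R | - e < t < e].
Let g (t : R) : R := (Num.sqrt (end_radius t))^-1.
Let psi (t : R) : 'rV[R]_2 * R := (row2 (g t * E1 t) (g t * E2 t), end_height t).

Definition end_point : 'rV[R]_2 * R := (row2 (E1 0) (E2 0), 0).

Let open_dom : open dom.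
Proof.
rewrite (_ : dom = [set t : R | - e < t] `&` [set t : R | t < e]).
  by apply: openI; [exact: open_gt|exact: open_lt].
by apply/seteqP; split => u; [move=> /andP[]|move=> [h1 h2]; apply/andP].
Qed.

Let dom0 : dom 0. Proof. by rewrite /dom /= oppr_lt0 e0. Qed.

Let psi0 : psi 0 = end_point.
Proof.
have r0 : end_radius 0 = 1 by rewrite /end_radius expr0n addr0 sqrtr1.
by rewrite /psi /g /end_height r0 sqrtr1 invr1 !mul1r mul0r.
Qed.

Let Ck1_direction k : Ck1 k dom (fun t => row2 (g t * E1 t) (g t * E2 t)).
Proof.
have sg : Ck1 k dom g.
  apply: Ck1_inv_sqrt2 => //.
    apply: Ck1D => //; first exact: Ck1_cst.
    by apply: (@Ck1M _ _ _ (fun x => x) (fun x => x)) => //; exact: Ck1_id.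
  by move=> x _ /=; rewrite ltr_wpDr ?sqr_ge0.
by apply: Ck1_row2 => //; apply: Ck1M.
Qed.

Let Ck1_psi : smooth1 dom psi.
Proof. by move=> k; apply: Ck1_pair => //; exact: Ck1_end_height. Qed.

Let psi_sigma p : P p -> 1 < e * dot p p -> psi (dot p p)^-1 = sigma p.
Proof.
move=> Pp hp; have q0 : 0 < dot p p.
  by rewrite lt_neqAle dot_ge0 andbT eq_sym; apply: contraTneq hp => ->;
    rewrite mulr0 -leNgt ler01.
rewrite /psi -(sigma2_height q0) sigmaE.
have gE : g (dot p p)^-1 = scale_to_sphere (p, 1 : R) * Num.sqrt (dot p p).
  rewrite /g /scale_to_sphere -[X in _ * X]invrK -invfM; congr (_^-1).
  have -> : end_radius (dot p p)^-1 = Num.sqrt (quartic (p, 1)) / dot p p.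
    rewrite /quartic /= expr1n /end_radius.
    have -> : 1 + (dot p p)^-1 ^+ 2 = (dot p p ^+ 2 + 1) * ((dot p p)^-1) ^+ 2.
      by field; exact: lt0r_neq0.
    by rewrite sqrtrM ?addr_ge0 ?sqr_ge0// sqrtr_sqr gtr0_norm ?invr_gt0.
  by rewrite sqrtrM ?sqrtr_ge0// sqrtrV ?ltW.
have pE := P_end Pp hp.
by congr (row2 _ _, _); rewrite gE -mulrA; congr (_ * _); rewrite [in RHS]pE mxE
  ?row2_0 ?row2_1.
Qed.

Let K := sphere_closure P.

(** By [P_onto] there are points of P with arbitrarily small positive tau, and psi is continuous at
    0. *)
Lemma end_point_mem : K end_point.
Proof.
move=> U nU; have hc : {for 0, continuous psi} by exact: (Ck1_psi 0%N _ dom0).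
rewrite -psi0 in nU.
have /nbhs_ballP[r /= r0 hr] : nbhs (0 : R) (psi @^-1` U) by exact: hc.
pose t := Num.min (r / 2) (e / 2).
have [t1 t2] : t <= r / 2 /\ t <= e / 2 by rewrite /t !ge_min !lexx orbT.
have t0 : 0 < t by rewrite lt_min !divr_gt0.
have te : 0 < t < e by rewrite t0 /=; lra.
have [p Pp pt] := P_onto te.
have hp : 1 < e * dot p p by rewrite pt ltr_pdivlMr// mul1r; lra.
exists (sigma p); split; first by exists p.
rewrite -psi_sigma// pt invrK; apply: hr.
by rewrite /ball/= sub0r normrN gtr0_norm//; lra.
Qed.

Let near_end w : (sigma @` P) w -> w.2 < 1 -> end_time w.2 < e ->
  0 <= end_time w.2 /\ w = psi (end_time w.2).
Proof.
move=> [p Pp <-] w1 we.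
have q0 : 0 < dot p p.
  (* p = 0 is sent to the pole (0, 1), which the bound on the height excludes. *)
  rewrite lt_neqAle dot_ge0 andbT eq_sym; apply: contraTneq w1 => q0.
  rewrite -leNgt sigmaE /= /scale_to_sphere /quartic /= q0 expr0n expr1n add0r.
  by rewrite !sqrtr1 invr1 mulr1.
have ht : end_time (sigma p).2 = (dot p p)^-1.
  by rewrite (sigma2_height q0) end_heightK.
rewrite ht in we *; split; first by rewrite invr_ge0 ltW.
rewrite psi_sigma//.
by rewrite -[ltLHS](mulVf (lt0r_neq0 q0)) ltr_pM2r.
Qed.

Let good_nbhs z (A : set R) : -1 < z.2 < 1 -> open A -> A (end_time z.2) ->
  nbhs (z : 'rV[R]_2 * R) [set w | -1 < w.2 < 1 /\ A (end_time w.2)].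
Proof.
move=> /andP[z1 z2] oA Az.
have n1 : nbhs z (snd @^-1` [set y : R | -1 < y]).
  by apply: cvg_snd; apply: open_nbhs_nbhs; split => //; exact: open_gt.
have n2 : nbhs z (snd @^-1` [set y : R | y < 1]).
  by apply: cvg_snd; apply: open_nbhs_nbhs; split => //; exact: open_lt.
have n3 : nbhs z ((end_time \o snd) @^-1` A).
  apply: (@continuous_comp _ _ _ snd end_time); first exact: cvg_snd.
    by apply: end_time_continuous; rewrite z1.
  exact: open_nbhs_nbhs.
by apply: filterS3 n1 n2 n3 => w /= -> ->.
Qed.

(** Points of sigma(P) near z have small height, hence are psi of their own [end_time]; as they tend
    to z, continuity gives z = psi 0. *)
Lemma end_point_unique z : K z -> z.2 = 0 -> z = end_point.
Proof.
move=> Kz z2; have t0 : end_time z.2 = 0 by rewrite z2 /end_time mul0r.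
have z1 : -1 < z.2 < 1 by rewrite z2 ltrN10 ltr01.
have hc : {for z, continuous (fun w : 'rV[R]_2 * R => psi (end_time w.2))}.
  have h : {for z, continuous (end_time \o snd)}.
    apply: continuous_comp; first exact: cvg_snd.
    exact: end_time_continuous.
  apply: (@continuous_comp _ _ _ (end_time \o snd) psi _ h).
  by rewrite /= t0; exact: (Ck1_psi 0%N _ dom0).
apply/eqP; apply: contraT => zne.
pose d := `|z - end_point|; have d0 : 0 < d by rewrite normr_gt0 subr_eq0.
have d3 : 0 < d / 3 by rewrite divr_gt0.
have n1 : nbhs z [set w | `|z - w| < d / 3].
  by apply/nbhs_ballP; exists (d / 3) => //= w; rewrite -ball_normE.
have n2 : nbhs z [set w : 'rV[R]_2 * R | `|end_point - psi (end_time w.2)| < d / 3].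
  have : nbhs (psi (end_time z.2)) [set q | `|end_point - q| < d / 3].
    rewrite t0 psi0; apply/nbhs_ballP; exists (d / 3) => //= w.
    by rewrite -ball_normE.
  exact: hc.
have n3 := @good_nbhs z dom z1 open_dom.
rewrite t0 in n3; have := n3 dom0 => {}n3.
have [w [Pw [[/= w1 w2] [w3 w4]]]] := Kz _ (filterI (filterI n1 n2) n3).
have [_ wE] : 0 <= end_time w.2 /\ w = psi (end_time w.2).
  by apply: near_end => //; [case/andP: w3|case/andP: w4].
move: w2; rewrite -wE => w2.
have : d <= `|z - w| + `|end_point - w|.
  rewrite [`|end_point - w|]distrC /d.
  have -> : z - end_point = (z - w) + (w - end_point) by rewrite addrA subrK.
  exact: ler_normD.
move=> h; have : `|z - w| + `|end_point - w| < d / 3 + d / 3 by exact: ltrD.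
by lra.
Qed.

Lemma end_chart : curve_chart K end_point.
Proof.
exists dom, psi; split.
- by [].
- by exists 0.
(* The height component alone gives injectivity here and a nonzero derivative below, whatever E1 and
   E2 are. *)
- by move=> s t _ _ _ _ [_ st]; rewrite -[s]end_heightK st end_heightK.
- move=> s ds _.
  have h := is_derive_pair (Ck1_is_derive (Ck1_direction 1) ds) (is_derive_end_height s).
  rewrite (is_derive_derive1 h); apply/eqP => -[_ /eqP].
  by rewrite invr_eq0 expf_eq0 /= (negbTE (lt0r_neq0 (end_radius_gt0 s))).
move=> A oA Ad.
exists [set w | -1 < w.2 < 1 /\ A (end_time w.2)].
  by rewrite openE => z [z1 Az]; exact: good_nbhs.
apply/seteqP; split => [_ [s [As /= s0] <-]|z [Kz [/= z1 Az]]].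
  split; last by rewrite /= end_heightK end_height_lt1.
  have /andP[_ se] := Ad _ As.
  move: s0; rewrite le_eqVlt => /predU1P[<-|s0]; first by rewrite psi0; exact: end_point_mem.
  have se' : 0 < s < e by rewrite s0.
  have [p Pp ps] := P_onto se'.
  have hp : 1 < e * dot p p by rewrite ps ltr_pdivlMr// mul1r.
  by apply: subset_closure; exists p => //; rewrite -psi_sigma// ps invrK.
have [z20|z20] := leP z.2 0.
  have [z2 _] := sphere_closure_half_sphere Kz.
  have z2E : z.2 = 0 by apply/eqP; rewrite eq_le z20.
  have zE := end_point_unique Kz z2E.
  exists 0; last by rewrite psi0.
  by split=> //=; move: Az; rewrite z2E /end_time mul0r.
have Pz := (sphere_closure_gt0 cP z20).1 Kz.
have [t0 zE] : 0 <= end_time z.2 /\ z = psi (end_time z.2).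
  by apply: near_end => //; [case/andP: z1|case/andP: (Ad _ Az)].
by exists (end_time z.2).
Qed.

End EndChart.

(** * Pieces of the network *)

Section Pieces.
Context {R : realType}.

(** v is the limit of the piece on the boundary circle of the half-sphere. An arc is compact and has
    no such limit: its last clause is vacuous and v arbitrary. *)
Definition is_piece (P : set 'rV[R]_2) (v : 'rV[R]_2 * R) : Prop :=
  [/\ closed P, P !=set0, connected P, (forall p, P p -> curve_chart P p) &
      forall z, sphere_closure P z -> z.2 = 0 ->
        z = v /\ curve_chart (sphere_closure P) z].

Lemma piece_charts P v z : is_piece P v -> sphere_closure P z ->
  curve_chart (sphere_closure P) z.
Proof.
move=> [cP _ _ ch endP] Kz; have [z2 _] := sphere_closure_half_sphere Kz.
move: z2; rewrite le_eqVlt => /predU1P[z2|z2].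
  by have [] := endP z Kz (esym z2).
have [p Pp <-] := (sphere_closure_gt0 cP z2).1 Kz.
exact/curve_chart_sphere_closure/ch.
Qed.

Lemma piece_connected P v : is_piece P v -> connected (sphere_closure P).
Proof.
move=> [_ _ conP _ _]; apply/connected_closure/connected_continuous_connected => //.
by apply: continuous_subspaceT; exact: sigma_continuous.
Qed.

Lemma embedded_connected (D : set R) (c : R -> 'rV[R]_2) :
  is_interval D -> (forall s, D s -> {for s, continuous c}) -> connected (c @` D).
Proof.
move=> iD cc; apply: connected_continuous_connected; first exact/connected_intervalP.
by apply: continuous_in_subspaceT => s; rewrite inE; exact: cc.
Qed.

Lemma arc_piece (c : R -> 'rV[R]_2) v : embedded `[0, 1]%classic c ->
  (forall p, (c @` `[0, 1]%classic) p -> curve_chart (c @` `[0, 1]%classic) p) ->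
  is_piece (c @` `[0, 1]%classic) v.
Proof.
move=> emb ch; split => //.
- exact: embedded_closed_trace.
- by exists (c 0), 0 => //=; rewrite in_itv/= lexx ler01.
- by apply: embedded_connected; [exact: interval_is_interval|exact: (emb_cont emb)].
- move=> z Kz z2; have : (sigma @` (c @` `[0, 1]%classic)) z.
    rewrite -sphere_closure_compact//; apply: continuous_compact; last exact: segment_compact.
    apply: continuous_in_subspaceT => s; rewrite inE; exact: (emb_cont emb).
  by move=> [p _ pz]; have := sigma2_gt0 p; rewrite pz z2 ltxx.
Qed.

Lemma dot_enorm (p : 'rV[R]_2) B : dot p p <= B -> enorm p <= Num.sqrt B.
Proof. by move=> h; rewrite /enorm ler_wsqrtr. Qed.

(** The expander equation is required for s > 0, since c 0 may be a vertex. It serves the chart at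
    the boundary circle; charts at finite points are a separate hypothesis. *)
Lemma ray_piece (c v w : R -> 'rV[R]_2) : embedded `[0, +oo[%classic c ->
  (forall p, (c @` `[0, +oo[%classic) p -> curve_chart (c @` `[0, +oo[%classic) p) ->
  (forall s : R, 0 < s -> is_derive s 1 c (v s)) ->
  (forall s : R, 0 < s -> is_derive s 1 v (w s)) ->
  (forall s : R, 0 < s -> v s != 0) ->
  (forall s : R, 0 < s -> v s 0 0 * w s 0 1 - v s 0 1 * w s 0 0 =
    (v s 0 0 ^+ 2 + v s 0 1 ^+ 2) * (c s 0 1 * v s 0 0 - c s 0 0 * v s 0 1) / 2) ->
  exists z, is_piece (c @` `[0, +oo[%classic) z.
Proof.
move=> emb ch dc dv v0 eqn.
pose x (s : R) := c s 0 0; pose y (s : R) := c s 0 1.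
have cj j : {within `[0, +oo[%classic, continuous (fun s => c s 0 j)}.
  apply: continuous_in_subspaceT => s; rewrite inE => Ds.
  apply: (@continuous_comp _ _ _ c (fun q : 'rV[R]_2 => q 0 j)).
    exact: (emb_cont emb).
  exact: coord_continuous.
have ray : expander_ray x y (fun s => v s 0 0) (fun s => v s 0 1)
    (fun s => w s 0 0) (fun s => w s 0 1).
  split => //.
  - by move=> s s0; apply: is_derive_coord; exact: dc.
  - by move=> s s0; apply: is_derive_coord; exact: dc.
  - by move=> s s0; apply: is_derive_coord; exact: dv.
  - by move=> s s0; apply: is_derive_coord; exact: dv.
  - move=> s s0; rewrite lt_neqAle addr_ge0 ?sqr_ge0// andbT eq_sym.
    apply: contra (v0 s s0).
    rewrite paddr_eq0 ?sqr_ge0// !sqrf_eq0 => /andP[/eqP z1 /eqP z2].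
    by apply/eqP/row2P; rewrite ?z1 ?z2 mxE.
  - exact: (cj 0).
  - exact: (cj 1).
  - move=> B; have [B' hB'] := emb_proper emb (Num.sqrt B).
    exists B' => s s0 hs; apply: le_trans (ler_norm s) _; apply: hB'.
      by rewrite /= in_itv/= s0.
    by apply: dot_enorm; rewrite dotE -!expr2.
have [e [E1 [E2 [e0 [sm1 sm2] hend honto]]]] := expander_end ray.
pose P := c @` `[0, +oo[%classic.
have cP : closed P by exact: embedded_closed_trace.
have P_end p : P p -> 1 < e * dot p p ->
    p = Num.sqrt (dot p p) *: row2 (E1 (dot p p)^-1) (E2 (dot p p)^-1).
  move=> [s /=]; rewrite in_itv/= andbT => s0 <-.
  have -> : dot (c s) (c s) = x s ^+ 2 + y s ^+ 2 by rewrite dotE -!expr2.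
  move=> /(hend s s0)[h1 h2]; apply: row2P; rewrite mxE ?row2_0 ?row2_1.
    exact: h1.
  exact: h2.
have P_onto (t : R) : 0 < t < e -> exists2 p, P p & dot p p = t^-1.
  move=> /honto[s s0 hs]; exists (c s); first by exists s => //=; rewrite in_itv/= s0.
  by rewrite dotE -!expr2.
exists (end_point E1 E2); split => //.
- by exists (c 0), 0 => //=; rewrite in_itv/= lexx.
- by apply: embedded_connected; [exact: interval_is_interval|exact: (emb_cont emb)].
- move=> z Kz z2; have zE := end_point_unique e0 sm1 sm2 P_end Kz z2.
  by split => //; rewrite zE; exact: (end_chart cP e0 sm1 sm2 P_end P_onto).
Qed.

End Pieces.

Section KindPieces.
Context {R : realType}.

Definition is_line (k : curve_kind) : bool := if k is Line then true else false.

Definition piece_dom (k : curve_kind) : set R :=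
  if k is Arc then `[0, 1]%classic else `[0, +oo[%classic.

Lemma signP (b : bool) : (-1) ^+ b = 1 :> R \/ (-1) ^+ b = -1 :> R.
Proof. by case: b; rewrite ?expr1 ?expr0; [right|left]. Qed.

Lemma is_derive_scale (V : normedModType R) (F : R -> V) (m x : R) dF :
  is_derive (m * x) 1 F dF -> is_derive x 1 (fun y => F (m * y)) (m *: dF).
Proof.
move=> h; have := @is_derive_affine _ _ F m 0 x dF; rewrite addr0 => /(_ h).
by under eq_fun do rewrite addr0.
Qed.

Lemma embedded_reflect (D D' : set R) (c : R -> 'rV[R]_2) (b : bool) :
  embedded D c -> closed D' -> (forall s, D' s -> D ((-1) ^+ b * s)) ->
  embedded D' (fun s => c ((-1) ^+ b * s)).
Proof.
move=> emb cD' DD; split => //.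
- move=> s /DD Ds; apply: (@continuous_comp _ _ _ (fun s : R => (-1) ^+ b * s) c).
    exact: (continuousM (@cst_continuous _ _ ((-1) ^+ b : R) s) (@cvg_id _ (nbhs s))).
  exact: (emb_cont emb).
- move=> s t /DD Ds /DD Dt /(emb_inj emb Ds Dt); apply: mulfI.
  by rewrite signr_eq0.
- move=> B; have [B' hB'] := emb_proper emb B; exists B' => s Ds hs.
  have := hB' _ (DD s Ds) hs.
  by rewrite normrM normrX normrN1 expr1n mul1r.
Qed.

Lemma param_near_reflect (c : R -> 'rV[R]_2) (b : bool) p d J dom F W :
  param_near setT c p d J dom F W ->
  param_near setT (fun s => c ((-1) ^+ b * s)) p d J dom F W.
Proof.
case=> h1 h2 h3 h4 h5 h6 h7 h8 h9 h10; split => //; rewrite h10.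
congr (_ `&` _); apply/seteqP; split => q [s _ <-].
  by exists ((-1) ^+ b * s) => //; rewrite mulrA -expr2 sqrr_sign mul1r.
by exists ((-1) ^+ b * s).
Qed.

Lemma dom_reflect (k : curve_kind) (b : bool) (s : R) : k <> Arc -> b ==> is_line k ->
  0 <= s -> curve_dom k ((-1) ^+ b * s).
Proof. by case: k => //= _; case: b => //= _; rewrite in_itv/= mul1r => ->. Qed.

Lemma dom_reflect_interior (k : curve_kind) (b : bool) (s t : R) : k <> Arc ->
  b ==> is_line k -> 0 < s -> `|t - (-1) ^+ b * s| < s -> curve_dom k t.
Proof.
case: k => //= _; case: b => //= _.
by rewrite mul1r ltr_norml in_itv/= => _ /andP[h _]; rewrite andbT; lra.
Qed.

Variables (k : curve_kind) (c : R -> 'rV[R]_2).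
Hypothesis pe : proper_embedding k c.
Hypothesis params : forall p, (c @` curve_dom k) p ->
  exists d J dom F W, param_near (curve_dom k) c p d J dom F W.
Hypothesis eqn : forall s e : R, 0 < e ->
  (forall t, `|t - s| < e -> curve_dom k t) ->
  let v := derive1 c s in let w := derive1 (derive1 c) s in
  v 0 0 * w 0 1 - v 0 1 * w 0 0 =
  (v 0 0 ^+ 2 + v 0 1 ^+ 2) * (c s 0 1 * v 0 0 - c s 0 0 * v 0 1) / 2.

Let emb := proper_embedding_embedded pe.

Let ray_is_piece (b : bool) : k <> Arc -> b ==> is_line k ->
  (forall p, ((fun s => c ((-1) ^+ b * s)) @` `[0, +oo[%classic) p ->
    curve_chart ((fun s => c ((-1) ^+ b * s)) @` `[0, +oo[%classic) p) ->
  exists z, is_piece ((fun s => c ((-1) ^+ b * s)) @` `[0, +oo[%classic) z.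
Proof.
move=> kA bl charts.
have dom_m := dom_reflect kA bl; have dom_e := dom_reflect_interior kA bl.
have [U [oU DU dc ddc]] := proper_embedding_C2 pe.
set m : R := (-1) ^+ b.
have mm : m * m = 1 by rewrite -expr2 sqrr_sign.
apply: (@ray_piece _ _ (fun s => m *: derive1 c (m * s))
    (fun s => derive1 (derive1 c) (m * s))) => //.
- apply: (embedded_reflect emb); first exact: interval_closed.
  by move=> s /=; rewrite in_itv/= andbT; exact: dom_m.
- move=> s s0; apply: is_derive_scale; apply: derivable_is_derive.
  exact/dc/DU/dom_m/ltW.
- move=> s s0; have Us : U (m * s) by exact/DU/dom_m/ltW.
  have := is_deriveZ m (is_derive_scale (derivable_is_derive (ddc _ Us))).
  by move/is_derive_eq; apply; rewrite scalerA mm scale1r.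
- move=> s s0; rewrite scaler_eq0 negb_or signr_eq0 /=.
  by have [_ _ h _] := pe; apply: h; exact/dom_m/ltW.
- move=> s s0; have := eqn s0 (fun t => dom_e s t s0); rewrite -/m /= => e.
  (* With v = m c' and w = c'', both sides of the equation acquire one factor m because m^2 = 1. *)
  rewrite !mxE -!mulrA -mulrBr e.
  have : m = 1 \/ m = -1 by exact: signP.
  by case=> ->; ring.
Qed.

Lemma kind_is_piece (b : bool) : b ==> is_line k ->
  exists z, is_piece ((fun s => c ((-1) ^+ b * s)) @` piece_dom k) z.
Proof.
move=> bl.
have full : k <> Line -> forall p, (c @` curve_dom k) p -> curve_chart (c @` curve_dom k) p.
  by move=> _ p /params[d [J [dom [F [W pn]]]]]; exact: full_chart emb pn.
have id_c : (fun s => c ((-1) ^+ false * s)) = c.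
  by apply/funext => s; rewrite expr0 mul1r.
case E : k => [||] /=.
- have bF : b = false by move: bl; rewrite E; case: b.
  rewrite bF id_c; exists (0, 0).
  by move: emb full; rewrite E => emb' full'; apply: arc_piece => //; exact: full'.
- have bF : b = false by move: bl; rewrite E; case: b.
  apply: ray_is_piece; rewrite ?E ?bF//.
  by rewrite id_c; move: full; rewrite E; exact.
- apply: ray_is_piece; rewrite ?E ?implybT// => p [s /=]; rewrite in_itv/= andbT => s0 sp.
  have Dp : (c @` curve_dom k) p by exists ((-1) ^+ b * s) => //; rewrite E.
  have [d [J [dom [F [W]]]]] := params Dp; rewrite E /= => pn.
  apply: (half_line_chart _ (param_near_reflect b pn)) sp => //.
  by apply: (@embedded_reflect setT) => //; move: emb; rewrite E.
Qed.

End KindPieces.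

Section NetworkPieces.
Context {R : realType}.

(* Lines are cut at parameter 0: their two ends may be asymptotic to the same
   ray, and an uncut line would then not close up to an embedded curve. *)
Definition net_piece (N : network R) (x : 'I_(net_size N) * bool) : set 'rV[R]_2 :=
  (fun s => net_curve x.1 ((-1) ^+ x.2 * s)) @` piece_dom (net_kind x.1).

(** The sign given by [true] runs through the negative half of a line; arcs and half-lines
    contribute a single piece, with [false]. *)
Definition valid_piece (N : network R) (x : 'I_(net_size N) * bool) : bool :=
  x.2 ==> is_line (net_kind x.1).

Lemma net_support_pieces (N : network R) p :
  net_support N p <-> exists2 x, valid_piece x & @net_piece N x p.
Proof.
split=> [[i _ [s Ds <-]]|[[i b] ok [s Ds <-]]].
  case E : (net_kind i) Ds => /= Ds.
  - exists (i, false) => //; exists s; rewrite /= ?E//.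
    by rewrite expr0 mul1r.
  - exists (i, false) => //; exists s; rewrite /= ?E//.
    by rewrite expr0 mul1r.
  - exists (i, s < 0); first by rewrite /valid_piece /= E implybT.
    exists `|s|; first by rewrite /= E /= in_itv/= normr_ge0.
    by rewrite /= -realEsign ?num_real.
exists i => //; exists ((-1) ^+ b * s) => //.
move: ok Ds; rewrite /valid_piece /=; case: (net_kind i) => //=.
- by rewrite implybF => /negbTE ->; rewrite expr0 mul1r.
- by rewrite implybF => /negbTE ->; rewrite expr0 mul1r.
Qed.

(** Ends have parameter 0 or 1, and the two halves of one line share only the cut at parameter 0.
    This finite list of candidates is what makes the number of intersection curves finite. *)
Lemma net_pieces_meet (N : network R) x y p : is_network N ->
  valid_piece x -> valid_piece y -> x != y ->
  net_piece x p -> @net_piece N y p ->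
  p = net_curve x.1 0 \/ p = net_curve x.1 1.
Proof.
move=> [pe inter]; case: x y => [i b] [j b'] okx oky xy px py.
have tr x : valid_piece x -> @net_piece N x p -> curve_trace x.1 p.
  move=> okx' [s Ds <-]; exists ((-1) ^+ x.2 * s) => //.
  move: okx' Ds; rewrite /valid_piece; case: (net_kind x.1) => //=.
    by rewrite implybF => /negbTE ->; rewrite expr0 mul1r.
  by rewrite implybF => /negbTE ->; rewrite expr0 mul1r.
have [ij|ij] := eqVneq i j; last first.
  have [[s es <-] _] := inter i j p ij (tr _ okx px) (tr _ oky py).
  by move: es; case: (net_kind i) => //= [[]|] ->; [left|right|left].
move: xy oky py; rewrite -ij => bb oky py; move: okx oky px py.
have {}bb : b != b' by apply: contra bb => /eqP ->.
have emb := proper_embedding_embedded (pe i).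
rewrite /valid_piece /net_piece /=.
have line : net_kind i = Line -> ((fun s => net_curve i ((-1) ^+ b * s)) @` `[0, +oo[%classic) p ->
    ((fun s => net_curve i ((-1) ^+ b' * s)) @` `[0, +oo[%classic) p -> p = net_curve i 0.
  move=> E [s /=]; rewrite in_itv/= andbT => s0 <- [t /=]; rewrite in_itv/= andbT => t0.
  move=> /(emb_inj emb); rewrite E /= => /(_ I I) e.
  have -> : s = 0; last by rewrite mulr0.
  by move: bb e; case: b; case: b' => //= _; rewrite ?expr1 ?expr0 ?mulN1r ?mul1r; lra.
case E : (net_kind i) => /=; rewrite ?implybF.
- by move=> /negbTE b1 /negbTE b2; rewrite b1 b2 eqxx in bb.
- by move=> /negbTE b1 /negbTE b2; rewrite b1 b2 eqxx in bb.
- by move=> _ _ h1 h2; left; exact: line.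
Qed.

Lemma net_piece_is_piece (gamma : R -> network R) x : network_flow gamma ->
  self_similar (world_sheet gamma) -> @valid_piece (gamma 1) x ->
  exists z, is_piece (net_piece x) z.
Proof.
move=> flow similar okx; have [net _ _ _] := flow; have [pe _] := net 1 ler01.
apply: (kind_is_piece (pe x.1)) => //.
  move=> p /(flow_param flow)[d [J [dom [F [W [pn _ _ _]]]]]].
  by exists d, J, dom, (F^~ 1), W.
by move=> s e e0 De; exact: (expander_equation flow similar e0 De).
Qed.

End NetworkPieces.

(** * The initial condition *)

Section InitialCondition.
Context {R : realType}.

Lemma coord_le_enorm (p : 'rV[R]_2) j : `|p 0 j| <= enorm p.
Proof.
rewrite -(@ler_pXn2r _ 2)// ?nnegrE ?enorm_ge0// real_normK ?num_real// enorm_sqr.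
by move: j; apply: forall_ord2; rewrite ?lerDl ?lerDr sqr_ge0.
Qed.

Lemma coord_le_norm (p : 'rV[R]_2) j : `|p 0 j| <= `|p|.
Proof.
rewrite [leRHS]/Num.Def.normr/= mx_normrE.
exact: (le_bigmax _ (fun i : 'I_1 * 'I_2 => `|p i.1 i.2|) (0, j)).
Qed.

Lemma norm_le_enorm (p : 'rV[R]_2) : `|p| <= enorm p.
Proof.
rewrite [leLHS]/Num.Def.normr/= mx_normrE bigmax_le ?enorm_ge0// => -[i j] _ /=.
by rewrite ord1; exact: coord_le_enorm.
Qed.

Lemma enorm_le_norm (p : 'rV[R]_2) : enorm p <= 2 * `|p|.
Proof.
have h0 := coord_le_norm p 0; have h1 := coord_le_norm p 1.
rewrite -(@ler_pXn2r _ 2)// ?nnegrE ?enorm_ge0 ?mulr_ge0// enorm_sqr.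
have e (j : 'I_2) : p 0 j ^+ 2 <= `|p| ^+ 2.
  by rewrite -real_normK ?num_real// ler_pXn2r ?nnegrE//; exact: coord_le_norm.
have := e 0; have := e 1; rewrite exprMn; have := sqr_ge0 `|p|; lra.
Qed.

Variables (v : 'rV[R]_2) (eta : R).
Hypotheses (eta0 : 0 < eta).

Definition bump (p : 'rV[R]_2) : R := Num.max 0 (eta - `|p - v|).

Lemma bump_ge0 p : 0 <= bump p.
Proof. by rewrite le_max lexx. Qed.

Lemma bump_le p : bump p <= eta.
Proof. by rewrite /bump ge_max ltW//= lerBlDr lerDl. Qed.

Lemma bump_eq0 p : eta <= `|p - v| -> bump p = 0.
Proof. by move=> h; apply/max_idPl; rewrite subr_le0. Qed.

Lemma bump_continuous : continuous bump.
Proof.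
move=> p; have h : {for p, continuous (fun p : 'rV[R]_2 => eta - `|p - v|)}.
  apply: (continuousB (@cst_continuous _ _ eta p)).
  apply: (@continuous_comp _ _ _ (fun p : 'rV[R]_2 => p - v) (fun p : 'rV[R]_2 => `|p|)).
    exact: (continuousB (@cvg_id _ (nbhs p)) (@cst_continuous _ _ v p)).
  exact: norm_continuous.
exact: (continuous_max (@cst_continuous _ _ (0 : R) p) h).
Qed.

Lemma bump_compact_support : exists B : R, forall p, B < enorm p -> bump p = 0.
Proof.
exists (2 * (`|v| + eta)) => p hp; apply: bump_eq0.
have h1 := enorm_le_norm p; have h2 := lerB_dist p v.
by lra.
Qed.

Lemma bump_ray_integral_gt0 : enorm v = 1 ->
  0 < \int[@lebesgue_measure R]_(s in `[0, +oo[) bump (s *: v).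
Proof.
move=> v1.
have n1 : `|v| <= 1 by rewrite -v1; exact: norm_le_enorm.
have n2 : 1 / 2 <= `|v| by have := enorm_le_norm v; rewrite v1; lra.
have dist (s : R) : `|s *: v - v| = `|s - 1| * `|v|.
  by rewrite -[X in _ - X]scale1r -scalerBl normrZ.
pose f := EFin \o (fun s : R => bump (s *: v)).
have mf (A : set (measurableTypeR R)) : measurable A -> measurable_fun A f.
  move=> mA; apply/measurable_EFinP; apply: measurable_funTS.
  apply: continuous_measurable_fun => s.
  apply: (@continuous_comp _ _ _ (fun s : R => s *: v) bump).
    exact: scalel_continuous.
  exact: bump_continuous.
(* Since [fine] of an infinite value is 0, finiteness has to be proved along with positivity. For
   positivity, |v| <= 1 in the sup norm makes [bump] at least eta / 2 for s in [1, 1 + eta / 2]. *)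
rewrite /Rintegral; apply: fine_gt0; apply/andP; split.
  apply: (@lt_le_trans _ _ (\int[lebesgue_measure]_(s in `[1%R, (1 + eta / 2)%R]) f s)%E).
    apply: (@lt_le_trans _ _ (\int[lebesgue_measure]_(s in `[1%R, (1 + eta / 2)%R])
        cst (eta / 2)%:E s)%E).
      rewrite integral_cst//= lebesgue_measure_itv/= lte_fin ltrDl divr_gt0//.
      by rewrite -EFinB -EFinM lte_fin mulr_gt0 ?divr_gt0// addrAC subrr add0r divr_gt0.
    apply: ge0_le_integral => //.
    - by move=> s _; rewrite lee_fin divr_ge0// ltW.
    - exact: mf.
    - move=> s /=; rewrite in_itv/= => /andP[s1 s2]; rewrite lee_fin le_max.
      apply/orP; right; rewrite dist ger0_norm ?subr_ge0//.
      have : (s - 1) * `|v| <= (s - 1) * 1 by rewrite ler_wpM2l// subr_ge0.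
      by lra.
  apply: ge0_subset_integral => //; first exact: mf.
    by move=> s _; rewrite lee_fin bump_ge0.
  move=> s /=; rewrite !in_itv/= andbT => /andP[s1 _]; lra.
(* For s > S the bound |v| >= 1 / 2 puts s v at distance at least eta from v, where [bump] vanishes;
   so the integral is at most eta times the length of [0, S]. *)
pose S := 1 + 2 * eta.
apply: (@le_lt_trans _ _ (\int[lebesgue_measure]_(s in `[0%R, +oo[)
  ((cst eta%:E) \_ `[0%R, S]) s)%E).
  apply: ge0_le_integral => //.
  - by move=> s _; rewrite lee_fin bump_ge0.
  - exact: mf.
  - by apply/measurable_restrict.
  - move=> s /=; rewrite in_itv/= andbT => s0; rewrite patchE.
    case: ifPn => [_|]; first by rewrite lee_fin bump_le.
    rewrite notin_setE /= in_itv/= s0 /= => /negP; rewrite -ltNge => sS.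
    have {}sS : 1 + 2 * eta < s := sS; have s1 : 0 <= s - 1 by move: eta0 sS; lra.
    rewrite lee_fin bump_eq0// dist ger0_norm//.
    have : (s - 1) * (1 / 2) <= (s - 1) * `|v|.
      exact: ler_wpM2l.
    by lra.
rewrite -integral_mkcondr integral_cst//=; last exact: measurableI.
apply: (@le_lt_trans _ _ (eta%:E * lebesgue_measure (`[0%R, S]%classic : set R))%E).
  rewrite lee_pmul2l//.
  by apply: le_measure; rewrite ?inE//; exact: measurableI.
rewrite lebesgue_measure_itv/= lte_fin; case: ifP => _.
  by rewrite -EFinB -EFinM ltry.
by rewrite mule0 ltry.
Qed.

End InitialCondition.

Section Directions.
Context {R : realType}.

Lemma normalize_spacetime (p : 'rV[R]_2) t : 0 < t ->
  normalize (p, t) = sigma ((Num.sqrt t)^-1 *: p).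
Proof.
move=> t0; set q := _ *: p; have r0 : 0 < Num.sqrt t by rewrite sqrtr_gt0.
have m0 := scale_to_sphere_gt0 (quartic_at1_gt0 q).
have -> : (p, t) = dilation (Num.sqrt t / scale_to_sphere (q, 1)) (sigma q).
  rewrite /sigma /normalize dilation_comp divfK ?lt0r_neq0// /dilation /=.
  by rewrite /q scalerA divff ?lt0r_neq0// scale1r mulr1 sqr_sqrtr// ltW.
by rewrite normalize_dilation ?divr_gt0//; exact: sigma_half_sphere.
Qed.

Lemma unit_half_sphere (v : 'rV[R]_2) : enorm v = 1 -> half_sphere (v, 0 : R).
Proof.
move=> v1; split => //=; have := enorm_sqr v; rewrite v1 dotE -!expr2 => <-.
by rewrite !expr1n expr0n addr0.
Qed.

(* If [(u k, 0)] were missed, a bump around [u k] would have zero length integral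
   on [gamma t] for small [t] and a positive one on the half-lines. *)
Lemma initial_direction_mem (m : nat) (u : 'I_m -> 'rV[R]_2) (gamma : R -> network R)
    (K : set ('rV[R]_2 * R)) (k : 'I_m) : (forall k, enorm (u k) = 1) ->
  self_similar (world_sheet gamma) -> initial_condition gamma u -> closed K ->
  (forall p, net_support (gamma 1) p -> K (sigma p)) -> K (u k, 0).
Proof.
move=> u1 similar [_ init] cK hK; apply: contrapT => nK.
have hu := unit_half_sphere (u1 k).
have nu : normalize (u k, 0) = (u k, 0).
  by have := normalize_dilation ltr01 hu; rewrite dilation1.
have nn : nbhs (u k, 0 : R) (normalize @^-1` (~` K)).
  apply: normalize_continuous; first exact: quartic_gt0 (half_sphere_neq0 hu).
  by rewrite nu; apply: open_nbhs_nbhs; split => //; exact: closed_openC.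
have /nbhs_ballP[eta /= eta0 heta] := nn.
have [B hB] := bump_compact_support (u k) eta.
have := init (bump (u k) eta) (@bump_continuous _ _ _) (ex_intro _ B hB).
have zero : \forall t \near 0^'+, length_integral (gamma t) (bump (u k) eta) = 0.
  near=> t; have t0 : 0 < t by near: t; exact: nbhs_right_gt.
  have te : t < eta by near: t; exact: nbhs_right_lt.
  rewrite /length_integral big1// => i _.
  rewrite (@eq_Rintegral _ _ _ _ _ (fun=> 0)) ?Rintegral_cst ?mul0r//.
    by case: (net_kind i) => /=; [exact: measurable_itv|exact: measurable_itv|exact: measurableT].
  move=> s; rewrite inE => Ds; rewrite bump_eq0 ?mul0r// leNgt; apply/negP => he.
  (* The ball around (u k, 0) normalizes into the complement of K, whereas a point of gamma t
     normalizes to [sigma] of a point of gamma 1. *)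
  have [] := heta (net_curve i s, t).
    split; last by rewrite /ball/= sub0r normrN gtr0_norm.
    by rewrite -ball_normE /= distrC.
  rewrite /= normalize_spacetime//; apply: hK.
  apply/(support_self_similar similar _ t0).
  by exists i => //; exists s.
move=> lim; have pos : 0 < half_lines_integral u (bump (u k) eta).
  rewrite /half_lines_integral (bigD1 k)//= ltr_pwDl//.
    exact: bump_ray_integral_gt0.
  by apply: sumr_ge0 => j _; apply: Rintegral_ge0 => s _; exact: bump_ge0.
have lim0 : length_integral (gamma t) (bump (u k) eta) @[t --> 0^'+] --> (0 : R).
  apply: cvg_trans (near_eq_cvg _) (cvg_cst 0).
  by apply: filterS zero => t ->.
have e := cvg_unique (@norm_hausdorff _ _) lim lim0.
by rewrite e ltxx in pos.
Unshelve. all: by end_near. Qed.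

End Directions.

(** * Closures in the blowup *)

Section Cylinders.
Context {R : realType}.
Local Notation spacetime := ('rV[R]_2 * R)%type.

Lemma cylinder_closed (V : normedModType R) (K : set V) : closed K -> closed (cylinder K).
Proof.
move=> cK; rewrite (_ : cylinder K = fst @^-1` [set x : R | 0 <= x] `&` snd @^-1` K)//.
apply: closedI.
  by apply: preimage_closed; [move=> z _; exact: cvg_fst|exact: closed_ge].
by apply: preimage_closed => // z _; exact: cvg_snd.
Qed.

(** Each half-line [0, oo) x {w} is joined to the connected base {0} x K. *)
Lemma cylinder_connected (V : normedModType R) (K : set V) :
  connected K -> connected (cylinder K).
Proof.
move=> conK; have [[w0 Kw0]|K0] := pselect (K !=set0); last first.
  rewrite (_ : cylinder K = set0); first exact: connected0.
  by apply/seteqP; split => // q [_ Kq]; apply: K0; exists q.2.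
pose ray (w : V) : set (R * V) := (fun a : R => (a, w)) @` `[0, +oo[%classic.
pose base : set (R * V) := (fun w : V => (0, w)) @` K.
rewrite (_ : cylinder K = \bigcup_(w in K) (ray w `|` base)); last first.
  apply/seteqP; split => [[a w] [/= a0 Kw]|q [w Kw [h|h]]].
  - by exists w => //; left; exists a => //=; rewrite in_itv/= a0.
  - by case: h => a /=; rewrite in_itv/= andbT => a0 <-.
  - by case: h => w' Kw' <-; split => /=.
apply: bigcup_connected.
  by exists (0, w0) => w Kw; right; exists w0.
move=> w Kw; apply: connectedU.
- exists (0, w); split; last by exists w.
  by exists 0 => //=; rewrite in_itv/= lexx.
- apply: connected_continuous_connected.
    exact/connected_intervalP/interval_is_interval.
  apply: continuous_subspaceT => a.
  exact: (cvg_pair (@cvg_id _ (nbhs a)) (@cst_continuous _ _ w a)).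
- apply: connected_continuous_connected => //.
  apply: continuous_subspaceT => z.
  exact: (cvg_pair (@cst_continuous _ _ (0 : R) z) (@cvg_id _ (nbhs z))).
Qed.

Lemma cylinder_set1_corner_submanifold (V : normedModType R) (w : V) :
  corner_submanifold 1 (cylinder [set w]).
Proof.
move=> [a p] [/= a0 ->].
exists setT, (fun x : 'rV[R]_1 => (x 0 0, w)); split.
- split; first exact: openT.
  have := @smooth_cylinder R V 0 setT (fun=> w) 0 openT (fun k => Ck1_cst k w openT).
  by [].
- exists (\row_(i < 1) a); last by rewrite mxE.
  by split => // i; rewrite mxE.
- by move=> x y _ _ [e]; apply/rowP => i; rewrite ord1.
- move=> x _ _ v v0.
  have := @derive_cylinder R V 0 setT (fun=> w) 0 openT (fun k => Ck1_cst k w openT) x v I.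
  move=> ->; apply/eqP => /(congr1 fst) /= e; move/eqP: v0; apply.
  by apply/rowP => i; rewrite ord1 e mxE.
move=> A oA _; exists [set q : R * V | A (\row_(i < 1) q.1)].
  apply: (@open_comp _ _ (fun q : R * V => \row_(i < 1) q.1) A) => //.
  move=> q _; apply: cvg_row => i.
  by under eq_fun do rewrite mxE; rewrite mxE; exact: cvg_fst.
apply/seteqP; split => [_ [x [Ax cx] <-]|[b p'] [[/= b0 ->] Ab]].
  split; first by split => //; exact: cx.
  rewrite /= (_ : \row_(i < 1) x 0 0 = x)//.
  by apply/rowP => i; rewrite mxE ord1.
exists (\row_(i < 1) b); last by rewrite mxE.
by split => // i; rewrite mxE.
Qed.

Lemma cylinder_blowup (K : set spacetime) : K `<=` @half_sphere R ->
  cylinder K `<=` @blowup R.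
Proof. by move=> KS q [q0 /KS]. Qed.

(** By hypothesis A contains the orbit of a point of the half-sphere entirely or not at all, so in
    the product its lift is ]0, oo[ times a set. *)
Lemma blowup_closure_cone (A B : set spacetime) :
  (forall (a : R) z, 0 < a -> half_sphere z -> A (dilation a z) <-> B z) ->
  blowup_closure A = cylinder (closure (B `&` @half_sphere R)).
Proof.
move=> AB; have liftE q : blowup_lift A q <-> 0 < q.1 /\ (B `&` @half_sphere R) q.2.
  split=> [[[q1 hq] q0 Aq]|[q0 [Bq hq]]].
    by split => //; split => //; apply/(AB q.1).
  by split => //; [split => //; exact: ltW|apply/AB].
have clS z : closure (B `&` @half_sphere R) z -> half_sphere z.
  move=> h; rewrite (closure_id (@half_sphere R)).1; last exact: half_sphere_closed.
  by apply: closure_subset h => y [].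
apply/seteqP; split => [q [clq [q1 hq]]|[a z] [/= a0 clz]].
  split => // U nU; have nq : nbhs q (snd @^-1` U) by exact: cvg_snd.
  have [q' [/liftE[_ Bq'] Uq']] := clq _ nq.
  by exists q'.2.
split; last by split => //; exact: clS.
move=> U [[U1 U2] [/= n1 n2] hU].
have /nbhs_ballP[r /= r0 hr] := n1.
have [z' [Bz' Uz']] := clz _ n2.
(* The first factor is moved into ]0, oo[, as a may be 0. *)
exists (a + r / 2, z'); split.
  by apply/liftE; split => //=; rewrite ltr_wpDl// divr_gt0.
apply: hU; split => //=; apply: hr; rewrite /ball/= opprD addrA subrr sub0r normrN.
by rewrite gtr0_norm; lra.
Qed.

Lemma blowup_orbitE (w : spacetime) : half_sphere w ->
  blowup_orbit w = cylinder [set w].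
Proof.
move=> hw; rewrite /blowup_orbit (@blowup_closure_cone _ [set w]).
  congr cylinder; rewrite (_ : _ `&` _ = [set w]).
    rewrite -(closure_id _).1//; apply: compact_closed; first exact: norm_hausdorff.
    exact: compact_set1.
  by apply/seteqP; split => [z []//|_ ->].
move=> a z a0 hz; split => [[b /= b0 e]|->]; last by exists a.
by have [_ ->] := half_sphere_dilation_inj b0 a0 hw hz e.
Qed.

End Cylinders.

(** * Assembly of the surfaces and their intersections *)

Section Assembly.
Context {R : realType}.
Local Notation spacetime := ('rV[R]_2 * R)%type.

(** The surfaces are the products [0, oo) x K i, so two of them meet in the orbits of the common
    points of K i and K j, and [b] provides a finite list containing these. *)
Lemma assemble_pieces (I : finType) (B : finType) (P : I -> set 'rV[R]_2)
    (v : I -> spacetime) (b : I -> B -> spacetime) :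
  (forall i, is_piece (P i) (v i)) ->
  (forall i j z, i != j -> sphere_closure (P i) z -> sphere_closure (P j) z ->
    exists a, z = b i a) ->
  exists (n : nat) (M : 'I_n -> set (R * spacetime))
         (l : nat) (E : 'I_l -> set (R * spacetime)),
    [/\ cylinder (\bigcup_i sphere_closure (P i)) = \bigcup_i M i,
        forall i, smooth_surface (M i),
        forall i i' : 'I_n, i != i' ->
          exists A : set 'I_l, M i `&` M i' = \bigcup_(j in A) E j,
        forall j, exists i i' : 'I_n, i != i' /\ E j `<=` M i `&` M i' &
        forall j, smooth_curve (E j) /\
          exists q : spacetime,
            [/\ 0 <= q.2, q != (0, 0) & E j = blowup_orbit q]].
Proof.
move=> pieceP meet; pose K i := sphere_closure (P i).
(* A candidate [b i a] may fail to lie on a second piece. Only shared candidates are retained,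
   because each orbit E j has to lie in an intersection of two surfaces. *)
pose special (x : I * B) := `[< exists2 y, y != x.1 & K x.1 (b x.1 x.2) /\ K y (b x.1 x.2) >].
pose S := {x : I * B | special x}.
pose pt (s : S) : spacetime := b (val s).1 (val s).2.
have ptP (s : S) : exists i j, [/\ i != j, K i (pt s) & K j (pt s)].
  have /asboolP[y yx [h1 h2]] := valP s.
  by exists (val s).1, y; rewrite eq_sym.
have pt_sphere (s : S) : half_sphere (pt s).
  have [i [_ [_ h _]]] := ptP s; exact: sphere_closure_half_sphere h.
exists #|I|, (fun i => cylinder (K (enum_val i))), #|{: S}|,
  (fun j => cylinder [set pt (enum_val j)]); split.
- apply/seteqP; split => [q [q0 [i _ Ki]]|q [i _ [q0 Ki]]].
    by exists (enum_rank i) => //; split => //; rewrite enum_rankK.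
  by split => //; exists (enum_val i).
- move=> i; have pi := pieceP (enum_val i); split.
  + exact/cylinder_blowup/sphere_closure_half_sphere.
  + exact/cylinder_closed/closed_closure.
  + have [_ [p Pp] _ _ _] := pi; exists (0, sigma p); split => //=.
    by apply: subset_closure; exists p.
  + exact/cylinder_connected/(piece_connected pi).
  + by apply: cylinder_corner_submanifold => z; exact: (piece_charts pi).
- move=> i i' ii'; have ne : enum_val i != enum_val i'.
    by apply: contra ii' => /eqP/enum_val_inj ->.
  exists [set j | K (enum_val i) (pt (enum_val j)) /\ K (enum_val i') (pt (enum_val j))].
  apply/seteqP; split => [[a z] [[/= a0 Kz] [_ /= Kz']]|[a z] [j [/= h1 h2] [/= q0 ->]]]; last by [].
  have [c zc] := meet _ _ _ ne Kz Kz'.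
  have sp : special (enum_val i, c).
    by apply/asboolP; exists (enum_val i'); rewrite /= -?zc// eq_sym.
  pose s : S := exist _ (enum_val i, c) sp.
  by exists (enum_rank s); rewrite /= enum_rankK /pt /= -zc.
- move=> j; have [i [i' [ne h1 h2]]] := ptP (enum_val j).
  exists (enum_rank i), (enum_rank i'); split.
    by apply: contra ne => /eqP/enum_rank_inj ->.
  by move=> [a z] [/= q0 ->]; rewrite !enum_rankK.
- move=> j; set w := pt (enum_val j); have hw : half_sphere w by exact: pt_sphere.
  split.
    split.
    + by apply: cylinder_blowup => _ ->.
    + apply: cylinder_closed; apply: compact_closed; first exact: norm_hausdorff.
      exact: compact_set1.
    + by exists (0, w).
    + exact/cylinder_connected/connected1.
    + exact: cylinder_set1_corner_submanifold.
  by exists w; split; [case: hw|exact: half_sphere_neq0|rewrite blowup_orbitE].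
Qed.

Lemma world_sheet_sphere (gamma : R -> network R) (m : nat) (u : 'I_m -> 'rV[R]_2) z :
  (forall k, enorm (u k) = 1) -> self_similar (world_sheet gamma) ->
  net_support (gamma 0) = half_lines u -> half_sphere z -> world_sheet gamma z ->
  (exists2 p, net_support (gamma 1) p & z = sigma p) \/ exists k, z = (u k, 0).
Proof.
move=> u1 similar supp0 hz; case: z hz => p t hz [/= t0 ws].
move: t0; rewrite le_eqVlt => /predU1P[t0|t0]; last first.
  left; exists (sigma_inv (p, t)); last by rewrite sigma_invK.
  exact/(support_self_similar similar _ t0).
right; move: ws hz; rewrite -t0 supp0 => -[k [s [s0 ->]]] [_] /=.
rewrite dotZ expr0n addr0 => h.
have uu : dot (u k) (u k) = 1 by have := enorm_sqr (u k); rewrite u1 dotE -!expr2 => <-; rewrite expr1n.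
(* At t = 0 the equation of S reduces to s^4 = 1, and s >= 0 gives s = 1. *)
exists k; move: h; rewrite uu mulr1 -exprM => /eqP.
by rewrite pexpr_eq1// => /eqP ->; rewrite scale1r.
Qed.

End Assembly.

Theorem proposition4p1 (R : realType) (m : nat) (u : 'I_m -> 'rV[R]_2)
    (u_unit : forall k, enorm (u k) = 1) (u_inj : injective u)
    (gamma : R -> network R)
    (gamma_flow : network_flow gamma)
    (gamma_self_similar : self_similar (world_sheet gamma))
    (gamma_init : initial_condition gamma u) :
  exists (n : nat) (M : 'I_n -> set (R * ('rV[R]_2 * R)))
         (l : nat) (E : 'I_l -> set (R * ('rV[R]_2 * R))),
    [/\ blowup_closure (world_sheet gamma `\ (0, 0)) = \bigcup_i M i,
        forall i, smooth_surface (M i),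
        forall i i' : 'I_n, i != i' ->
          exists A : set 'I_l, M i `&` M i' = \bigcup_(j in A) E j,
        forall j, exists i i' : 'I_n, i != i' /\ E j `<=` M i `&` M i' &
        forall j, smooth_curve (E j) /\
          exists q : 'rV[R]_2 * R,
            [/\ 0 <= q.2, q != (0, 0) & E j = blowup_orbit q]].
Proof.
pose N := gamma 1; pose I := {x : 'I_(net_size N) * bool | valid_piece x}.
have ex (i : I) : exists z, is_piece (net_piece (val i)) z.
  exact: net_piece_is_piece (valP i).
have [v piece_v] := choice ex.
pose P (i : I) := net_piece (val i).
(* Candidates for points that piece i shares with others: its curve at the parameters 0 and 1, which
   cover ends and cuts, and its limit on the boundary circle. *)
pose b (i : I) (a : 'I_3) : 'rV[R]_2 * R :=
  nth (v i) [:: sigma (net_curve (val i).1 0); sigma (net_curve (val i).1 1); v i] a.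
have meet i j z : i != j -> sphere_closure (P i) z -> sphere_closure (P j) z ->
    exists a, z = b i a.
  move=> ij Ki Kj; have [z2 _] := sphere_closure_half_sphere Ki.
  move: z2; rewrite le_eqVlt => /predU1P[z2|z2].
    have [_ _ _ _ h] := piece_v i; have [-> _] := h z Ki (esym z2).
    by exists (inord 2); rewrite /b inordK.
  have [ci _ _ _ _] := piece_v i; have [cj _ _ _ _] := piece_v j.
  have [p Pp pz] := (sphere_closure_gt0 ci z2).1 Ki.
  have [q Pq qz] := (sphere_closure_gt0 cj z2).1 Kj.
  have pq : p = q by apply: (can_inj sigmaK); rewrite pz qz.
  have [net _ _ _] := gamma_flow.
  have ij' : val i != val j by [].
  rewrite -pq in Pq.
  have [e|e] := net_pieces_meet (net 1 ler01) (valP i) (valP j) ij' Pp Pq.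
    by exists (inord 0); rewrite /b inordK//= -e pz.
  by exists (inord 1); rewrite /b inordK//= -e pz.
have [n [M [l [E [h1 h2 h3 h4 h5]]]]] := assemble_pieces piece_v meet.
exists n, M, l, E; split => //; rewrite -h1.
(* A dilation with a > 0 sends no point of the half-sphere to the deleted origin, and
   self-similarity makes membership independent of a. *)
rewrite (@blowup_closure_cone _ _ (world_sheet gamma)); last first.
  move=> a z a0 hz; split=> [[ws _]|ws].
    have : (dilation a @` world_sheet gamma) (dilation a z) by rewrite gamma_self_similar.
    move=> [y wy /(congr1 (dilation a^-1))].
    by rewrite !dilation_comp mulVf ?lt0r_neq0// !dilation1 => <-.
  split; first by rewrite -(gamma_self_similar a a0); exists z.
  move=> /(congr1 (dilation a^-1)); rewrite dilation_comp mulVf ?lt0r_neq0// dilation1.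
  move=> e; have := half_sphere_neq0 hz; rewrite e /dilation /= scaler0 mulr0.
  by rewrite eqxx.
congr cylinder.
have cK : closed (\bigcup_i sphere_closure (P i)).
  apply: closed_bigcup; last by move=> i _; exact: closed_closure.
  exact: finite_finset.
have suppK p : net_support N p -> (\bigcup_i sphere_closure (P i)) (sigma p).
  move=> /net_support_pieces[x okx px]; exists (exist _ x okx) => //.
  by apply: subset_closure; exists p.
have [supp0 _] := gamma_init.
(* A point of the world-sheet on S is [sigma] of a point of gamma 1 or a direction (u k, 0); the
   initial condition places the latter in the closed union of pieces. *)
apply/seteqP; split.
  rewrite [X in _ `<=` X](closure_id _).1//; apply: closure_subset => z [ws hz].
  have [[p Np ->]|[k ->]] := world_sheet_sphere u_unit gamma_self_similar supp0 hz ws.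
    exact: suppK.
  exact: (initial_direction_mem k u_unit gamma_self_similar gamma_init cK suppK).
move=> z [i _]; apply: closure_subset => _ [p Pp <-].
split; last exact: sigma_half_sphere.
have Np : net_support N p.
  by apply/net_support_pieces; exists (val i) => //; exact: valP.
have w1 : world_sheet gamma (p, 1) by split => //=; exact: ler01.
have m0 := scale_to_sphere_gt0 (quartic_at1_gt0 p).
by rewrite -(gamma_self_similar _ m0); exists (p, 1).
Qed.
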